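(* Let $u=(u_0,u_1,u_2)\in L_2^{n_0}[x,y]\times H_1^{n_1}[x,y]\times H_2^{n_2}[x,y]$ on $[a,b]\times[c,d]$. Then $$\Lambda_{\mathrm{bf}}u=\mathcal H_1\Lambda_{\mathrm{bc}}u+\mathcal H_2\hat u,\qquad\hat u=\mathcal Du,$$ where $\mathcal D$, $\Lambda_{\mathrm{bc}}$, $\Lambda_{\mathrm{bf}}$, $\mathcal H_1$, $\mathcal H_2$ are the operators defined in the context.
   Context: $a<b$, $c<d$. $H_k^m[x,y]=\{u:\partial_x^{\alpha_1}\partial_y^{\alpha_2}u\in L_2^m([a,b]\times[c,d])\ \forall\,\max(\alpha_1,\alpha_2)\le k\}$ (weak derivatives; point values and restrictions to boundary lines in the trace sense/continuous representative). $\mathcal Du=(u_0,\ \partial_x\partial_yu_1,\ \partial_x^2\partial_y^2u_2)$. $\Lambda_{\mathrm{bc}}u=(v_0,v_1,v_2)\in\mathbb R^{n_1+4n_2}\times L_2^{n_1+2n_2}[a,b]\times L_2^{n_1+2n_2}[c,d]$ with $v_0=(u_1,u_2,\partial_xu_2,\partial_yu_2,\partial_x\partial_yu_2)(a,c)$, $v_1(x)=(\partial_xu_1,\partial_x^2u_2,\partial_x^2\partial_yu_2)(x,c)$, $v_2(y)=(\partial_yu_1,\partial_y^2u_2,\partial_x\partial_y^2u_2)(a,y)$. $\Lambda_{\mathrm{bf}}u=(w_0,w_1,w_2)\in\mathbb R^{4n_1+16n_2}\times L_2^{2n_1+4n_2}[a,b]\times L_2^{2n_1+4n_2}[c,d]$: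 let $\Lambda_1f=(f(a,c),f(b,c),f(a,d),f(b,d))$, $(\Lambda_2f)(x)=(f(x,c),f(x,d))$, $(\Lambda_3f)(y)=(f(a,y),f(b,y))$; then $w_0=(\Lambda_1u_1,\Lambda_1u_2,\Lambda_1\partial_xu_2,\Lambda_1\partial_yu_2,\Lambda_1\partial_x\partial_yu_2)$, $w_1=(\Lambda_2\partial_xu_1,\Lambda_2\partial_x^2u_2,\Lambda_2\partial_x^2\partial_yu_2)$, $w_2=(\Lambda_3\partial_yu_1,\Lambda_3\partial_y^2u_2,\Lambda_3\partial_x\partial_y^2u_2)$. $\mathcal H_1(v_0,v_1,v_2)=\big(H_{00}v_0+\int_a^bH_{01}(x)v_1(x)dx+\int_c^dH_{02}(y)v_2(y)dy,\ H_{11}v_1(x),\ H_{22}v_2(y)\big)$, $\mathcal H_2\hat u=\big(\int_a^b\int_c^dH_{03}(x,y)\hat u(x,y)dydx,\ \int_c^dH_{13}(y)\hat u(x,y)dy,\ \int_a^bH_{23}(x)\hat u(x,y)dx\big)$. In the following matrices, each column-vector entry in the first block row is to be read as (vector)$\otimes I_{n_1}$ and in the other block rows as (vector)$\otimes I_{n_2}$. Put $e=(1,1,1,1)^T$, $p=(0,b-a,0,b-a)^T$, $g'=(0,0,d-c,d-c)^T$, $m=(0,0,0,(d-c)(b-a))^T$, $f=(0,1,0,1)^T$, $f_d=(0,0,0,d-c)^T$, $g=(0,0,1,1)^T$, $g_b=(0,0,0,b-a)^T$, $h=(0,0,0,1)^T$, $s=(1,1)^T$, $t=(0,1)^T$.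 Then $$H_{00}=\begin{bmatrix}e&0&0&0&0\\0&e&p&g'&m\\0&0&e&0&g'\\0&0&0&e&p\\0&0&0&0&e\end{bmatrix},\ H_{01}(x)=\begin{bmatrix}f&0&0\\0&(b-x)f&(b-x)f_d\\0&f&f_d\\0&0&(b-x)f\\0&0&f\end{bmatrix},\ H_{02}(y)=\begin{bmatrix}g&0&0\\0&(d-y)g&(d-y)g_b\\0&0&(d-y)g\\0&g&g_b\\0&0&g\end{bmatrix},$$ $$H_{03}(x,y)=\begin{bmatrix}0&h&0\\0&0&(d-y)(b-x)h\\0&0&(d-y)h\\0&0&(b-x)h\\0&0&h\end{bmatrix},\quad H_{11}=\begin{bmatrix}s&0&0\\0&s&(d-c)t\\0&0&s\end{bmatrix},\quad H_{22}=\begin{bmatrix}s&0&0\\0&s&(b-a)t\\0&0&s\end{bmatrix},$$ $$H_{13}(y)=\begin{bmatrix}0&t&0\\0&0&(d-y)t\\0&0&t\end{bmatrix},\quad H_{23}(x)=\begin{bmatrix}0&t&0\\0&0&(b-x)t\\0&0&t\end{bmatrix},$$ where the columns of $H_{03},H_{13},H_{23}$ have block widths $n_0,n_1,n_2$, those of $H_{00}$ widths $n_1,n_2,n_2,n_2,n_2$, and those of $H_{01},H_{02},H_{11},H_{22}$ widths $n_1,n_2,n_2$. *)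

(* Defs.v *)
From HB Require Import structures.
From mathcomp Require Import all_boot all_order all_algebra.
From mathcomp Require Import all_classical all_reals all_analysis.
Set Implicit Arguments.
Unset Strict Implicit.
Unset Printing Implicit Defensive.
Import Order.TTheory GRing.Theory Num.Theory.
Import numFieldNormedType.Exports.
Local Open Scope classical_set_scope.
Local Open Scope ring_scope.

Definition leb1 {R : realType} := @lebesgue_measure R.
Definition leb2 {R : realType} := (@leb1 R \x @leb1 R)%E.

(* The library's L^2 consists of functions on the whole space: a function on a
   subset is tested through its extension by zero. *)
Definition L2 {R : realType} (s t : R) : set (R -> R) :=
  [set f | f \_ `[s, t] \in Lfun leb1 2%:E].

Definition dx {R : realType} (phi : R * R -> R) : R * R -> R := 'D_(1, 0) phi.
Definition dy {R : realType} (phi : R * R -> R) : R * R -> R := 'D_(0, 1) phi.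

(* C^oo: the partial derivatives of every order, taken in every order, exist
   and are continuous; equivalently, they are all differentiable. *)
Definition smooth {R : realType} (phi : R * R -> R) :=
  forall (w : seq bool) (z : R * R),
    differentiable (foldr (fun i f => if i then dx f else dy f) phi w) z.

Section rectangle.
Context {R : realType} (a b c d : R).
Implicit Types (u v phi : R * R -> R).

Definition rect : set (R * R) := `[a, b] `*` `[c, d].

Definition L2_rect : set (R * R -> R) :=
  [set f | f \_ rect \in Lfun leb2 2%:E].

Definition test_function phi :=
  [/\ smooth phi, compact (closure [set z | phi z != 0]) &
      closure [set z | phi z != 0] `<=` `]a, b[ `*` `]c, d[].

(* v is the weak derivative of u of order i in x and j in y, and lies in L^2. *)
Definition is_weak_derivative (i j : nat) u v :=
  L2_rect v /\
  forall phi, test_function phi ->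
    \int[leb2]_(z in rect) (u z * iter i dx (iter j dy phi) z) =
    (-1) ^+ (i + j) * \int[leb2]_(z in rect) (v z * phi z).

Definition weak_derivative (i j : nat) u : R * R -> R :=
  xget (fun=> 0) [set v | is_weak_derivative i j u v].

Definition sobolev (k : nat) : set (R * R -> R) :=
  [set u | L2_rect u /\
     forall i j, (maxn i j <= k)%N -> exists v, is_weak_derivative i j u v].

(* t is the value at z0 of the continuous representative of u. *)
Definition is_point_value u (z0 : R * R) (t : R) :=
  exists g : R * R -> R,
    [/\ ae_eq leb2 rect g u, {within rect, continuous g} & g z0 = t].

Definition point_value u (z0 : R * R) : R :=
  xget 0 [set t | is_point_value u z0 t].

(* w is the trace of u on the line y = y0: the restriction to this line of the
   representative of u that is continuous in y for almost every x. It is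
   determined by the class of u up to a null set of x. *)
Definition is_xtrace u (y0 : R) (w : R -> R) :=
  L2 a b w /\
  exists2 g : R * R -> R, ae_eq leb2 rect g u &
    {ae leb1, forall x, x \in `[a, b] ->
       {within `[c, d], continuous (fun y => g (x, y))} /\ g (x, y0) = w x}.

Definition xtrace u (y0 : R) : R -> R :=
  xget (fun=> 0) [set w | is_xtrace u y0 w].

(* The same on the line x = x0. *)
Definition is_ytrace u (x0 : R) (w : R -> R) :=
  L2 c d w /\
  exists2 g : R * R -> R, ae_eq leb2 rect g u &
    {ae leb1, forall y, y \in `[c, d] ->
       {within `[a, b], continuous (fun x => g (x, y))} /\ g (x0, y) = w y}.

Definition ytrace u (x0 : R) : R -> R :=
  xget (fun=> 0) [set w | is_ytrace u x0 w].

(* For vector-valued functions everything is taken coordinatewise: wD, pt, xtr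
   and ytr are weak derivatives, point values and traces on y = y0, x = x0. *)
Definition coordinate n (u : R * R -> 'cV[R]_n) (k : 'I_n) : R * R -> R :=
  fun z => u z k 0.

Definition L2v n : set (R * R -> 'cV[R]_n) :=
  [set u | forall k, L2_rect (coordinate u k)].

Definition sobolevv (k n : nat) : set (R * R -> 'cV[R]_n) :=
  [set u | forall l, sobolev k (coordinate u l)].

Definition wD (i j : nat) n (u : R * R -> 'cV[R]_n) : R * R -> 'cV[R]_n :=
  fun z => \col_k weak_derivative i j (coordinate u k) z.

Definition pt n (u : R * R -> 'cV[R]_n) (x0 y0 : R) : 'cV[R]_n :=
  \col_k point_value (coordinate u k) (x0, y0).

Definition xtr n (u : R * R -> 'cV[R]_n) (y0 : R) : R -> 'cV[R]_n :=
  fun x => \col_k xtrace (coordinate u k) y0 x.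

Definition ytr n (u : R * R -> 'cV[R]_n) (x0 : R) : R -> 'cV[R]_n :=
  fun y => \col_k ytrace (coordinate u k) x0 y.

End rectangle.

Definition intv {R : realType} (s t : R) n (F : R -> 'cV[R]_n) : 'cV[R]_n :=
  \col_k \int[leb1]_(r in `[s, t]) (F r k 0).

Section blocks.
Context {R : realType}.

Definition vec (k : nat) (s : seq R) : 'cV[R]_k := \col_i s`_i.

(* The Kronecker product of v with the identity matrix of size n. *)
Definition kronI k (v : 'cV[R]_k) n : 'M[R]_(\sum_(i < k) n, n) :=
  \mxcol_(i < k) (v i 0)%:M.

Definition row3 m p1 p2 p3 (A1 : 'M[R]_(m, p1)) (A2 : 'M[R]_(m, p2))
    (A3 : 'M[R]_(m, p3)) : 'M[R]_(m, p1 + (p2 + p3)) :=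
  row_mx A1 (row_mx A2 A3).

Definition row5 m p1 p2 p3 p4 p5 (A1 : 'M[R]_(m, p1)) (A2 : 'M[R]_(m, p2))
    (A3 : 'M[R]_(m, p3)) (A4 : 'M[R]_(m, p4)) (A5 : 'M[R]_(m, p5)) :
    'M[R]_(m, p1 + (p2 + (p3 + (p4 + p5)))) :=
  row_mx A1 (row_mx A2 (row_mx A3 (row_mx A4 A5))).

Definition col3 p m1 m2 m3 (A1 : 'M[R]_(m1, p)) (A2 : 'M[R]_(m2, p))
    (A3 : 'M[R]_(m3, p)) : 'M[R]_(m1 + (m2 + m3), p) :=
  col_mx A1 (col_mx A2 A3).

Definition col5 p m1 m2 m3 m4 m5 (A1 : 'M[R]_(m1, p)) (A2 : 'M[R]_(m2, p))
    (A3 : 'M[R]_(m3, p)) (A4 : 'M[R]_(m4, p)) (A5 : 'M[R]_(m5, p)) :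
    'M[R]_(m1 + (m2 + (m3 + (m4 + m5))), p) :=
  col_mx A1 (col_mx A2 (col_mx A3 (col_mx A4 A5))).

End blocks.

Section operators.
Context {R : realType} (a b c d : R) (n0 n1 n2 : nat).

Definition state : Type :=
  (R * R -> 'cV[R]_n0) * (R * R -> 'cV[R]_n1) * (R * R -> 'cV[R]_n2).

Definition size3 (p q : nat) : nat := (p + (q + q))%N.
Definition size5 (p q : nat) : nat := (p + (q + (q + (q + q))))%N.
Definition mult (k n : nat) : nat := (\sum_(i < k) n)%N.

Definition size_hat : nat := (n0 + (n1 + n2))%N.
Definition size_bc0 : nat := size5 n1 n2.
Definition size_bc1 : nat := size3 n1 n2.
Definition size_bf0 : nat := size5 (mult 4 n1) (mult 4 n2).
Definition size_bf1 : nat := size3 (mult 2 n1) (mult 2 n2).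

Definition bc_data : Type :=
  'cV[R]_size_bc0 * (R -> 'cV[R]_size_bc1) * (R -> 'cV[R]_size_bc1).
Definition bf_data : Type :=
  'cV[R]_size_bf0 * (R -> 'cV[R]_size_bf1) * (R -> 'cV[R]_size_bf1).

Local Notation wD := (wD a b c d).
Local Notation pt := (pt a b c d).
Local Notation xtr := (xtr a b c d).
Local Notation ytr := (ytr a b c d).

Definition Dop (u : state) : R * R -> 'cV[R]_size_hat :=
  let '(u0, u1, u2) := u in
  fun z => col3 (u0 z) (wD 1 1 u1 z) (wD 2 2 u2 z).

Definition Lambda_bc (u : state) : bc_data :=
  let '(u0, u1, u2) := u in
  (col5 (pt u1 a c) (pt u2 a c) (pt (wD 1 0 u2) a c) (pt (wD 0 1 u2) a c)
     (pt (wD 1 1 u2) a c),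
   fun x => col3 (xtr (wD 1 0 u1) c x) (xtr (wD 2 0 u2) c x)
              (xtr (wD 2 1 u2) c x),
   fun y => col3 (ytr (wD 0 1 u1) a y) (ytr (wD 0 2 u2) a y)
              (ytr (wD 1 2 u2) a y)).

Definition Lambda1 n (f : R * R -> 'cV[R]_n) : 'cV[R]_(mult 4 n) :=
  \mxcol_(i < 4) [:: pt f a c; pt f b c; pt f a d; pt f b d]`_i.

Definition Lambda2 n (f : R * R -> 'cV[R]_n) (x : R) : 'cV[R]_(mult 2 n) :=
  \mxcol_(i < 2) [:: xtr f c x; xtr f d x]`_i.

Definition Lambda3 n (f : R * R -> 'cV[R]_n) (y : R) : 'cV[R]_(mult 2 n) :=
  \mxcol_(i < 2) [:: ytr f a y; ytr f b y]`_i.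

Definition Lambda_bf (u : state) : bf_data :=
  let '(u0, u1, u2) := u in
  (col5 (Lambda1 u1) (Lambda1 u2) (Lambda1 (wD 1 0 u2)) (Lambda1 (wD 0 1 u2))
     (Lambda1 (wD 1 1 u2)),
   fun x => col3 (Lambda2 (wD 1 0 u1) x) (Lambda2 (wD 2 0 u2) x)
              (Lambda2 (wD 2 1 u2) x),
   fun y => col3 (Lambda3 (wD 0 1 u1) y) (Lambda3 (wD 0 2 u2) y)
              (Lambda3 (wD 1 2 u2) y)).

Let e := vec 4 [:: 1; 1; 1; 1] : 'cV[R]_4.
Let p := vec 4 [:: 0; b - a; 0; b - a].
Let g' := vec 4 [:: 0; 0; d - c; d - c].
Let m := vec 4 [:: 0; 0; 0; (d - c) * (b - a)].
Let f := vec 4 [:: 0; 1; 0; 1] : 'cV[R]_4.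
Let f_d := vec 4 [:: 0; 0; 0; d - c].
Let g := vec 4 [:: 0; 0; 1; 1] : 'cV[R]_4.
Let g_b := vec 4 [:: 0; 0; 0; b - a].
Let h := vec 4 [:: 0; 0; 0; 1] : 'cV[R]_4.
Let s := vec 2 [:: 1; 1] : 'cV[R]_2.
Let t := vec 2 [:: 0; 1] : 'cV[R]_2.

Definition H00 : 'M[R]_(size_bf0, size_bc0) :=
  col5 (row5 (kronI e _) 0 0 0 0)
       (row5 0 (kronI e _) (kronI p _) (kronI g' _) (kronI m _))
       (row5 0 0 (kronI e _) 0 (kronI g' _))
       (row5 0 0 0 (kronI e _) (kronI p _))
       (row5 0 0 0 0 (kronI e _)).

Definition H01 (x : R) : 'M[R]_(size_bf0, size_bc1) :=
  col5 (row3 (kronI f _) 0 0)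
       (row3 0 (kronI ((b - x) *: f) _) (kronI ((b - x) *: f_d) _))
       (row3 0 (kronI f _) (kronI f_d _))
       (row3 0 0 (kronI ((b - x) *: f) _))
       (row3 0 0 (kronI f _)).

Definition H02 (y : R) : 'M[R]_(size_bf0, size_bc1) :=
  col5 (row3 (kronI g _) 0 0)
       (row3 0 (kronI ((d - y) *: g) _) (kronI ((d - y) *: g_b) _))
       (row3 0 0 (kronI ((d - y) *: g) _))
       (row3 0 (kronI g _) (kronI g_b _))
       (row3 0 0 (kronI g _)).

Definition H03 (x y : R) : 'M[R]_(size_bf0, size_hat) :=
  col5 (row3 0 (kronI h _) 0)
       (row3 0 0 (kronI (((d - y) * (b - x)) *: h) _))
       (row3 0 0 (kronI ((d - y) *: h) _))
       (row3 0 0 (kronI ((b - x) *: h) _))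
       (row3 0 0 (kronI h _)).

Definition H11 : 'M[R]_(size_bf1, size_bc1) :=
  col3 (row3 (kronI s _) 0 0)
       (row3 0 (kronI s _) (kronI ((d - c) *: t) _))
       (row3 0 0 (kronI s _)).

Definition H22 : 'M[R]_(size_bf1, size_bc1) :=
  col3 (row3 (kronI s _) 0 0)
       (row3 0 (kronI s _) (kronI ((b - a) *: t) _))
       (row3 0 0 (kronI s _)).

Definition H13 (y : R) : 'M[R]_(size_bf1, size_hat) :=
  col3 (row3 0 (kronI t _) 0)
       (row3 0 0 (kronI ((d - y) *: t) _))
       (row3 0 0 (kronI t _)).

Definition H23 (x : R) : 'M[R]_(size_bf1, size_hat) :=
  col3 (row3 0 (kronI t _) 0)
       (row3 0 0 (kronI ((b - x) *: t) _))
       (row3 0 0 (kronI t _)).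

Definition calH1 (v : bc_data) : bf_data :=
  let '(v0, v1, v2) := v in
  (H00 *m v0 + intv a b (fun x => H01 x *m v1 x)
     + intv c d (fun y => H02 y *m v2 y),
   fun x => H11 *m v1 x,
   fun y => H22 *m v2 y).

Definition calH2 (uhat : R * R -> 'cV[R]_size_hat) : bf_data :=
  (intv a b (fun x => intv c d (fun y => H03 x y *m uhat (x, y))),
   fun x => intv c d (fun y => H13 y *m uhat (x, y)),
   fun y => intv a b (fun x => H23 x *m uhat (x, y))).

(* Equality in R^k x L^2[a, b] x L^2[c, d]. *)
Definition bf_eq (w w' : bf_data) : Prop :=
  [/\ w.1.1 = w'.1.1,
      {ae leb1, forall x, x \in `[a, b] -> w.1.2 x = w'.1.2 x} &
      {ae leb1, forall y, y \in `[c, d] -> w.2 y = w'.2 y}].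

Definition bf_add (w w' : bf_data) : bf_data :=
  (w.1.1 + w'.1.1, fun x => w.1.2 x + w'.1.2 x, fun y => w.2 y + w'.2 y).

End operators.

(* Main.v *)
(* In one variable, f and g integrable on [c, d] satisfy
     f(y) = B + \int_c^y g  for almost every y
   as soon as \int f psi' = - \int g psi for a suitable countable family of test
   functions psi, with B a fixed linear functional of (f, g). Testing the weak
   derivatives of u against products phi(x) psi(y) and using that the family is
   countable, this applies to almost every section of u at once. Hence if D is the
   weak y-derivative of p, then p(x, y) = B(x) + \int_c^y D(x, s) ds with B in L^2,
   and B is the trace of p on y = c. Applied to u and its derivatives p = u_x,
   q = u_y with common mixed derivative D, it gives the continuous representative
     u(x, y) = u(a, c) + \int_a^x p(s, c) ds + \int_c^y q(a, t) dt
               + \int_a^x \int_c^y D(s, t) dt ds.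
   Evaluating it at the corners gives the blocks for u_1; for u_2 the formula is
   used for u, u_x, u_y, u_xy, and iterated primitives are rewritten with the
   weights (b - x) and (d - y) by Fubini's theorem. *)
Require Import Defs.
From mathcomp Require Import all_boot all_order all_algebra.
From mathcomp Require Import all_classical all_reals all_analysis.
From mathcomp Require Import measurable_realfun ring lra.
Set Implicit Arguments.
Unset Strict Implicit.
Unset Printing Implicit Defensive.
Import Order.TTheory GRing.Theory Num.Theory.
Import numFieldNormedType.Exports.
Local Open Scope classical_set_scope.
Local Open Scope ring_scope.

(** * Smooth bump functions *)

(** Integrating in one variable determines [u] only up to a function of the other one. Doing it both
    ways, from the trace on [y = c] and from the trace on [x = a], gives two formulas whose
    comparison separates the variables and produces the integration constant. Weak derivatives,
    traces and point values are all picked by choice, so every identity has to be carried over to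
    the chosen object: exactly for a point value, since a continuous representative is unique on a
    nondegenerate rectangle, and only almost everywhere for a trace. The hypotheses speak of
    derivatives of [u] alone; that [D] is a weak derivative of [p] and of [q] follows by moving one
    derivative onto the test function and comparing through [u]. The top derivative stays an
    arbitrary square integrable representative throughout, because [uhat] is one. The functional [B]
    is a partial integral of L^2 functions, so it is in L^2 by Cauchy-Schwarz on sections. The
    countable family consists of rescaled bumps built from exp(-1/x) that converge to indicators of
    rational intervals. *)

Section smooth1.
Context {R : realType}.
Implicit Types (f g : R -> R) (n : nat) (P : {poly R}).

(** Continuity of the derivatives is not recorded: [smooth1] asks for every [n], so each derivative
    is itself differentiable, hence continuous. *)
Fixpoint Ck n f : Prop :=
  if n is m.+1 then (forall x, derivable f x 1) /\ Ck m (derive1 f) else True.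

Definition smooth1 f := forall n, Ck n f.

Lemma CkW n f : Ck n.+1 f -> Ck n f.
Proof.
elim: n f => // n IH f [df] /IH Cf; split => //.
Qed.

Lemma CkD n f g : Ck n f -> Ck n g -> Ck n (f + g).
Proof.
elim: n f g => // n IH f g [df Cf] [dg Cg]; split.
  by move=> x; exact: derivableD.
have -> : derive1 (f + g) = derive1 f + derive1 g; last exact: IH.
apply/funext => x; transitivity (derive1 f x + derive1 g x) => //.
by rewrite !derive1E deriveD.
Qed.

Lemma CkZ n (k : R) f : Ck n f -> Ck n (k *: f).
Proof.
elim: n f => // n IH f [df Cf]; split.
  by move=> x; exact: derivableZ.
have -> : derive1 (k *: f) = k *: derive1 f; last exact: IH.
apply/funext => x; transitivity (k *: derive1 f x) => //.
by rewrite !derive1E deriveZ.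
Qed.

Lemma CkM n f g : Ck n f -> Ck n g -> Ck n (f * g).
Proof.
elim: n f g => // n IH f g Cf Cg; have [[df Cf'] [dg Cg']] := (Cf, Cg); split.
  by move=> x; exact: derivableM.
have -> : derive1 (f * g) = f * derive1 g + g * derive1 f.
  apply/funext => x; transitivity (f x *: derive1 g x + g x *: derive1 f x) => //.
  by rewrite !derive1E deriveM.
by apply: CkD; apply: IH => //; exact: CkW.
Qed.

Lemma is_derive_affine (k l x : R) : is_derive x 1 (fun y : R => k * y + l) k.
Proof.
apply: is_derive_eq; rewrite ?scaler0 ?add0r ?addr0.
by rewrite [LHS]mulr1.
Qed.

Lemma Ck_affine n f (k l : R) : Ck n f -> Ck n (fun x => f (k * x + l)).
Proof.
elim: n f => // n IH f [df Cf].
have dfa (x : R) : is_derive x 1 (fun y => f (k * y + l)) (k * (derive1 f) (k * x + l)).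
  have dl := is_derive_affine k l x.
  have df' : is_derive (k * x + l) 1 f (derive1 f (k * x + l)).
    by rewrite derive1E; exact: derivableP.
  rewrite [k * derive1 _ _]mulrC.
  exact: (@is_derive1_comp R f (fun y : R => k * y + l) x _ _ df' dl).
split; first by move=> x; have [] := dfa x.
have -> : derive1 (fun x => f (k * x + l)) = k *: (fun x => (derive1 f) (k * x + l)).
  by apply/funext => x; rewrite derive1E; have [_ ->] := dfa x.
by apply: CkZ; exact: IH.
Qed.

Lemma Ck_cst n (k : R) : Ck n (cst k).
Proof.
elim: n k => // n IH k; split; first by move=> x; exact: derivable_cst.
rewrite (_ : derive1 _ = cst 0)//.
by apply/funext => x; rewrite derive1_cst.
Qed.

Lemma smooth1_derivable f : smooth1 f -> forall x, derivable f x 1.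
Proof. by move=> /(_ 1%N)[]. Qed.

Lemma smooth1_derive1 f : smooth1 f -> smooth1 (derive1 f).
Proof. by move=> sf n; have [] := sf n.+1. Qed.

Lemma smooth1_derive1n f n : smooth1 f -> smooth1 (derive1n n f).
Proof.
by elim: n => // n IH sf; rewrite derive1nS; apply/smooth1_derive1/IH.
Qed.

Lemma smooth1_continuous f : smooth1 f -> continuous f.
Proof.
move=> sf x; apply: differentiable_continuous; apply/derivable1_diffP.
exact: smooth1_derivable.
Qed.

(** Induction on the degree, with [e] general: half of the exponent bounds the quotient polynomial,
    the other half absorbs the extra factor t, since e/2 * t <= exp(e/2 * t). *)
Lemma expR_horner_bound P (e : R) : 0 < e ->
  exists2 C : R, 0 <= C & forall t, 0 <= t -> `|P.[t]| <= C * expR (e * t).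
Proof.
elim/poly_ind: P e => [|P c IH] e e0.
  by exists 0 => // t _; rewrite horner0 normr0 mul0r.
have [C C0 HC] := IH (e / 2) (divr_gt0 e0 (ltr0Sn _ _)).
exists (C * (2 / e) + `|c|) => [|t t0].
  by rewrite addr_ge0// mulr_ge0// divr_ge0// ltW.
rewrite hornerMXaddC (le_trans (ler_normD _ _))// mulrDl lerD//.
  rewrite normrM (ger0_norm t0).
  have -> : e * t = e / 2 * t + e / 2 * t by rewrite -mulrDl -splitr.
  rewrite expRD mulrACA ler_pM//; first exact: HC.
  rewrite -ler_pdivrMl ?divr_gt0// invf_div.
  by rewrite (le_trans _ (expR_ge1Dx _))// lerDr.
rewrite -[leLHS]mulr1 ler_wpM2l// -expR0 ler_expR.
by rewrite mulr_ge0// ltW.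
Qed.

(* The factor P(1/x) makes the family stable under differentiation. *)
Definition flat P (x : R) : R := if 0 < x then P.[x^-1] * expR (- x^-1) else 0.

(** The polynomial bound at t = 1/x with rate 1. It controls the difference quotient of [flat] at
    0. *)
Lemma flat_bound P : exists2 C : R, 0 <= C & forall x, `|flat P x| <= C.
Proof.
have [C C0 HC] := expR_horner_bound P (@ltr01 R).
exists C => // x; rewrite /flat; case: ifPn => x0; last by rewrite normr0.
have := HC x^-1; rewrite invr_ge0 (ltW x0) mul1r => /(_ isT) H.
rewrite normrM (ger0_norm (expR_ge0 _)) expRN.
by rewrite ler_pdivrMr// expR_gt0.
Qed.

(** For x > 0 the product rule gives x^-2 (P - P')(1/x) exp(-1/x), and the factor x^-2 is absorbed
    into the polynomial as ['X ^+ 2]. The delicate point is 0, where the derivative is 0. *)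
Lemma derive_flat P (x : R) :
  is_derive x 1 (flat P) (flat ('X ^+ 2 * (P - P^`())) x).
Proof.
have [x0|x0|x0] := ltgtP 0 x.
- have : is_derive x 1 (fun y : R => P.[y^-1] * expR (- y^-1))
      (flat ('X ^+ 2 * (P - P^`())) x).
    have d1 : is_derive x 1 (fun y : R => y^-1) (- x ^- 2).
      have := @is_deriveV R id x 1 1 (lt0r_neq0 x0) (is_derive_id _ _).
      by move=> /is_derive_eq; apply; rewrite [_ *: _]mulr1.
    have d2 : is_derive x 1 (fun y : R => P.[y^-1]) (P^`().[x^-1] * (- x ^- 2)).
      exact: (@is_derive1_comp R (horner P) (fun y : R => y^-1) x _ _
              (is_derive_poly P x^-1) d1).
    have d3 : is_derive x 1 (fun y : R => expR (- y^-1)) (expR (- x^-1) * x ^- 2).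
      have d1N : is_derive x 1 (fun y : R => - y^-1) (x ^- 2).
        by have := is_deriveN d1; rewrite opprK.
      exact: (@is_derive1_comp R expR (fun y : R => - y^-1) x _ _
              (is_derive_expR _) d1N).
    have := is_deriveM d2 d3; move=> /is_derive_eq; apply.
    rewrite /flat x0 !hornerE /= /GRing.scale /= exprVn; ring.
  apply: near_eq_is_derive.
  near=> y; rewrite /flat ifT//; near: y; exact: lt_nbhsr.
- have : is_derive x 1 (cst (0 : R)) (flat ('X ^+ 2 * (P - P^`())) x).
    by rewrite /flat ltNge (ltW x0)/=; exact: is_derive_cst.
  apply: near_eq_is_derive.
  near=> y; rewrite /flat ifN//= -leNgt ltW//; near: y.
  exact: lt_nbhsl.
- rewrite -x0 [X in is_derive _ _ _ X]/flat ltxx.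
  have [C C0 HC] := flat_bound ('X ^+ 2 * P).
  suff : h^-1 *: (flat P (h *: (1 : R) + 0) - flat P 0) @[h --> 0^'] --> (0 : R).
    move=> lim0; apply: DeriveDef.
      by apply/cvg_ex; exists 0; exact: lim0.
    by apply/cvg_lim => //; exact: lim0.
  apply/cvgrPdist_le => /= e e0; near=> h.
  rewrite sub0r normrN addr0 [flat P 0]/flat ltxx subr0 [_ *: 1]mulr1.
  rewrite [_ *: _]/(_ * _) normrM.
  have [h0|h0] := ltP 0 h; last by rewrite /flat ltNge h0/= normr0 mulr0 ltW.
  (* Trading h^-1 for h costs a factor h^-2, which [flat] absorbs; what remains is h times a bounded
     function. *)
  have -> : `|h^-1| * `|flat P h| = h * `|flat ('X ^+ 2 * P) h|.
    have <- : `|h * flat ('X ^+ 2 * P) h| = h * `|flat ('X ^+ 2 * P) h|.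
      by rewrite normrM (gtr0_norm h0).
    rewrite -normrM; congr `|_|; rewrite /flat h0 !hornerE /=.
    by field; exact: lt0r_neq0.
  apply: (@le_trans _ _ (h * C)); first by rewrite ler_wpM2l// ltW.
  (* [C] may be 0, and the next line divides by the bound. *)
  apply: (@le_trans _ _ (h * (C + 1))); first by rewrite ler_wpM2l ?lerDl// ltW.
  rewrite -ler_pdivlMr ?ltr_wpDl//.
  rewrite -[leLHS]gtr0_norm//; near: h.
  apply: dnbhs0_le; rewrite divr_gt0 // ltr_wpDl//.
Unshelve. all: by end_near. Qed.

Lemma smooth1_flat P : smooth1 (flat P).
Proof.
move=> n; elim: n P => // n IH P; split.
  by move=> x; have [] := derive_flat P x.
rewrite (_ : derive1 _ = flat ('X ^+ 2 * (P - P^`())))//.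
by apply/funext => x; rewrite derive1E; have [_ ->] := derive_flat P x.
Qed.

(** Stretching the argument by n + 1 makes exp(-1/((n+1)(x-s))) tend to 1 for every x > s while it
    stays 0 for x <= s; the same happens at [t]. The affine arguments are written out in the form
    that [Ck_affine] expects. *)
Definition bumpfun (s t : R) n : R -> R :=
  (fun x => flat 1 (n.+1%:R * x + - (n.+1%:R * s))) *
  (fun x => flat 1 (- n.+1%:R * x + n.+1%:R * t)).

Lemma smooth1_bumpfun s t n : smooth1 (bumpfun s t n).
Proof. by move=> k; apply: CkM; apply: Ck_affine; exact: smooth1_flat. Qed.

Lemma bumpfunE s t n x :
  bumpfun s t n x = flat 1 (n.+1%:R * (x - s)) * flat 1 (n.+1%:R * (t - x)).
Proof. by congr (flat 1 _ * flat 1 _); rewrite ?mulrBr ?mulNr ?mulrN // addrC. Qed.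

Lemma bumpfun_out s t n x : x \notin `]s, t[ -> bumpfun s t n x = 0.
Proof.
rewrite in_itv/= negb_and -!leNgt => xst.
rewrite bumpfunE /flat !pmulr_rgt0// !subr_gt0.
by case/orP: xst => H; [rewrite [s < x]ltNge H mul0r|rewrite [x < t]ltNge H mulr0].
Qed.

Lemma bumpfun_in s t n x : x \in `]s, t[ ->
  bumpfun s t n x = expR (- (n.+1%:R)^-1 * ((x - s)^-1 + (t - x)^-1)).
Proof.
rewrite in_itv/= => /andP[sx xt].
rewrite bumpfunE /flat !pmulr_rgt0// !subr_gt0 sx xt -!polyC1 !hornerC !mul1r -expRD; congr expR.
by rewrite !invfM mulrDr !mulNr.
Qed.

Lemma bumpfun_gt0 s t n x : x \in `]s, t[ -> 0 < bumpfun s t n x.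
Proof. by move=> /(bumpfun_in n) ->; exact: expR_gt0. Qed.

Lemma bumpfun_ge0 s t n x : 0 <= bumpfun s t n x.
Proof.
by have [/(bumpfun_gt0 n)/ltW//|/(bumpfun_out n) ->] := boolP (x \in `]s, t[).
Qed.

Lemma bumpfun_le1 s t n x : bumpfun s t n x <= 1.
Proof.
have [xst|/(bumpfun_out n) ->//] := boolP (x \in `]s, t[).
rewrite bumpfun_in// -expR0 ler_expR mulNr oppr_le0 mulr_ge0//.
move: xst; rewrite in_itv/= => /andP[? ?].
by rewrite addr_ge0// invr_ge0 subr_ge0 ltW.
Qed.

Lemma bumpfun_cvg s t x : bumpfun s t n x @[n --> \oo] --> (\1_(`]s, t[) x : R).
Proof.
rewrite indicE; have [xst|xst] := boolP (x \in `]s, t[).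
  rewrite mem_set//=.
  rewrite (_ : (fun n => _) = (fun n =>
    expR (- (n.+1%:R)^-1 * ((x - s)^-1 + (t - x)^-1)))); last first.
    by apply/funext => n; rewrite bumpfun_in.
  rewrite -[X in _ --> X]expR0; apply: continuous_cvg; first exact: continuous_expR.
  rewrite -[X in _ --> X](mul0r ((x - s)^-1 + (t - x)^-1)).
  apply: cvgMr_tmp; rewrite -[X in _ --> X]oppr0; apply: cvgN.
  exact: (@cvg_harmonic R).
rewrite memNset/=; last by apply/negP.
rewrite (_ : (fun n => _) = cst 0); first exact: cvg_cst.
by apply/funext => n; rewrite bumpfun_out.
Qed.

End smooth1.

(** * One-dimensional weak derivatives *)

Section one_dim.
Context {R : realType}.
Local Notation mu := (@lebesgue_measure R).
Implicit Types (c d : R) (f g h psi : R -> R).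

#[global] Instance ae_lebesgue_filter : Filter (nbhs (almost_everywhere mu)).
Proof. exact: (ae_filter_ringOfSetsType mu). Qed.

(** Compact support is witnessed by an explicit closed interval, so the supports of sums,
    derivatives and tensor products are read off from end points. *)
Definition test1 c d psi := smooth1 psi /\
  exists s t, [/\ c < s, s < t, t < d & forall x, x \notin `[s, t] -> psi x = 0].

Lemma ae_eq_Rintegral dd (T : measurableType dd) (m : {measure set T -> \bar R})
    (D : set T) (f g : T -> R) :
  measurable D -> measurable_fun D f -> measurable_fun D g ->
  ae_eq m D f g -> \int[m]_(x in D) f x = \int[m]_(x in D) g x.
Proof.
move=> mD mf mg fg; rewrite /Rintegral; congr fine.
apply: ae_eq_integral => //; [exact/measurable_EFinP|exact/measurable_EFinP|].
by apply: filterS fg => x fg /fg ->.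
Qed.

Lemma bounded_within c d h : {within `[c, d], continuous h} ->
  [bounded h x | x in `[c, d]].
Proof.
move=> ch; have /compact_bounded : compact (h @` `[c, d]).
  by apply: continuous_compact => //; exact: segment_compact.
move=> [M [Mr HM]]; exists M; split => // x Mx y cdy.
by apply: HM => //; exists y.
Qed.

Lemma integrableMc c d f h : mu.-integrable `[c, d] (EFin \o f) ->
  {within `[c, d], continuous h} ->
  mu.-integrable `[c, d] (EFin \o (fun x => f x * h x)).
Proof.
move=> fi ch.
have -> : EFin \o (fun x => f x * h x) = ((EFin \o f) \* (EFin \o h))%E by [].
apply: integrableMl => //; last exact: bounded_within.
by apply: subspace_continuous_measurable_fun.
Qed.

Lemma test1_0 c d : c < d -> test1 c d (fun=> 0).
Proof.
move=> cd; split; first by move=> n; exact: Ck_cst.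
exists (c + (d - c) / 3), (c + (d - c) / 2); split => //; lra.
Qed.

Lemma test1_bumpfun c d s t n : c < s -> s < t -> t < d -> test1 c d (bumpfun s t n).
Proof.
move=> cs st td; split; first exact: smooth1_bumpfun.
exists s, t; split => // x xst; apply: bumpfun_out; apply: contra xst.
exact: subset_itv_oo_cc.
Qed.

Lemma integral_indic_itv f c d s t : c <= s -> t <= d ->
  \int[mu]_(x in `[c, d]) (f x * \1_(`]s, t[) x) = \int[mu]_(x in `]s, t[) f x.
Proof.
move=> cs td; rewrite Rintegral_mkcond [RHS]Rintegral_mkcond.
congr Rintegral; apply/funext => x; rewrite /patch indicE.
have [xst|xst] := boolP (x \in `]s, t[%classic); last first.
  by rewrite mulr0; case: ifP.
rewrite ifT ?mulr1//; rewrite inE/=; move: xst; rewrite inE/= !in_itv/=.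
move=> /andP[sx xt]; lra.
Qed.

(** Dominated convergence: the bumps lie between 0 and 1, so [|f|] dominates the integrands. *)
Lemma bumpfun_integral_cvg f c d s t : c <= s -> t <= d ->
  mu.-integrable `[c, d] (EFin \o f) ->
  \int[mu]_(x in `[c, d]) (f x * bumpfun s t n x) @[n --> \oo] -->
  \int[mu]_(x in `]s, t[) f x.
Proof.
move=> cs td fi; rewrite -(integral_indic_itv f cs td).
have mf : measurable_fun `[c, d] f by apply/measurable_EFinP; exact: (measurable_int mu fi).
have mb n : measurable_fun `[c, d] (bumpfun s t n).
  apply: measurable_funTS; apply: continuous_measurable_fun.
  exact/smooth1_continuous/smooth1_bumpfun.
have i1 : mu.-integrable `[c, d] (EFin \o (fun x => f x * \1_(`]s, t[) x)).
  apply: le_integrable fi => //.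
    by apply/measurable_EFinP; apply: measurable_funM => //; exact: measurable_indic.
  move=> x _ /=; rewrite lee_fin normrM ler_piMr//.
  by rewrite indicE; case: (_ \in _); rewrite ?normr1 ?normr0.
have : (\int[mu]_(x in `[c, d]) ((f x * bumpfun s t n x)%:E) @[n --> \oo] -->
    \int[mu]_(x in `[c, d]) (f x * \1_(`]s, t[) x)%:E)%E.
  apply: (@dominated_cvg _ _ _ mu `[c, d] _ _ _ (EFin \o (Num.norm \o f))) => //.
  - by move=> n; apply/measurable_EFinP; apply: measurable_funM => //; exact: mb.
  - move=> x _; apply: cvg_EFin; first exact: nearW.
    by apply: cvgMl_tmp; exact: bumpfun_cvg.
  - exact: integrable_norm.
  - move=> n x _; rewrite lee_fin normrM ler_piMr//.
    by rewrite ger0_norm ?bumpfun_ge0 ?bumpfun_le1.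
move=> cv; rewrite /Rintegral; apply: fine_cvg; rewrite fineK//.
exact: integrable_fin_num i1.
Qed.

Lemma ae_neq (c : R) : {ae mu, forall x, x != c}.
Proof.
exists [set c]; split => //; first exact: lebesgue_measure_set1.
by move=> x /= /negP; rewrite negbK => /eqP.
Qed.

Lemma integrable_sub_itv c d f s t : c <= s -> t <= d ->
  mu.-integrable `[c, d] (EFin \o f) -> mu.-integrable `[s, t] (EFin \o f).
Proof.
move=> cs td; apply: integrableS => // x/=; rewrite !in_itv/= => /andP[sx xt].
by rewrite (le_trans cs)//= (le_trans xt).
Qed.

Lemma prim_continuous c d f : c <= d -> mu.-integrable `[c, d] (EFin \o f) ->
  {within `[c, d], continuous (fun x => \int[mu]_(t in `[c, x]) f t)}.
Proof. by move=> cd fi; exact: parameterized_integral_continuous. Qed.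

Lemma prim_sub c d f s t : c <= s -> s <= t -> t <= d ->
  mu.-integrable `[c, d] (EFin \o f) ->
  \int[mu]_(x in `[c, t]) f x - \int[mu]_(x in `[c, s]) f x =
  \int[mu]_(x in `]s, t[) f x.
Proof.
move=> cs st td fi.
have fct : mu.-integrable `[c, t] (EFin \o f) by exact: integrable_sub_itv fi.
rewrite Rintegral_itvB ?bnd_simp//; last first.
rewrite -Rintegral_itv_bndo_bndc//.
apply: integrableS fct => // x/=; rewrite !in_itv/= => /andP[sx xt]; lra.
Qed.

(** The primitive of [f] takes a single value at all rational points, hence by continuity on the
    whole open interval; Lebesgue differentiation then identifies [f] with the derivative of a
    constant. *)
Lemma prim_cst_ae0 c d f : c < d -> mu.-integrable `[c, d] (EFin \o f) ->
  (forall s t : rat, c < ratr s -> ratr s < ratr t :> R -> ratr t < d ->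
    \int[mu]_(x in `]ratr s, ratr t[) f x = 0) ->
  {ae mu, forall x, x \in `[c, d] -> f x = 0}.
Proof.
move=> cd fi f0; pose G x := \int[mu]_(t in `[c, x]) f t.
have [q /[!in_itv]/= /andP[cq qd]] := rat_in_itvoo cd.
have Gq (r : rat) : c < ratr r -> ratr r < d -> G (ratr r) = G (ratr q).
  move=> cr rd; apply/eqP; rewrite -subr_eq0; apply/eqP.
  have [rq|qr|->] := ltgtP (ratr r : R) (ratr q); last by rewrite subrr.
  - by rewrite -opprB (prim_sub _ _ _ fi) ?ltW// f0// oppr0.
  - by rewrite (prim_sub _ _ _ fi) ?ltW// f0.
have /(continuous_within_itvP _ cd)[cG _ _] := prim_continuous (ltW cd) fi.
have Gx x : x \in `]c, d[ -> G x = G (ratr q).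
  move=> xcd; apply/eqP/negPn/negP => Gxq.
  have e0 : 0 < `|G x - G (ratr q)| by rewrite normr_gt0 subr_eq0.
  have /cvgrPdist_lt/(_ _ e0) cGx := cG _ xcd.
  have xcd' : \forall y \near x, y \in `]c, d[ by exact: near_in_itvoo.
  have := filterI cGx xcd'; rewrite -nbhs_ballE => -[r /= r0 Hr].
  have [y [/= xy [z _ zy]]] : ball x r `&` range ratr !=set0.
    by apply: dense_rat; [exists x; exact: ballxx|exact: ball_open].
  have [] := Hr _ xy; rewrite -zy => + /[!in_itv]/= /andP[cz zd].
  by rewrite -/(G (ratr z)) -/(G x) (Gq z)// ltxx.
(* The differentiation theorem is applied on the whole line, so [f] is extended by zero. *)
pose g := f \_ `[c, d].
have gi (a : itv_bound R) y : mu.-integrable [set` Interval a (BRight y)] (EFin \o g).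
  apply: (@integrableS _ _ _ mu setT) => //.
  by rewrite /g -restrict_EFin; apply/integrable_restrict => //=; rewrite setTI.
have lg : locally_integrable setT g by exact: integrable_locally.
have := FTC1 (gi (BLeft c)) lg.
apply: filterS3 (ae_neq c) (ae_neq d) => x xc xd + xcd.
have {xcd xc xd} xcd : x \in `]c, d[.
  by move: xcd; rewrite !in_itv/= !lt_neqAle eq_sym xc xd.
have /andP[cx xd] : (c < x < d) by [].
rewrite /= lte_fin => /(_ cx)[_].
rewrite derive1E (@near_eq_derive _ _ _ _ (cst (G (ratr q)))) ?derive_cst; last first.
  near=> y; rewrite /= -(Gx y); last by near: y; exact: near_in_itvoo.
  have /andP[cy yd] : (c < y < d).
    suff : y \in `]c, d[ by rewrite in_itv.
    by near: y; exact: near_in_itvoo.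
  rewrite /G; apply: eq_Rintegral => z; rewrite inE/= in_itv/= => /andP[cz zy].
  by rewrite /g /patch ifT// inE/= in_itv/= cz (le_trans zy)// ltW.
move/esym; rewrite /g /patch ifT// inE/= in_itv/= !ltW//.
Unshelve. all: by end_near. Qed.

(** The family is indexed by codes of triples: two rational end points and a sharpness [n]. Codes
    that are not admissible give the zero function, which is a harmless test function. Letting [n]
    grow turns the vanishing integrals into vanishing integrals over rational intervals. *)
Lemma test1_separating c d : c < d -> exists h : nat -> R -> R,
  (forall n, test1 c d (h n)) /\
  forall f, mu.-integrable `[c, d] (EFin \o f) ->
    (forall n, \int[mu]_(x in `[c, d]) (f x * h n x) = 0) ->
    {ae mu, forall x, x \in `[c, d] -> f x = 0}.
Proof.
move=> cd.
pose ok (q r : rat) := [&& c < ratr q, ratr q < ratr r :> R & ratr r < d].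
pose h k := if @unpickle (rat * rat * nat)%type k is Some (q, r, n) then
  if ok q r then bumpfun (ratr q) (ratr r) n else (fun=> 0) else (fun=> 0 : R).
exists h; split => [k|f fi fh].
  rewrite /h; case: unpickle => [[[q r] n]|]; last exact: test1_0.
  case: ifPn => [/and3P[? ? ?]|_]; last exact: test1_0.
  exact: test1_bumpfun.
apply: prim_cst_ae0 => // q r cq qr rd.
have cs := bumpfun_integral_cvg (ltW cq) (ltW rd) fi.
have e : (fun n => \int[mu]_(x in `[c, d]) (f x * bumpfun (ratr q) (ratr r) n x))
    = cst 0.
  apply/funext => n; have := fh (pickle (q, r, n)).
  by rewrite /h pickleK ifT// /ok cq qr rd.
move: cs; rewrite e => cs; apply: (cvg_unique _ cs) => //; exact: cvg_cst.
Qed.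

End one_dim.

(** * Fubini's theorem for real-valued integrals *)

Section real_fubini.
Context d1 d2 (T1 : measurableType d1) (T2 : measurableType d2) {R : realType}.
Variables (m1 : {sigma_finite_measure set T1 -> \bar R})
          (m2 : {sigma_finite_measure set T2 -> \bar R}).
Implicit Types F : T1 * T2 -> R.

(** [fine] sends an infinite value to 0, so the real inner integral is dominated by the extended
    one. *)
Lemma integrable_inner1 F : (m1 \x m2)%E.-integrable setT (EFin \o F) ->
  m1.-integrable setT (EFin \o (fun x => \int[m2]_y F (x, y))).
Proof.
move=> iF; have iF1 := integrable_fubini_F iF.
apply: (@le_integrable _ _ _ m1 setT _ _ (fubini_F m2 (EFin \o F))) => //.
  apply/measurable_EFinP; apply: measurableT_comp; first exact: fine_measurable.
  exact: (measurable_int m1 iF1).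
by move=> x _ /=; rewrite /Rintegral /fubini_F /=;
case: (integral _ _ _) => [r| |] /=; rewrite ?normr0 ?leey.
Qed.

(** The real and the extended inner integrals agree wherever the section is integrable, that is, off
    a null set. *)
Lemma RFubini1 F : (m1 \x m2)%E.-integrable setT (EFin \o F) ->
  \int[m1]_x \int[m2]_y F (x, y) = \int[(m1 \x m2)%E]_z F z.
Proof.
move=> iF; rewrite [RHS]/Rintegral -(integral12_prod_meas1 iF).
rewrite [LHS]/Rintegral; congr fine.
have iF1 := integrable_fubini_F iF.
apply: ae_eq_integral => //.
- exact: (measurable_int m1 (integrable_inner1 iF)).
- exact: (measurable_int m1 iF1).
- have := ae_integrable1 iF; apply: filterS => x ix _.
  by rewrite /Rintegral fineK//; exact: integrable_fin_num.
Qed.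

Let integrable_fubini_G F : (m1 \x m2)%E.-integrable setT (EFin \o F) ->
  m2.-integrable setT (fubini_G m1 (EFin \o F)).
Proof.
move=> iF; have mF := measurable_int _ iF.
have mG : measurable_fun setT (fun y => \int[m1]_x `|(EFin \o F) (x, y)|)%E.
  apply: (measurable_fun_fubini_tonelli_G (abse \o (EFin \o F))).
    by apply: measurableT_comp => //; exact: measurable_int iF.
  by move=> x; exact: abse_ge0.
apply/integrableP; split; first exact: measurable_fubini_G iF.
apply: le_lt_trans ((integrable21ltyP m1 m2 mF).1 iF).
apply: ge0_le_integral => //.
  by apply: measurableT_comp => //; exact: measurable_fubini_G iF.
move=> y _; apply: le_abse_integral => //.
exact: measurableT_comp.
Qed.

Lemma integrable_inner2 F : (m1 \x m2)%E.-integrable setT (EFin \o F) ->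
  m2.-integrable setT (EFin \o (fun y => \int[m1]_x F (x, y))).
Proof.
move=> iF; have iF1 := integrable_fubini_G iF.
apply: (@le_integrable _ _ _ m2 setT _ _ (fubini_G m1 (EFin \o F))) => //.
  apply/measurable_EFinP; apply: measurableT_comp; first exact: fine_measurable.
  exact: (measurable_int m2 iF1).
by move=> x _ /=; rewrite /Rintegral /fubini_G /=;
case: (integral _ _ _) => [r| |] /=; rewrite ?normr0 ?leey.
Qed.

Lemma RFubini2 F : (m1 \x m2)%E.-integrable setT (EFin \o F) ->
  \int[m2]_y \int[m1]_x F (x, y) = \int[(m1 \x m2)%E]_z F z.
Proof.
move=> iF; rewrite [RHS]/Rintegral -(integral21_prod_meas1 iF).
rewrite [LHS]/Rintegral; congr fine.
have iF1 := integrable_fubini_G iF.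
apply: ae_eq_integral => //.
- exact: (measurable_int m2 (integrable_inner2 iF)).
- exact: (measurable_int m2 iF1).
- have := ae_integrable2 iF; apply: filterS => x ix _.
  by rewrite /Rintegral fineK//; exact: integrable_fin_num.
Qed.

Lemma integrable_tensor (f : T1 -> R) (g : T2 -> R) :
  m1.-integrable setT (EFin \o f) -> m2.-integrable setT (EFin \o g) ->
  (m1 \x m2)%E.-integrable setT (EFin \o (fun z => f z.1 * g z.2)).
Proof.
move=> fi gi.
have mf : measurable_fun setT f by apply/measurable_EFinP; exact: (measurable_int m1 fi).
have mg : measurable_fun setT g by apply/measurable_EFinP; exact: (measurable_int m2 gi).
apply/(integrable12ltyP m1 m2).
  apply/measurable_EFinP; apply: measurable_funM; exact: measurableT_comp.
have /integrableP[_ fl] := fi; have /integrableP[_ gl] := gi.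
have [r gE] : exists r : R, (\int[m2]_y (`|(g y)%:E|) = r%:E)%E.
  exists (fine (\int[m2]_y (`|(g y)%:E|))%E); rewrite fineK// ge0_fin_numE//.
  exact: integral_ge0.
rewrite (@eq_integral _ _ _ m1 setT (fun x => `|(f x)%:E| * r%:E)%E); last first.
  move=> x _; rewrite -gE -ge0_integralZl//.
    by apply: eq_integral => y _; rewrite /= normrM EFinM.
  by apply/measurable_EFinP; exact: measurableT_comp.
have r0 : 0 <= r by rewrite -lee_fin -gE; exact: integral_ge0.
rewrite ge0_integralZr//; last by apply/measurable_EFinP; exact: measurableT_comp.
by rewrite muleC lte_mul_pinfty.
Qed.

End real_fubini.

(** * Integration by parts for the primitive of an integrable function *)

Section ibp.
Context {R : realType}.
Local Notation mu := (@lebesgue_measure R).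
Implicit Types (c d : R) (f g psi : R -> R).

Lemma measurable_le_set : measurable [set z : R * R | z.1 <= z.2].
Proof.
have m : measurable_fun setT (fun z : R * R => z.1 <= z.2).
  by apply: measurable_fun_ler; [exact: measurable_fst|exact: measurable_snd].
have -> : [set z : R * R | z.1 <= z.2] = setT `&` (fun z : R * R => z.1 <= z.2) @^-1` [set true].
  by rewrite setTI; apply/seteqP; split.
exact: m.
Qed.

(** The indicator of the half-plane [z.1 <= z.2] encodes a variable limit of integration, so that
    Fubini can be applied on the full product. *)
Lemma integral_le_indic_r c d f (x : R) : x \in `[c, d] ->
  \int[mu]_y ((f \_ `[c, d]) y * \1_[set z : R * R | z.1 <= z.2] (x, y)) =
  \int[mu]_(y in `[x, d]) f y.
Proof.
rewrite in_itv/= => /andP[cx xd]; rewrite [RHS]Rintegral_mkcond; apply: eq_Rintegral => y _.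
rewrite /patch indicE; have [xy|yx] := leP x y; last first.
  rewrite [X in (nat_of_bool X)%:R]memNset/= ?mulr0; last by apply/negP; rewrite -ltNge.
  by rewrite ifN//; apply/negP; rewrite inE/= in_itv/= leNgt yx.
rewrite [X in (nat_of_bool X)%:R]mem_set//= mulr1.
have -> // : (y \in `[c, d]%classic) = (y \in `[x, d]%classic).
by apply/idP/idP; rewrite !inE/= !in_itv/= => /andP[cy yd]; lra.
Qed.

Lemma integral_le_indic_l c d f (y : R) : y \in `[c, d] ->
  \int[mu]_x ((f \_ `[c, d]) x * \1_[set z : R * R | z.1 <= z.2] (x, y)) =
  \int[mu]_(x in `[c, y]) f x.
Proof.
rewrite in_itv/= => /andP[cy yd]; rewrite [RHS]Rintegral_mkcond; apply: eq_Rintegral => x _.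
rewrite /patch indicE; have [xy|yx] := leP x y; last first.
  rewrite [X in (nat_of_bool X)%:R]memNset/= ?mulr0; last by apply/negP; rewrite -ltNge.
  by rewrite ifN//; apply/negP; rewrite inE/= in_itv/= andbC leNgt yx.
rewrite [X in (nat_of_bool X)%:R]mem_set//= mulr1.
have -> // : (x \in `[c, d]%classic) = (x \in `[c, y]%classic).
by apply/idP/idP; rewrite !inE/= !in_itv/= => /andP[cx xd]; lra.
Qed.

Lemma integral_derive1 c d psi : c <= d ->
  (forall x, derivable psi x 1) -> continuous (derive1 psi) ->
  \int[mu]_(x in `[c, d]) derive1 psi x = psi d - psi c.
Proof.
rewrite le_eqVlt => /predU1P[->|cd] dpsi cpsi.
  by rewrite set_itv1 Rintegral_set1 subrr.
have cp : continuous psi.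
  by move=> x; apply: differentiable_continuous; exact/derivable1_diffP.
have dp : derivable_oo_LRcontinuous psi c d.
  split; first by move=> x _; exact: dpsi.
  - by apply: cvg_at_right_filter; exact: cp.
  - by apply: cvg_at_left_filter; exact: cp.
have FTC : (\int[mu]_(x in `[c, d]) (derive1 psi x)%:E = (psi d)%:E - (psi c)%:E)%E.
  exact: (continuous_FTC2 cd (continuous_subspaceT cpsi) dp (fun _ _ => erefl)).
by rewrite /Rintegral FTC.
Qed.

Lemma integral_restrictE (D : set R) f h :
  \int[mu]_(x in D) (f x * h x) = \int[mu]_x ((f \_ D) x * h x).
Proof.
rewrite Rintegral_mkcond; apply: eq_Rintegral => x _.
by rewrite /patch; case: ifP; rewrite ?mul0r.
Qed.

(** Fubini on the triangle t <= y: exchanging the order leaves the integral of g(t) (psi(d) -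
    psi(t)). The boundary term at [d] vanishes with [psi], the one at [c] with the primitive. *)
Lemma integral_prim_derive1 c d g psi : c <= d ->
  mu.-integrable `[c, d] (EFin \o g) ->
  (forall x, derivable psi x 1) -> continuous (derive1 psi) -> psi d = 0 ->
  \int[mu]_(y in `[c, d]) ((\int[mu]_(t in `[c, y]) g t) * derive1 psi y) =
  - \int[mu]_(y in `[c, d]) (g y * psi y).
Proof.
move=> cd gi dpsi cpsi psid.
pose I : set (R * R) := [set z | z.1 <= z.2].
pose F z := (g \_ `[c, d]) z.1 * (derive1 psi \_ `[c, d]) z.2 * \1_I z.
have iF : (mu \x mu)%E.-integrable setT (EFin \o F).
  have i1 : (mu \x mu)%E.-integrable setT (EFin \o
      (fun z => (g \_ `[c, d]) z.1 * (derive1 psi \_ `[c, d]) z.2)).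
    apply: integrable_tensor; rewrite -restrict_EFin.
      by apply/integrable_restrict => //=; rewrite setTI.
    apply/integrable_restrict => //=; rewrite setTI.
    apply: continuous_compact_integrable; first exact: segment_compact.
    exact: continuous_subspaceT.
  apply: (le_integrable _ _ _ i1) => //.
    apply/measurable_EFinP; apply: measurable_funM.
      by apply/measurable_EFinP; exact: measurable_int i1.
    by apply: measurable_indic; exact: measurable_le_set.
  move=> z _ /=; rewrite lee_fin [leLHS]normrM ler_piMr//.
  by rewrite indicE; case: (_ \in _); rewrite ?normr1 ?normr0.
transitivity (\int[mu]_y \int[mu]_x F (x, y)).
  under eq_Rintegral do rewrite mulrC.
  rewrite integral_restrictE; apply: eq_Rintegral => y _.
  rewrite /F/=; have [ycd|ycd] := boolP (y \in `[c, d]).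
    have := ycd; rewrite in_itv/= => /andP[cy yd].
    rewrite mulrC -RintegralZr//; last exact: integrable_sub_itv gi.
    rewrite -(integral_le_indic_l _ ycd); apply: eq_Rintegral => x _.
    by rewrite /patch; case: ifP; rewrite ?mul0r.
  rewrite patchE ifN; last by apply: contra ycd; rewrite inE.
  rewrite mul0r; under eq_Rintegral do rewrite mulr0 mul0r.
  by rewrite Rintegral_cst// mul0r.
rewrite RFubini2// -RFubini1// -mulN1r -RintegralZl//; last first.
  apply: integrableMc => //; apply: continuous_subspaceT => x.
  by apply: differentiable_continuous; exact/derivable1_diffP.
under [RHS]eq_Rintegral do rewrite mulrCA.
rewrite integral_restrictE; apply: eq_Rintegral => x _.
rewrite /F/=; have [xcd|xcd] := boolP (x \in `[c, d]); last first.
  rewrite patchE ifN; last by apply: contra xcd; rewrite inE.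
  rewrite mul0r; under eq_Rintegral do rewrite !mul0r.
  by rewrite Rintegral_cst// mul0r.
have := xcd; rewrite in_itv/= => /andP[cx xd].
have ci : mu.-integrable `[x, d] (EFin \o derive1 psi).
  apply: continuous_compact_integrable; first exact: segment_compact.
  exact: continuous_subspaceT.
(* Writes -psi(x) as psi(d) - psi(x), the integral of psi' over [[x, d]]. *)
rewrite mulN1r -[- psi x]add0r -{1}psid -(integral_derive1 xd)//.
rewrite -RintegralZl// -(integral_le_indic_r _ xcd); apply: eq_Rintegral => y _.
by rewrite /patch; case: ifP; case: ifP; rewrite ?mulr0 ?mul0r.
Qed.

End ibp.

(** * Functions of one variable with an integrable weak derivative *)

Section weak_1d.
Context {R : realType}.
Local Notation mu := (@lebesgue_measure R).
Implicit Types (c d : R) (f g h k psi : R -> R).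

Lemma test1D c d h k : test1 c d h -> test1 c d k -> test1 c d (h + k).
Proof.
move=> [sh [s [t [cs st td h0]]]] [sk [s' [t' [cs' st' td' k0]]]]; split.
  by move=> n; exact: CkD.
exists (Num.min s s'), (Num.max t t'); split.
- by rewrite lt_min cs.
- by rewrite gt_min !lt_max st.
- by rewrite gt_max td.
move=> x; rewrite in_itv/= ge_min le_max => /negP xst.
have hx : h x = 0.
  by apply: h0; rewrite in_itv/=; apply/negP => /andP[sx xt]; apply: xst; rewrite sx xt.
have kx : k x = 0.
  by apply: k0; rewrite in_itv/=; apply/negP => /andP[sx xt]; apply: xst; rewrite sx xt !orbT.
by rewrite (_ : (h + k) x = h x + k x)// hx kx addr0.
Qed.

Lemma test1Z c d (r : R) k : test1 c d k -> test1 c d (r *: k).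
Proof.
move=> [sk [s [t [cs st td k0]]]]; split; first by move=> n; exact: CkZ.
by exists s, t; split => // x xst; rewrite (_ : (r *: k) x = r * k x)// k0// mulr0.
Qed.

Lemma test1_continuous c d k : test1 c d k -> continuous k.
Proof. by case=> /smooth1_continuous. Qed.

Lemma test1_derivable c d k : test1 c d k -> forall x, derivable k x 1.
Proof. by case=> /smooth1_derivable. Qed.

Lemma test1_integrable c d k (s t : R) : test1 c d k -> mu.-integrable `[s, t] (EFin \o k).
Proof.
move=> tk; apply: continuous_compact_integrable; first exact: segment_compact.
by apply: continuous_subspaceT; exact: test1_continuous tk.
Qed.

Lemma test1_end c d k : test1 c d k -> k d = 0.
Proof.
move=> [_ [s [t [cs st td ->//]]]].
by rewrite in_itv/= andbC leNgt td.
Qed.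

(** [smooth1] concerns the whole line. To the right of [c] this is the fundamental theorem; at [c]
    and to its left the primitive vanishes in a neighbourhood, because [k] is zero below some s >
    c. *)
Lemma is_derive_prim_test1 c d k (x : R) : test1 c d k ->
  is_derive x 1 (fun y => \int[mu]_(t in `[c, y]) k t) (k x).
Proof.
move=> tk; have [sk [s [t [cs st td k0]]]] := tk.
have [cx|xc] := ltP c x.
  have [] := @continuous_FTC1_closed R k c x (x + 1) _ _ cx.
  - by rewrite ltrDl.
  - exact: test1_integrable tk.
  - exact: test1_continuous tk _.
  by rewrite derive1E => H1 H2; apply: DeriveDef.
have -> : k x = 0 by apply: k0; rewrite in_itv/= leNgt (le_lt_trans xc cs).
have : is_derive x 1 (cst (0 : R)) 0 by exact: is_derive_cst.
apply: near_eq_is_derive; near=> y.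
have ys : y < s by near: y; apply: lt_nbhsl; exact: le_lt_trans cs.
rewrite [LHS]/=; rewrite (@eq_Rintegral _ _ _ mu _ (cst 0)).
  by rewrite Rintegral_cst// mul0r.
move=> z; rewrite inE/= in_itv/= => /andP[_ zy].
by apply: k0; rewrite in_itv/= leNgt (le_lt_trans zy ys).
Unshelve. all: by end_near. Qed.

Lemma derive1_prim_test1 c d k : test1 c d k ->
  derive1 (fun y => \int[mu]_(t in `[c, y]) k t) = k.
Proof.
move=> tk; apply/funext => x; rewrite derive1E.
by have [_ ->] := is_derive_prim_test1 x tk.
Qed.

(** Beyond the support of [k] the primitive equals the total integral, so compact support of the
    primitive amounts to zero mean of [k]. *)
Lemma test1_prim c d k : test1 c d k -> \int[mu]_(t in `[c, d]) k t = 0 ->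
  test1 c d (fun y => \int[mu]_(t in `[c, y]) k t).
Proof.
move=> tk ik0; have [sk [s [t [cs st td k0]]]] := tk; split.
  case=> // n; split; first by move=> x; have [] := is_derive_prim_test1 x tk.
  by rewrite (derive1_prim_test1 tk).
exists s, t; split => // x; rewrite in_itv/= negb_and -!ltNge => /orP[xs|tx].
  rewrite (@eq_Rintegral _ _ _ mu _ (cst 0)).
    by rewrite Rintegral_cst// mul0r.
  move=> z; rewrite inE/= in_itv/= => /andP[_ zx].
  by apply: k0; rewrite in_itv/= leNgt (le_lt_trans zx xs).
rewrite -[RHS]ik0 [LHS]Rintegral_mkcond [RHS]Rintegral_mkcond.
apply: eq_Rintegral => z _; rewrite /patch.
have [zst|zst] := boolP (z \in `[s, t]).
  move: zst; rewrite in_itv/= => /andP[sz zt].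
  by rewrite !ifT// inE/= in_itv/=; lra.
by rewrite k0// !if_same.
Qed.

Lemma not_ae_false c d (P : R -> Prop) : c < d ->
  {ae mu, forall x, P x} -> exists2 x, x \in `]c, d[ & P x.
Proof.
move=> cd [N [mN N0 PN]]; apply: contrapT => H.
have : (mu `]c, d[ <= mu N)%E.
  apply: le_measure; rewrite ?inE// => x xcd; apply: PN => /= Px.
  by apply: H; exists x.
rewrite N0 lebesgue_measure_itv/= lte_fin cd -EFinD lee_fin.
by rewrite leNgt subr_gt0 cd.
Qed.

(* T is countable, so that the hypothesis, known for each n almost everywhere in a
   parameter, holds for all n outside of one null set. The constant is obtained by
   testing against psi0 of integral 1, and theta' = psi0. *)
Lemma weak_derivative_1d c d : c < d -> exists T : nat -> R -> R,
  exists psi0 theta : R -> R,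
  [/\ forall n, test1 c d (T n), test1 c d psi0, continuous theta &
    forall f g, mu.-integrable `[c, d] (EFin \o f) ->
      mu.-integrable `[c, d] (EFin \o g) ->
      (forall n, \int[mu]_(x in `[c, d]) (f x * derive1 (T n) x) =
                 - \int[mu]_(x in `[c, d]) (g x * T n x)) ->
    {ae mu, forall y, y \in `[c, d] ->
      f y = (\int[mu]_(x in `[c, d]) (f x * psi0 x) +
             \int[mu]_(x in `[c, d]) (g x * theta x)) +
            \int[mu]_(x in `[c, y]) g x}].
Proof.
move=> cd; have [h [th hsep]] := test1_separating cd.
have cont_int k : continuous k -> mu.-integrable `[c, d] (EFin \o k).
  move=> ck; apply: continuous_compact_integrable; first exact: segment_compact.
  exact: continuous_subspaceT.
(* Otherwise the constant 1 would be orthogonal to the whole separating family, hence zero almost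
   everywhere. *)
have [N hN] : exists N, \int[mu]_(x in `[c, d]) h N x != 0.
  apply: contrapT => H.
  have /(not_ae_false cd) : {ae mu, forall x, x \in `[c, d] -> (1 : R) = 0}.
    apply: (hsep (cst 1)); first by apply: cont_int; exact: cst_continuous.
    move=> n; under eq_Rintegral do rewrite mul1r.
    by apply/eqP/negPn/negP => ?; apply: H; exists n.
  move=> [x /subset_itv_oo_cc xcd /(_ xcd)/eqP]; by rewrite oner_eq0.
pose psi0 : R -> R := (\int[mu]_(x in `[c, d]) h N x)^-1 *: h N.
have tpsi0 : test1 c d psi0 by exact: test1Z.
have ipsi0 : \int[mu]_(x in `[c, d]) psi0 x = 1.
  by rewrite RintegralZl ?mulVf//; exact: test1_integrable (th N).
(* Subtracting its mean times [psi0] makes [h n] the derivative of a test function, namely [T n]. *)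
pose k n : R -> R := h n + (- \int[mu]_(x in `[c, d]) h n x) *: psi0.
have kE n x : k n x = h n x + (- \int[mu]_(x in `[c, d]) h n x) * psi0 x by [].
have tk n : test1 c d (k n) by apply: test1D => //; exact: test1Z.
have ik n : \int[mu]_(x in `[c, d]) k n x = 0.
  rewrite RintegralD//; last 2 first.
    exact: test1_integrable (th n).
    by apply: test1_integrable; exact: test1Z tpsi0.
  rewrite RintegralZl//; last exact: test1_integrable tpsi0.
  by rewrite ipsi0 mulr1 subrr.
pose T n y := \int[mu]_(t in `[c, y]) k n t.
(* The shift by 1, the integral of [psi0], gives theta(d) = 0, as the integration by parts
   requires. *)
pose theta y := \int[mu]_(t in `[c, y]) psi0 t - 1.
have tT n : test1 c d (T n) by exact: test1_prim.
have dtheta (x : R) : is_derive x 1 theta (psi0 x).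
  have d0 := is_derive_prim_test1 x tpsi0.
  have := is_deriveB d0 (is_derive_cst (1 : R) x 1).
  by rewrite subr0.
have d1theta : derive1 theta = psi0.
  by apply/funext => x; rewrite derive1E; have [_ ->] := dtheta x.
have ctheta : continuous theta.
  move=> x; apply: differentiable_continuous; apply/derivable1_diffP.
  by have [] := dtheta x.
exists T, psi0, theta; split => // f g fi gi fg.
pose G y := \int[mu]_(t in `[c, y]) g t.
have cG : {within `[c, d], continuous G} by exact: prim_continuous (ltW cd) gi.
have Gi : mu.-integrable `[c, d] (EFin \o G).
  by apply: continuous_compact_integrable => //; exact: segment_compact.
have Wi : mu.-integrable `[c, d] (EFin \o (fun x => f x - G x)).
  rewrite (_ : _ \o _ = ((EFin \o f) \- (EFin \o G))%E)//.
  exact: integrableB.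
have fM k' : continuous k' -> mu.-integrable `[c, d] (EFin \o (fun x => f x * k' x)).
  by move=> ?; apply: integrableMc => //; exact: continuous_subspaceT.
have GM k' : continuous k' -> mu.-integrable `[c, d] (EFin \o (fun x => G x * k' x)).
  by move=> ?; apply: integrableMc => //; exact: continuous_subspaceT.
have WM k' : continuous k' -> mu.-integrable `[c, d] (EFin \o (fun x => (f x - G x) * k' x)).
  by move=> ?; apply: integrableMc => //; exact: continuous_subspaceT.
have WE k' : continuous k' -> \int[mu]_(x in `[c, d]) ((f x - G x) * k' x) =
    \int[mu]_(x in `[c, d]) (f x * k' x) - \int[mu]_(x in `[c, d]) (G x * k' x).
  move=> ck'; rewrite -RintegralB//; [|exact: fM|exact: GM].
  by apply: eq_Rintegral => x _; rewrite mulrBl.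
set B := _ + _.
(* With G the primitive of [g], integration by parts turns the integral of g theta into minus that
   of G psi0. So [B] is the weighted mean of f - G. *)
have BE : B = \int[mu]_(x in `[c, d]) ((f x - G x) * psi0 x).
  rewrite WE; last exact: test1_continuous tpsi0.
  have dtheta' (x : R) : derivable theta x 1 by have [] := dtheta x.
  have cd1 : continuous (derive1 theta).
    by rewrite d1theta; exact: test1_continuous tpsi0.
  have thetad : theta d = 0 by rewrite /theta ipsi0 subrr.
  have := integral_prim_derive1 (ltW cd) gi dtheta' cd1 thetad.
  by rewrite d1theta -/G /B => ->; rewrite opprK.
(* The hypothesis for [T n] and the integration by parts for G have the same right-hand side.
   Written out in [h n] and [psi0], the result says that (f - G) - B is orthogonal to every
   [h n]. *)
have W0 n : \int[mu]_(x in `[c, d]) ((f x - G x) * k n x) = 0.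
  rewrite WE; last exact: test1_continuous (tk n).
  have dT : derive1 (T n) = k n by exact: derive1_prim_test1.
  have cT : continuous (derive1 (T n)).
    by rewrite dT; exact: test1_continuous (tk n).
  have := integral_prim_derive1 (ltW cd) gi (test1_derivable (tT n)) cT (test1_end (tT n)).
  by rewrite -/G -[k n]dT fg => ->; rewrite subrr.
have : {ae mu, forall x, x \in `[c, d] -> (f x - G x) - B = 0}.
  apply: hsep.
    rewrite (_ : _ \o _ = ((EFin \o (fun x => (f x - G x)%R)) \- (EFin \o cst B))%E)//.
    by apply: integrableB => //; apply: cont_int; exact: cst_continuous.
  move=> n; under eq_Rintegral do rewrite mulrBl.
  have ch := test1_continuous (th n).
  rewrite RintegralB//; [|exact: WM|]; last first.
    by apply: integrableMc; [apply: cont_int; exact: cst_continuous|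
      exact: continuous_subspaceT].
  rewrite RintegralZl//; last exact: test1_integrable (th n).
  have cp := test1_continuous tpsi0.
  have := W0 n.
  under eq_Rintegral do rewrite kE mulrDr mulrCA.
  rewrite RintegralD//; [|exact: WM|]; last first.
    rewrite (_ : _ \o _ = (fun x => (- \int[mu]_(x in `[c, d]) h n x)%:E *
      (EFin \o (fun x => ((f x - G x) * psi0 x)%R)) x)%E)//.
    by apply: integrableZl => //; exact: WM.
  by rewrite RintegralZl -?BE ?mulNr 1?[B * _]mulrC//; exact: WM.
apply: filterS => y Hy /Hy/eqP; rewrite subr_eq0 subr_eq => /eqP ->.
by rewrite addrC.
Qed.

End weak_1d.

(** * Reduction to tensor test functions *)

Section tensor.
Context {R : realType}.
Implicit Types (phi psi : R -> R).

Definition tensor phi psi : R * R -> R := fun z => phi z.1 * psi z.2.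

Lemma derivable1_cvg phi (x : R) : derivable phi x 1 ->
  h^-1 * (phi (h + x) - phi x) @[h --> 0^'] --> derive1 phi x.
Proof.
rewrite derive1E => dphi.
have : h^-1 *: (phi (h *: (1 : R) + x) - phi x) @[h --> 0^'] --> 'D_1 phi x.
  exact: dphi.
have -> // : (fun h => h^-1 *: (phi (h *: (1 : R) + x) - phi x)) =
  (fun h => h^-1 * (phi (h + x) - phi x)).
by apply/funext => h; rewrite [h *: 1]mulr1.
Qed.

Lemma dx_tensor phi psi : (forall x, derivable phi x 1) ->
  dx (tensor phi psi) = tensor (derive1 phi) psi.
Proof.
move=> dphi; apply/funext => -[x y]; apply/cvg_lim => //.
rewrite (_ : (fun h => _) =
    (fun h : R => h^-1 * (phi (h + x) - phi x) * psi y)).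
  by apply: cvgMr_tmp; exact: derivable1_cvg.
apply/funext => h; rewrite /tensor/= [h *: 1]mulr1 [h *: 0]mulr0 add0r.
by rewrite -mulrBl; exact: mulrA.
Qed.

Lemma dy_tensor phi psi : (forall x, derivable psi x 1) ->
  dy (tensor phi psi) = tensor phi (derive1 psi).
Proof.
move=> dphi; apply/funext => -[x y]; apply/cvg_lim => //.
rewrite (_ : (fun h => _) =
    (fun h : R => phi x * (h^-1 * (psi (h + y) - psi y)))).
  by apply: cvgMl_tmp; exact: derivable1_cvg.
apply/funext => h; rewrite /tensor/= [h *: 1]mulr1 [h *: 0]mulr0 add0r.
by rewrite -mulrBr; exact: mulrCA.
Qed.

Lemma iter_dx_tensor phi psi n : smooth1 phi ->
  iter n dx (tensor phi psi) = tensor (derive1n n phi) psi.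
Proof.
move=> sphi; elim: n => // n IH; rewrite iterS IH dx_tensor ?derive1nS//.
by apply: smooth1_derivable; exact: smooth1_derive1n.
Qed.

Lemma iter_dy_tensor phi psi n : smooth1 psi ->
  iter n dy (tensor phi psi) = tensor phi (derive1n n psi).
Proof.
move=> sphi; elim: n => // n IH; rewrite iterS IH dy_tensor ?derive1nS//.
by apply: smooth1_derivable; exact: smooth1_derive1n.
Qed.

Lemma differentiable_tensor phi psi z : (forall x, derivable phi x 1) ->
  (forall x, derivable psi x 1) -> differentiable (tensor phi psi) z.
Proof.
move=> dphi dpsi; apply: differentiableM.
  apply: (@differentiable_comp _ _ _ _ (fst : R * R -> R) phi).
    apply: (@linear_differentiable R (R * R)%type R fst) => ?; exact: cvg_fst.
  by apply/derivable1_diffP; exact: dphi.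
apply: (@differentiable_comp _ _ _ _ (snd : R * R -> R) psi).
  apply: (@linear_differentiable R (R * R)%type R snd) => ?; exact: cvg_snd.
by apply/derivable1_diffP; exact: dpsi.
Qed.

(** Any word in [dx] and [dy] applied to a tensor product is again a tensor product of iterated
    derivatives, whatever the order of the letters. *)
Lemma smooth_tensor phi psi : smooth1 phi -> smooth1 psi -> smooth (tensor phi psi).
Proof.
move=> sphi spsi w z.
suff [i [j ->]] : exists i j,
    foldr (fun i f => if i then dx f else dy f) (tensor phi psi) w =
    tensor (derive1n i phi) (derive1n j psi).
  by apply: differentiable_tensor; apply/smooth1_derivable/smooth1_derive1n.
elim: w => [|[] w [i [j IH]]]; first by exists 0%N, 0%N.
- exists i.+1, j; rewrite /= IH dx_tensor ?derive1nS//.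
  exact/smooth1_derivable/smooth1_derive1n.
- exists i, j.+1; rewrite /= IH dy_tensor ?derive1nS//.
  exact/smooth1_derivable/smooth1_derive1n.
Qed.

Lemma test_function_tensor a b c d phi psi : test1 a b phi -> test1 c d psi ->
  test_function a b c d (tensor phi psi).
Proof.
move=> [sphi [s [t [cs st td phi0]]]] [spsi [s' [t' [cs' st' td' psi0]]]].
have sub : closure [set z | tensor phi psi z != 0] `<=` `[s, t] `*` `[s', t'].
  have /closure_id -> : closed (`[s, t] `*` `[s', t'] : set (R * R)).
    apply: compact_closed; first exact: norm_hausdorff.
    by apply: compact_setX; exact: segment_compact.
  apply: closureS => -[x y] /=; rewrite /tensor/= mulf_eq0 negb_or => /andP[fx fy].
  split; apply/negPn/negP => H.
    by rewrite phi0 ?eqxx in fx.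
  by rewrite psi0 ?eqxx in fy.
split; first exact: smooth_tensor.
  apply: subclosed_compact sub; first exact: closed_closure.
  by apply: compact_setX; exact: segment_compact.
apply: subset_trans sub _ => -[x y] /=; rewrite !in_itv/= => -[/andP[? ?] /andP[? ?]].
by split; lra.
Qed.

(** The weak identity tested on tensor products only. This is all that the proof exploits of a weak
    derivative, and on products a derivative falls on a single factor, so derivatives are easily
    moved and the variables easily exchanged. *)
Definition weak_pair a b c d i j (u v : R * R -> R) :=
  forall phi psi, test1 a b phi -> test1 c d psi ->
    \int[leb2]_(z in rect a b c d) (u z * tensor (derive1n i phi) (derive1n j psi) z) =
    (-1) ^+ (i + j) * \int[leb2]_(z in rect a b c d) (v z * tensor phi psi z).

Lemma test1_derive1 a b phi : test1 a b phi -> test1 a b (derive1 phi).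
Proof.
move=> [sphi [s [t [cs st td phi0]]]]; split; first exact: smooth1_derive1.
exists s, t; split => // x; rewrite in_itv/= negb_and -!ltNge => xst.
have : is_derive x 1 (cst (0 : R)) 0 by exact: is_derive_cst.
suff near0 : \forall y \near x, cst 0 y = phi y.
  by move=> /(near_eq_is_derive near0)[_]; rewrite derive1E.
case/orP: xst => H; near=> y; rewrite /= phi0//; rewrite in_itv/= negb_and -!ltNge; apply/orP.
- by left; near: y; exact: lt_nbhsl.
- by right; near: y; exact: lt_nbhsr.
Unshelve. all: by end_near. Qed.

Lemma test1_derive1n a b phi n : test1 a b phi -> test1 a b (derive1n n phi).
Proof. by elim: n => // n IH tphi; rewrite derive1nS; exact/test1_derive1/IH. Qed.

Lemma is_weak_derivative_pair a b c d i j u v :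
  is_weak_derivative a b c d i j u v -> weak_pair a b c d i j u v.
Proof.
move=> [_ H] phi psi tphi tpsi; have := H _ (test_function_tensor tphi tpsi).
by rewrite iter_dy_tensor ?iter_dx_tensor//; [case: tphi|case: tpsi].
Qed.

(** Both sides are computed on [u]: the order (i, j) tested with psi' is the order (i, j+1) tested
    with [psi], and the common sign cancels. *)
Lemma weak_pair_dy a b c d i j u p q :
  weak_pair a b c d i j u p -> weak_pair a b c d i j.+1 u q ->
  weak_pair a b c d 0 1 p q.
Proof.
move=> up uq phi psi tphi tpsi.
have := up _ _ tphi (test1_derive1 tpsi); rewrite -derive1Sn uq// => H.
apply: (@mulfI _ ((-1) ^+ (i + j))); first by rewrite signr_eq0.
by rewrite mulrA -exprD add0n addn1 -addnS -H.
Qed.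

Lemma weak_pair_dx a b c d i j u p q :
  weak_pair a b c d i j u p -> weak_pair a b c d i.+1 j u q ->
  weak_pair a b c d 1 0 p q.
Proof.
move=> up uq phi psi tphi tpsi.
have := up _ _ (test1_derive1 tphi) tpsi; rewrite -derive1Sn uq// => H.
apply: (@mulfI _ ((-1) ^+ (i + j))); first by rewrite signr_eq0.
by rewrite mulrA -exprD addn0 addn1 -addSn -H.
Qed.

End tensor.

(** * Measurability and square integrability on a rectangle *)

Section measurability.
Context d1 d2 (T1 : measurableType d1) (T2 : measurableType d2) {R : realType}.
Variables (m1 : {sigma_finite_measure set T1 -> \bar R})
          (m2 : {sigma_finite_measure set T2 -> \bar R}).

(** The positive and negative parts are measurable in the parameter by Tonelli; their difference in
    the extended reals is the integral by definition, and [fine] is measurable. *)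
Lemma measurable_param_integral (F : T1 * T2 -> R) :
  measurable_fun setT F -> measurable_fun setT (fun x => \int[m2]_y F (x, y)).
Proof.
move=> mF; have mEF : measurable_fun setT (EFin \o F) by exact/measurable_EFinP.
apply: measurableT_comp; first exact: fine_measurable.
rewrite (_ : (fun x => _) = (fubini_F m2 (EFin \o F)^\+ \- fubini_F m2 (EFin \o F)^\-)%E).
  apply: emeasurable_funB; apply: measurable_fun_fubini_tonelli_F => //.
    exact: measurable_funepos.
  exact: measurable_funeneg.
apply/funext => x; rewrite integralE.
by congr (_ - _)%E; apply: eq_integral => y _; rewrite !(funeposE, funenegE).
Qed.

(** The measure of the exceptional set is the integral of the measures of its sections; a
    nonnegative function with zero integral vanishes almost everywhere. *)
Lemma ae_sections (P : T1 * T2 -> Prop) : {ae (m1 \x m2)%E, forall z, P z} ->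
  {ae m1, forall x, {ae m2, forall y, P (x, y)}}.
Proof.
move=> [N [mN N0 PN]].
have : {ae m1, forall x, setT x -> m2 (xsection N x) = cst 0%E x}.
  apply/ae_eq_integral_abs => //; first exact: measurable_fun_xsection.
  rewrite -N0; apply: eq_integral => x _; rewrite gee0_abs//.
apply: filterS => x /(_ I) /= Nx; exists (xsection N x); split => //.
  exact: measurable_xsection.
by move=> y /= Pxy; rewrite /xsection/= inE; apply: PN.
Qed.

(** Null sections alone do not make a null set: measurability of [f] and [g] is what makes the set
    where they differ measurable, so that its measure is the integral over sections. *)
Lemma ae_of_sections (f g : T1 * T2 -> R) :
  measurable_fun setT f -> measurable_fun setT g ->
  {ae m1, forall x, {ae m2, forall y, f (x, y) = g (x, y)}} ->
  {ae (m1 \x m2)%E, forall z, f z = g z}.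
Proof.
move=> mf mg fg; pose N := [set z | f z != g z].
have mN : measurable N.
  have -> : N = setT `&` (f \- g) @^-1` (~` [set 0]).
    rewrite setTI; apply/seteqP; split => z /=.
      by move=> /eqP fgz; apply/eqP; rewrite subr_eq0; apply/eqP.
    by move/eqP; rewrite subr_eq0.
  by apply: measurable_funB => //; exact: measurableC.
exists N; split => //; last by move=> z /= /eqP.
rewrite /product_measure1 (@ae_eq_integral _ _ _ m1 setT (cst 0%E))//.
- by rewrite integral_cst// mul0e.
- exact: measurable_fun_xsection.
- apply: filterS fg => x [M [mM M0 fgM]] _ /=.
  apply/eqP; rewrite -measure_le0 -M0; apply: le_measure; rewrite ?inE//.
    exact: measurable_xsection.
  by move=> y /=; rewrite /xsection/= inE => /eqP H; exact: fgM.
Qed.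

Lemma ae_fst (P : T1 -> Prop) : {ae m1, forall x, P x} ->
  {ae (m1 \x m2)%E, forall z, P z.1}.
Proof.
move=> [N [mN N0 PN]]; exists (N `*` setT); split.
- exact: measurableX.
- transitivity (m1 N * m2 setT)%E; first exact: product_measure1E.
  by rewrite [m1 N]N0 mul0e.
- by move=> z /= Pz; split => //; exact: PN.
Qed.

Lemma ae_snd (P : T2 -> Prop) : {ae m2, forall y, P y} ->
  {ae (m1 \x m2)%E, forall z, P z.2}.
Proof.
move=> [N [mN N0 PN]]; exists (setT `*` N); split.
- exact: measurableX.
- transitivity (m1 setT * m2 N)%E; first exact: product_measure1E.
  by rewrite [m2 N]N0 mule0.
- by move=> z /= Pz; split => //; exact: PN.
Qed.

End measurability.

Section Lfun2.
Context d (T : measurableType d) {R : realType} (m : {measure set T -> \bar R}).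

Lemma Lfun2P (f : T -> R) : measurable_fun setT f ->
  (\int[m]_x ((f x) ^+ 2)%:E < +oo)%E -> f \in Lfun m 2%:E.
Proof.
move=> mf fi; rewrite inE; apply/andP; split; rewrite inE//=.
rewrite /finite_norm unlock poweR_lty//.
rewrite (eq_integral (fun x => ((f x) ^+ 2)%:E))// => x _ /=.
by rewrite powR_mulrn// real_normK// num_real.
Qed.

Lemma Lfun2_sqr (f : T -> R) : f \in Lfun m 2%:E ->
  measurable_fun setT f /\ m.-integrable setT (EFin \o (fun x => f x ^+ 2)).
Proof.
move=> Lf; split; last exact: Lfun2_integrable_sqr.
by move: Lf; rewrite inE => /andP[]; rewrite inE.
Qed.

End Lfun2.

(** * Exchange of the two variables *)

Section swap.
Context {R : realType}.
Local Notation mu := (@lebesgue_measure R).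

(** Statements along [x] are deduced from those along [y] by composing with this map and exchanging
    [[a, b]] and [[c, d]]. *)
Definition swap (z : R * R) : R * R := (z.2, z.1).

Lemma measurable_swap : measurable_fun setT swap.
Proof.
by apply/measurable_fun_pairP; split; [exact: measurable_snd|exact: measurable_fst].
Qed.

(** The left side is the product measure computed with the other family of sections; the two agree
    by uniqueness of the product measure. *)
Lemma leb2_swap (A : set (R * R)) : measurable A ->
  leb2 (swap @^-1` A) = leb2 A.
Proof.
move=> mA; rewrite /leb2 /leb1.
transitivity ((mu \x^ mu)%E A).
  by apply: eq_integral => x _; congr mu; apply/seteqP; split => y /=;
    rewrite /xsection /ysection/= !inE.
by apply/esym; apply: product_measure_unique => // B C mB mC /=; rewrite product_measure2E.
Qed.

Lemma ae_swap (P : R * R -> Prop) : {ae leb2, forall z, P z} ->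
  {ae leb2, forall z, P (swap z)}.
Proof.
move=> [N [mN N0 PN]]; exists (swap @^-1` N); split.
- by rewrite -[X in measurable X]setTI; exact: measurable_swap.
- by rewrite leb2_swap.
- by move=> z Pz; apply: PN.
Qed.

Lemma integrable_swap (F : R * R -> R) :
  (mu \x mu)%E.-integrable setT (EFin \o F) ->
  (mu \x mu)%E.-integrable setT (EFin \o (F \o swap)).
Proof.
move=> iF; have mF := measurable_int _ iF.
apply/integrable12ltyP.
  by apply: (measurableT_comp mF); exact: measurable_swap.
exact: ((integrable21ltyP mu mu mF).1 iF).
Qed.

Lemma Rintegral_swap (F : R * R -> R) :
  (mu \x mu)%E.-integrable setT (EFin \o F) ->
  \int[(mu \x mu)%E]_z F (swap z) = \int[(mu \x mu)%E]_z F z.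
Proof.
move=> iF; rewrite -(@RFubini1 _ _ _ _ R mu mu (F \o swap)); last exact: integrable_swap.
by rewrite -RFubini2.
Qed.

End swap.

Section L2_spaces.
Context {R : realType}.
Local Notation mu := (@lebesgue_measure R).
Implicit Types (a b c d s t : R) (w h : R -> R) (f : R * R -> R).

Lemma L2P s t w : L2 s t w <-> measurable_fun (setT : set (measurableTypeR R)) (w \_ `[s, t]) /\
  mu.-integrable setT (EFin \o (fun x => (w \_ `[s, t]) x ^+ 2)).
Proof.
split; first by move=> /Lfun2_sqr.
move=> [mw iw]; apply: Lfun2P => //; exact: integrable_lty iw.
Qed.

Lemma L2_rectP a b c d f : L2_rect a b c d f <->
  measurable_fun (setT : set (measurableTypeR R * measurableTypeR R))
    (f \_ (rect a b c d)) /\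
  (mu \x mu)%E.-integrable setT (EFin \o (fun z => (f \_ (rect a b c d)) z ^+ 2)).
Proof.
split; first by move=> /Lfun2_sqr.
move=> [mw iw]; apply: Lfun2P => //; exact: integrable_lty iw.
Qed.

Lemma measurable_rect a b c d :
  measurable (rect a b c d : set (measurableTypeR R * measurableTypeR R)).
Proof. exact: measurableX. Qed.

Lemma normr_le_1Dsqr (x : R) : `|x| <= 1 + x ^+ 2.
Proof.
rewrite -real_normK ?num_real// expr2; have := normr_ge0 x.
set y := `|x|; nra.
Qed.

(** On a set of finite measure, |f| <= 1 + f^2 gives the bound. *)
Lemma square_integrable dd (T : measurableType dd) (m : {measure set T -> \bar R})
    (D : set T) (f : T -> R) : measurable D -> (m D < +oo)%E ->
  measurable_fun D f ->
  m.-integrable D (EFin \o (fun x => f x ^+ 2)) -> m.-integrable D (EFin \o f).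
Proof.
move=> mD Dfin mf if2.
have i1 : m.-integrable D (EFin \o cst (1 : R)).
  apply: measurable_bounded_integrable => //; exact: bounded_cst.
have iD : m.-integrable D (EFin \o (fun x => 1 + f x ^+ 2)).
  rewrite (_ : _ \o _ = (EFin \o cst (1%R : R)) \+ (EFin \o (fun x => (f x ^+ 2)%R)))%E//.
  exact: integrableD.
apply: (le_integrable _ _ _ iD) => //; first exact/measurable_EFinP.
move=> x _ /=; rewrite lee_fin [leRHS]ger0_norm ?normr_le_1Dsqr//.
by rewrite addr_ge0// sqr_ge0.
Qed.

Lemma restrict_integrable dd (T : measurableType dd) (m : {measure set T -> \bar R})
    (D : set T) (f : T -> R) : measurable D ->
  m.-integrable D (EFin \o f) <-> m.-integrable setT (EFin \o (f \_ D)).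
Proof. by move=> mD; rewrite -restrict_EFin; exact: integrable_mkcond. Qed.

Lemma restrict_sqr dd (T : measurableType dd) (D : set T) (f : T -> R) :
  (fun x => (f \_ D) x ^+ 2) = (fun x => f x ^+ 2) \_ D.
Proof.
by apply/funext => x; rewrite /patch; case: ifP => // _; rewrite expr0n.
Qed.

Lemma L2_integrable s t w : L2 s t w -> mu.-integrable `[s, t] (EFin \o w).
Proof.
move=> /L2P[mw iw]; apply: square_integrable => //.
- by rewrite [X in (X < _)%E]lebesgue_measure_itv/=; case: ifP => // _; rewrite -EFinD ltry.
- by apply/(measurable_restrictT _ _).2.
- by apply/restrict_integrable => //; rewrite -restrict_sqr.
Qed.

Lemma rect_finite a b c d : ((mu \x mu)%E (rect a b c d) < +oo)%E.
Proof.
have -> : ((mu \x mu)%E (rect a b c d) = mu `[a, b] * mu `[c, d])%E.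
  exact: product_measure1E.
by rewrite !lebesgue_measure_itv/=; do 2 case: ifP; rewrite ?mule0 ?mul0e// -?EFinD -?EFinM ?ltry.
Qed.

Lemma L2_rect_integrable a b c d f : L2_rect a b c d f ->
  (mu \x mu)%E.-integrable setT (EFin \o (f \_ (rect a b c d))).
Proof.
move=> /L2_rectP[mw iw]; have mr := measurable_rect a b c d.
apply: (restrict_integrable (mu \x mu)%E f mr).1.
apply: (square_integrable mr).
- exact: rect_finite.
- by apply/(measurable_restrictT _ _).2.
- by apply: (restrict_integrable _ _ mr).2; rewrite -restrict_sqr.
Qed.

Lemma L2D s t w h : L2 s t w -> L2 s t h -> L2 s t (fun x => w x + h x).
Proof.
move=> Lw Lh; rewrite /L2/=.
rewrite (_ : _ \_ _ = (w \_ `[s, t]) + (h \_ `[s, t])).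
  have p1 : (1 <= 2%:E :> \bar R)%E by rewrite lee_fin ler1n.
  by have [_ ->] := Lfun_addr_closed (@leb1 R) p1.
apply/funext => x; rewrite [RHS]/(_ + _) /patch; case: ifP => // _.
by rewrite [RHS]addr0.
Qed.

Lemma patch_rect a b c d f x y : (f \_ (rect a b c d)) (x, y) =
  ((fun x => ((fun y => f (x, y)) \_ `[c, d]) y) \_ `[a, b]) x.
Proof.
rewrite /patch /rect; case: ifPn.
  by rewrite !inE => -[/= xab ycd]; rewrite !ifT// inE.
rewrite notin_setE/= => H; case: ifPn => //; rewrite inE/= => xab.
case: ifPn => //; rewrite inE/= => ycd; exfalso; exact: H.
Qed.

(** The right-hand side may be infinite. This lets the inequality be applied to every section,
    including those that are not square integrable, and then integrated in the other variable. *)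
Lemma cauchy_schwarz1 c d h : c < d ->
  measurable_fun (`[c, d] : set (measurableTypeR R)) h ->
  (((\int[mu]_(x in `[c, d]) h x) ^+ 2)%:E <=
  (d - c)%:E * \int[mu]_(x in `[c, d]) (h x ^+ 2)%:E)%E.
Proof.
move=> cd mh.
have mucd : mu `[c, d] = (d - c)%:E by rewrite lebesgue_measure_itv/= lte_fin cd EFinD.
have := leey (\int[mu]_(x in `[c, d]) (h x ^+ 2)%:E)%E.
rewrite le_eqVlt => /predU1P[->|qoo]; first by rewrite gt0_muley ?leey// lte_fin subr_gt0.
have ih2 : mu.-integrable `[c, d] (EFin \o (fun x => h x ^+ 2)).
  apply/integrableP; split; first by apply/measurable_EFinP; exact: measurable_funX.
  by under eq_integral do rewrite gee0_abs ?lee_fin ?sqr_ge0//.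
have ih : mu.-integrable `[c, d] (EFin \o h).
  by apply: (square_integrable _ _ mh ih2) => //; rewrite [X in (X < _)%E]mucd ltry.
have -> : (\int[mu]_(x in `[c, d]) (h x ^+ 2)%:E)%E = (\int[mu]_(x in `[c, d]) (h x ^+ 2))%:E.
  by rewrite fineK//; exact: integrable_fin_num ih2.
rewrite -EFinM lee_fin; set I := (X in X ^+ 2 <= _); set Q := (X in _ <= _ * X).
(* The mean of [h]: expanding the integral of (h - k)^2 >= 0 at this value gives the inequality. *)
pose k := I / (d - c).
have dc : 0 < d - c by rewrite subr_gt0.
have : 0 <= \int[mu]_(x in `[c, d]) (h x ^+ 2 + (k ^+ 2 - k *+ 2 * h x)).
  apply: Rintegral_ge0 => x _; rewrite (_ : _ + _ = (h x - k) ^+ 2) ?sqr_ge0//.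
  by rewrite sqrrB; ring.
have ik : mu.-integrable `[c, d] (EFin \o cst (k ^+ 2)).
  by apply: measurable_bounded_integrable => //;
    [rewrite [X in (X < _)%E]mucd ltry|exact: bounded_cst].
have ikh : mu.-integrable `[c, d] (EFin \o (fun x => k *+ 2 * h x)).
  rewrite (_ : _ \o _ = (fun x => (k *+ 2)%:E * (EFin \o h) x)%E)//.
  exact: integrableZl.
rewrite RintegralD//; last first.
  rewrite (_ : _ \o _ = ((EFin \o cst (k ^+ 2)%R) \- (EFin \o (fun x => k *+ 2 * h x)%R))%E)//.
  exact: integrableB.
rewrite RintegralB// Rintegral_cst// [X in fine X]mucd/= RintegralZl// -/I -/Q.
have -> : I = k * (d - c) by rewrite /k mulfVK ?gt_eqF.
nra.
Qed.

End L2_spaces.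

Section sections.
Context {R : realType}.
Local Notation mu := (@lebesgue_measure R).
Implicit Types (a b c d s t x y : R) (w h theta : R -> R) (f g : R * R -> R).

Lemma integral_patch_rect a b c d f x :
  \int[mu]_y (f \_ (rect a b c d)) (x, y) =
  ((fun x => \int[mu]_(y in `[c, d]) f (x, y)) \_ `[a, b]) x.
Proof.
rewrite (@eq_Rintegral _ _ _ mu setT
  (fun y => ((fun x => ((fun y => f (x, y)) \_ `[c, d]) y) \_ `[a, b]) x)).
  rewrite /patch; case: ifPn => xab; first by rewrite [RHS]Rintegral_mkcond.
  by rewrite Rintegral_cst// mul0r.
by move=> y _; rewrite patch_rect.
Qed.

(** Cauchy-Schwarz on each section, then Tonelli for the square. This is what puts traces in L^2. *)
Lemma L2_rect_integral a b c d f : c < d -> L2_rect a b c d f ->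
  L2 a b (fun x => \int[mu]_(y in `[c, d]) f (x, y)).
Proof.
move=> cd /L2_rectP[mF iF2]; set w := (X in L2 _ _ X).
pose F := f \_ (rect a b c d); rewrite -/F in mF iF2.
have wE : w \_ `[a, b] = (fun x => \int[mu]_y F (x, y)).
  by apply/funext => x; rewrite integral_patch_rect.
have mW := measurable_param_integral mu mF; rewrite -wE in mW.
apply: Lfun2P => //.
have mEF2 : measurable_fun setT (EFin \o (fun z => F z ^+ 2)) by exact: (measurable_int _ iF2).
have mT : measurable_fun (setT : set (measurableTypeR R))
    (fun x => \int[mu]_y ((F (x, y)) ^+ 2)%:E)%E.
  apply: (@measurable_fun_fubini_tonelli_F _ _ _ _ R mu (EFin \o (fun z => F z ^+ 2)) mEF2).
  by move=> z; rewrite /= lee_fin sqr_ge0.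
apply: (@le_lt_trans _ _ (\int[mu]_x ((d - c)%:E * \int[mu]_y ((F (x, y)) ^+ 2)%:E))%E).
  apply: ge0_le_integral => //.
  - by move=> x _; rewrite lee_fin sqr_ge0.
  - by apply/measurable_EFinP; exact: measurable_funX.
  - by apply: measurable_funeM.
  move=> x _; rewrite wE.
  have mFx : measurable_fun (setT : set (measurableTypeR R)) (fun y => F (x, y)).
    by apply: (measurableT_comp mF); exact: measurable_pair1.
  have -> : \int[mu]_y F (x, y) = \int[mu]_(y in `[c, d]) F (x, y).
    rewrite [RHS]Rintegral_mkcond; apply: eq_Rintegral => y _.
    rewrite [RHS]/patch; case: ifPn => // ycd; rewrite /F patch_rect /patch.
    by case: ifP => // _; rewrite ifN.
  have mFcd : measurable_fun (`[c, d] : set (measurableTypeR R)) (fun y => F (x, y)).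
    exact: measurable_funTS.
  apply: (le_trans (cauchy_schwarz1 cd mFcd)).
  apply: lee_pmul => //; first by rewrite lee_fin subr_ge0 ltW.
    by apply: integral_ge0 => y _; rewrite lee_fin sqr_ge0.
  apply: ge0_subset_integral => //; first by apply/measurable_EFinP; exact: measurable_funX.
  by move=> y _; rewrite lee_fin sqr_ge0.
rewrite ge0_integralZl//; last 2 first.
  by move=> x _; apply: integral_ge0 => y _; rewrite lee_fin sqr_ge0.
  by rewrite lee_fin subr_ge0 ltW.
rewrite (_ : (\int[mu]_x _)%E = (\int[(mu \x mu)%E]_z (F z ^+ 2)%:E)%E).
  by apply: lte_mul_pinfty => //; [rewrite lee_fin subr_ge0 ltW|exact: integrable_lty iF2].
by rewrite (integral12_prod_meas1 iF2).
Qed.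

Lemma L2_rect_mulr a b c d f theta : {within `[c, d], continuous theta} ->
  measurable_fun setT theta ->
  L2_rect a b c d f -> L2_rect a b c d (fun z => f z * theta z.2).
Proof.
move=> ctheta mtheta /L2_rectP[mF iF2].
have [M [_ HM]] := bounded_within ctheta.
have {}HM y : y \in `[c, d] -> `|theta y| <= `|M| + 1.
  by move=> ycd; apply: HM; rewrite // (le_lt_trans (ler_norm M))// ltrDl.
pose F := f \_ (rect a b c d); rewrite -/F in mF iF2.
have E : (fun z => f z * theta z.2) \_ (rect a b c d) = (fun z => F z * theta z.2).
  by apply/funext => z; rewrite /F /patch; case: ifP; rewrite ?mul0r.
apply/L2_rectP; rewrite E.
have mFt : measurable_fun (setT : set (measurableTypeR R * measurableTypeR R))
    (fun z => F z * theta z.2).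
  by apply: measurable_funM => //; apply: measurableT_comp => //; exact: measurable_snd.
split => //.
have iM : (mu \x mu)%E.-integrable setT (EFin \o (fun z => (`|M| + 1) ^+ 2 * F z ^+ 2)).
  rewrite (_ : _ \o _ = (fun z => ((`|M| + 1) ^+ 2)%:E * (EFin \o (fun z => (F z ^+ 2)%R)) z)%E)//.
  exact: integrableZl.
apply: (le_integrable _ _ _ iM) => //.
  by apply/measurable_EFinP; exact: measurable_funX.
move=> z _; rewrite /= lee_fin [leLHS]ger0_norm ?sqr_ge0// [leRHS]ger0_norm; last first.
  by rewrite mulr_ge0 ?sqr_ge0.
rewrite exprMn mulrC.
have [zr|zr] := boolP (z \in rect a b c d); last first.
  by rewrite /F /patch ifN// expr0n !mulr0.
rewrite ler_wpM2r ?sqr_ge0// -[leLHS]real_normK ?num_real//.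
rewrite lerXn2r ?nnegrE ?addr_ge0//; apply: HM.
by move: zr; rewrite inE /rect/= => -[_].
Qed.

Lemma patch_swap a b c d f :
  (f \o swap) \_ (rect a b c d) = (f \_ (rect c d a b)) \o swap.
Proof.
apply/funext => z; rewrite /= /patch.
have -> // : (z \in rect a b c d) = (swap z \in rect c d a b).
by apply/idP/idP; rewrite !inE => -[].
Qed.

Lemma L2_rect_swap a b c d f : L2_rect a b c d f -> L2_rect c d a b (f \o swap).
Proof.
move=> /L2_rectP[mF iF2]; apply/L2_rectP; rewrite patch_swap; split.
  by apply: measurableT_comp => //; exact: measurable_swap.
exact: (integrable_swap iF2).
Qed.

Lemma ae_integrable_section a b c d f : L2_rect a b c d f ->
  {ae mu, forall x, x \in `[a, b] -> mu.-integrable `[c, d] (EFin \o (fun y => f (x, y)))}.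
Proof.
move=> /L2_rect_integrable /ae_integrable1; apply: filterS => x ix xab.
apply: (restrict_integrable mu _ _).2 => //.
apply: eq_integrable ix => // y _ /=; rewrite patch_rect /patch ifT// inE.
by [].
Qed.

Lemma ae_rect_sections a b c d f g : ae_eq leb2 (rect a b c d) f g ->
  {ae mu, forall x, x \in `[a, b] -> {ae mu, forall y, y \in `[c, d] -> f (x, y) = g (x, y)}}.
Proof.
move=> /ae_sections; apply: filterS => x H xab; apply: filterS H => y H ycd.
by apply: H; split.
Qed.

End sections.

(** * Traces *)

Section repr.
Context {R : realType}.
Local Notation mu := (@lebesgue_measure R).
Implicit Types (a b c d s t x y : R) (w h theta phi : R -> R) (f g p D : R * R -> R).

#[global] Instance ae_leb2_filter : Filter (nbhs (almost_everywhere (@leb2 R))).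
Proof. exact: (ae_filter_ringOfSetsType (mu \x mu)%E). Qed.

(** A point of disagreement would spread to a relative neighbourhood, which has positive measure
    because the interval is nondegenerate. *)
Lemma within_ae_eq c d h w : c < d -> {within `[c, d], continuous h} ->
  {within `[c, d], continuous w} ->
  {ae mu, forall y, y \in `[c, d] -> h y = w y} ->
  forall y, y \in `[c, d] -> h y = w y.
Proof.
move=> cd ch cw hw y ycd; apply/eqP/negPn/negP => hwy.
have e0 : 0 < `|h y - w y| by rewrite normr_gt0 subr_eq0.
have /subspace_continuousP cwi : {within `[c, d], continuous (h - w)}.
  by move=> z; apply: cvgB; [exact: ch|exact: cw].
have /cvgrPdist_lt/(_ _ e0) := cwi y ycd.
rewrite /within/= -nbhs_ballE => -[r /= r0 Hr].
(* The ball cut by [[c, d]] keeps positive length even when [y] is an end point. *)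
have lt1 : Num.max c (y - r) < Num.min d (y + r).
  move: ycd; rewrite in_itv/= gt_max !lt_min => /andP[cy yd].
  by rewrite cd/=; lra.
have [z zin Hz] := not_ae_false lt1 hw.
move: zin; rewrite in_itv/= gt_max lt_min => /andP[/andP[cz yz] /andP[zd zy]].
have zcd : z \in `[c, d] by rewrite in_itv/= !ltW.
have zb : ball y r z.
  by rewrite /ball/= ltr_distl; apply/andP; split; lra.
have : `|(h y - w y) - (h z - w z)| < `|h y - w y| := Hr z zb zcd.
by rewrite Hz// subrr subr0 ltxx.
Qed.

Lemma L2_rect_mull a b c d f phi : continuous phi ->
  L2_rect a b c d f -> L2_rect a b c d (fun z => f z * phi z.1).
Proof.
move=> cphi /L2_rect_swap/(L2_rect_mulr (continuous_subspaceT cphi)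
  (continuous_measurable_fun cphi))/L2_rect_swap.
by congr (L2_rect _ _ _ _ _); apply/funext => -[].
Qed.

Lemma L2_rect_mulrc a b c d f phi : continuous phi ->
  L2_rect a b c d f -> L2_rect a b c d (fun z => f z * phi z.2).
Proof.
move=> cphi; apply: L2_rect_mulr; first exact: continuous_subspaceT.
exact: continuous_measurable_fun.
Qed.

Lemma L2_measurable s t w : L2 s t w ->
  measurable_fun (`[s, t] : set (measurableTypeR R)) w.
Proof. by move=> /L2P[mw _]; apply/(measurable_restrictT _ _).2. Qed.

Lemma Rintegral_rect a b c d f : L2_rect a b c d f ->
  \int[leb2]_(z in rect a b c d) f z =
  \int[mu]_(x in `[a, b]) \int[mu]_(y in `[c, d]) f (x, y).
Proof.
move=> /L2_rect_integrable iF.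
rewrite Rintegral_mkcond -(RFubini1 iF) [RHS]Rintegral_mkcond.
by apply: eq_Rintegral => x _; rewrite integral_patch_rect.
Qed.

Lemma Rintegral_rect_tensor a b c d f phi theta : c < d ->
  continuous phi -> continuous theta -> L2_rect a b c d f ->
  \int[leb2]_(z in rect a b c d) (f z * tensor phi theta z) =
  \int[mu]_(x in `[a, b]) ((\int[mu]_(y in `[c, d]) (f (x, y) * theta y)) * phi x).
Proof.
move=> cd cphi ctheta Lf.
have L1 := L2_rect_mulrc ctheta Lf; have L2' := L2_rect_mull cphi L1.
transitivity (\int[leb2]_(z in rect a b c d) (f z * theta z.2 * phi z.1)).
  by apply: eq_Rintegral => z _; rewrite /tensor -mulrA [phi _ * _]mulrC.
have m1 := L2_measurable (L2_rect_integral cd L1).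
have m2 := L2_measurable (L2_rect_integral cd L2').
have m3 : measurable_fun (`[a, b] : set (measurableTypeR R)) phi.
  by apply: measurable_funTS; exact: continuous_measurable_fun cphi.
rewrite Rintegral_rect//; apply: (ae_eq_Rintegral _ m2 (measurable_funM m1 m3)) => //.
apply: filterS (ae_integrable_section L1) => x ix xab.
by rewrite /= RintegralZr//; exact: ix.
Qed.

Definition prim_y c D (z : R * R) : R := \int[mu]_(y in `[c, z.2]) D (z.1, y).

(** The variable upper limit becomes an indicator, and the primitive is the integral in t of a
    measurable function of ((x, y), t). *)
Lemma measurable_prim_y a b c d D : L2_rect a b c d D ->
  measurable_fun (setT : set (measurableTypeR R * measurableTypeR R))
    ((prim_y c D) \_ (rect a b c d)).
Proof.
move=> /L2_rectP[mF _]; pose F := D \_ (rect a b c d).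
pose G (w : (measurableTypeR R * measurableTypeR R) * measurableTypeR R) : R :=
  F (w.1.1, w.2) * \1_[set z : R * R | z.1 <= z.2] (w.2, w.1.2).
have mG : measurable_fun setT G.
  apply: measurable_funM.
    apply: (measurableT_comp mF); apply/measurable_fun_pairP; split => /=.
      by apply: (@measurableT_comp _ _ _ _ _ _ fst _ fst) => /=; exact: measurable_fst.
    exact: measurable_snd.
  apply: (measurableT_comp (measurable_indic measurable_le_set)).
  apply/measurable_fun_pairP; split => /=; first exact: measurable_snd.
  by apply: (@measurableT_comp _ _ _ _ _ _ snd _ fst) => /=;
    [exact: measurable_snd|exact: measurable_fst].
have mP := measurable_param_integral mu mG.
have -> : (prim_y c D) \_ (rect a b c d) =
    (fun z => \int[mu]_y G (z, y)) \_ (rect a b c d).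
  apply/funext => -[x y]; rewrite /patch; case: ifPn => //.
  rewrite inE /rect/= => -[xab ycd].
  rewrite /prim_y /= -(integral_le_indic_l _ ycd); apply: eq_Rintegral => t _.
  rewrite /G/= /F patch_rect; congr (_ * _).
  by rewrite [in RHS]/patch ifT// inE.
apply/(measurable_restrictT _ _).1; first exact: measurable_rect.
exact: measurable_funTS.
Qed.

Lemma weak_dy_repr a b c d p D : a < b -> c < d ->
  L2_rect a b c d p -> L2_rect a b c d D -> weak_pair a b c d 0 1 p D ->
  exists2 B, L2 a b B & ae_eq leb2 (rect a b c d) p (fun z => B z.1 + prim_y c D z).
Proof.
move=> ab cd Lp LD pD.
have [h [th hsep]] := test1_separating ab.
have [T [psi0 [theta [tT tpsi0 ctheta T1d]]]] := weak_derivative_1d cd.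
have cpsi0 := test1_continuous tpsi0.
have cT n := test1_continuous (tT n).
have cdT n := test1_continuous (test1_derive1 (tT n)).
pose q n x := \int[mu]_(y in `[c, d]) (p (x, y) * derive1 (T n) y) +
              \int[mu]_(y in `[c, d]) (D (x, y) * T n y).
have LpT n := L2_rect_integral cd (L2_rect_mulrc (cdT n) Lp).
have LDT n := L2_rect_integral cd (L2_rect_mulrc (cT n) LD).
(* The defect of the one-dimensional weak identity for [T n] on the section at [x] is orthogonal in
   [x] to all [h m]. *)
have q0 n : {ae mu, forall x, x \in `[a, b] -> q n x = 0}.
  apply: hsep; first exact: (L2_integrable (L2D (LpT n) (LDT n))).
  move=> m; have := pD _ _ (th m) (tT n).
  have chm := test1_continuous (th m).
  rewrite /= Rintegral_rect_tensor// Rintegral_rect_tensor// expr1 mulN1r => E.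
  under eq_Rintegral do rewrite mulrDl.
  rewrite RintegralD//; [|apply: integrableMc|apply: integrableMc]; last 4 first.
  - exact: L2_integrable (LpT n).
  - exact: continuous_subspaceT.
  - exact: L2_integrable (LDT n).
  - exact: continuous_subspaceT.
  by rewrite [X in X + _]E addNr.
pose B x := \int[mu]_(y in `[c, d]) (p (x, y) * psi0 y) +
            \int[mu]_(y in `[c, d]) (D (x, y) * theta y).
have LB : L2 a b B.
  apply: L2D; first exact: (L2_rect_integral cd (L2_rect_mulrc cpsi0 Lp)).
  exact: (L2_rect_integral cd (L2_rect_mulrc ctheta LD)).
exists B => //.
have /L2_rectP[mp _] := Lp; have /L2P[mB _] := LB.
have mV := measurable_prim_y LD.
pose g z := (p \_ (rect a b c d)) z.
pose g' := (fun z => (B \_ `[a, b]) z.1 + ((prim_y c D) \_ (rect a b c d)) z) \_ (rect a b c d).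
have mg' : measurable_fun (setT : set (measurableTypeR R * measurableTypeR R)) g'.
  apply/(measurable_restrictT _ _).1; first exact: measurable_rect.
  have mB1 : measurable_fun (setT : set (measurableTypeR R * measurableTypeR R))
      (fun z => (B \_ `[a, b]) z.1).
    by apply: (@measurableT_comp _ _ _ _ _ _ (B \_ `[a, b]) _ fst) => //; exact: measurable_fst.
  exact: (measurable_funTS (measurable_funD mB1 mV)).
(* The identity is known section by section only; extending both sides by zero makes them measurable
   on the plane, as [ae_of_sections] needs. The null sets of all the [q n] are merged by
   [ae_foralln]. *)
have : {ae leb2, forall z, g z = g' z}.
  apply: (ae_of_sections (m1 := mu) (m2 := mu) mp mg').
  have := ae_foralln q0.
  apply: filterS3 (ae_integrable_section Lp) (ae_integrable_section LD) => x ip iD qx.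
  have [xab|xab] := boolP (x \in `[a, b]); last first.
    apply: aeW => y; rewrite /g /g' /patch; case: ifP => //.
    by rewrite inE => -[]/= xab'; rewrite xab' in xab.
  have := T1d _ _ (ip xab) (iD xab) _.
  have Hn n : \int[mu]_(y in `[c, d]) (p (x, y) * derive1 (T n) y) =
     - \int[mu]_(y in `[c, d]) (D (x, y) * T n y).
    by apply/eqP; rewrite -addr_eq0; apply/eqP; exact: qx.
  move=> /(_ Hn); apply: filterS => y Hy.
  rewrite /g /g' /patch; case: ifPn => // xy.
  rewrite ifT ?inE//=; move: xy; rewrite inE => -[/= _ /Hy ->] //.
apply: filterS => -[x y] + xy; rewrite /g /g' /patch /=.
have -> : ((x, y) \in rect a b c d) = true by exact: mem_set.
have -> // : (x \in `[a, b]%classic) = true by apply: mem_set; case: xy.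
Qed.

End repr.

Section traces.
Context {R : realType}.
Local Notation mu := (@lebesgue_measure R).
Implicit Types (a b c d s t x y : R) (w h theta phi : R -> R) (f g u p D : R * R -> R).

(** Two representatives agree almost everywhere on almost every line; there both are continuous in
    [y], so they agree at [y0] as well. *)
Lemma is_xtrace_unique a b c d u y0 w w' : c < d -> y0 \in `[c, d] ->
  is_xtrace a b c d u y0 w -> is_xtrace a b c d u y0 w' ->
  {ae mu, forall x, x \in `[a, b] -> w x = w' x}.
Proof.
move=> cd ycd [_ [g gu gw]] [_ [g' gu' gw']].
have gg' : ae_eq leb2 (rect a b c d) g g'.
  by apply: filterS2 gu gu' => z H H' zr; rewrite H// H'.
apply: filterS3 (ae_rect_sections gg') gw gw' => x + + + xab.
move=> /(_ xab) E /(_ xab)[cg <-] /(_ xab)[cg' <-].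
exact: (within_ae_eq cd cg cg' E).
Qed.

Lemma xtraceP a b c d u y0 w : is_xtrace a b c d u y0 w ->
  is_xtrace a b c d u y0 (xtrace a b c d u y0).
Proof. by move=> H; apply: (@xgetPex _ _ [set w | is_xtrace a b c d u y0 w]); exists w. Qed.

(** B(x) plus the primitive of [D] is a representative continuous in [y] on almost every line. Its
    values at [c] and [d] are traces, and uniqueness transfers them to the chosen ones. *)
Lemma xtrace_repr a b c d p D : a < b -> c < d ->
  L2_rect a b c d p -> L2_rect a b c d D -> weak_pair a b c d 0 1 p D ->
  [/\ L2 a b (xtrace a b c d p c),
      ae_eq leb2 (rect a b c d) p (fun z => xtrace a b c d p c z.1 + prim_y c D z) &
      {ae mu, forall x, x \in `[a, b] -> xtrace a b c d p d x =
        xtrace a b c d p c x + \int[mu]_(y in `[c, d]) D (x, y)}].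
Proof.
move=> ab cd Lp LD pD; have [B LB pB] := weak_dy_repr ab cd Lp LD pD.
have trB (y0 : R) w : L2 a b w ->
    (forall x, B x + prim_y c D (x, y0) = w x) -> is_xtrace a b c d p y0 w.
  move=> Lw Bw; split => //; exists (fun z => B z.1 + prim_y c D z).
    by apply: filterS pB => z H zr; rewrite H.
  apply: filterS (ae_integrable_section LD) => x iD xab; split; last exact: Bw.
  have cp := prim_continuous (ltW cd) (iD xab).
  by move=> y; apply: cvgD; [exact: cvg_cst|exact: cp].
have trc : is_xtrace a b c d p c B.
  by apply: trB => // x; rewrite /prim_y/= set_itv1 Rintegral_set1 addr0.
have trd : is_xtrace a b c d p d (fun x => B x + \int[mu]_(y in `[c, d]) D (x, y)).
  by apply: trB => //; apply: L2D => //; exact: L2_rect_integral.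
have ccd : c \in `[c, d] by rewrite in_itv/= lexx ltW.
have dcd : d \in `[c, d] by rewrite in_itv/= lexx ltW.
have xc := is_xtrace_unique cd ccd trc (xtraceP trc).
have xd := is_xtrace_unique cd dcd trd (xtraceP trd).
split.
- by have [] := xtraceP trc.
- have := ae_fst mu xc.
  by apply: filterS2 pB => z H1 H2 zr; rewrite H1// H2//; case: zr.
- by apply: filterS2 xc xd => x H1 H2 xab; rewrite -H1// -H2.
Qed.

Lemma ae_eq_rect_swap a b c d f g : ae_eq leb2 (rect a b c d) f g ->
  ae_eq leb2 (rect c d a b) (f \o swap) (g \o swap).
Proof. by move=> /ae_swap; apply: filterS => z H [? ?]; apply: H. Qed.

Lemma is_ytrace_swap a b c d u x0 w :
  is_ytrace a b c d u x0 w <-> is_xtrace c d a b (u \o swap) x0 w.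
Proof.
split=> -[Lw [g gu gw]]; split => //; exists (g \o swap).
- exact: ae_eq_rect_swap.
- exact: gw.
- by have := ae_eq_rect_swap gu; congr (ae_eq _ _ _ _); apply/funext => -[].
- exact: gw.
Qed.

(** An equality of functions, not only almost everywhere: both choices are made from the same
    set. *)
Lemma ytrace_swap a b c d u x0 :
  ytrace a b c d u x0 = xtrace c d a b (u \o swap) x0.
Proof.
rewrite /ytrace /xtrace; congr (xget _ _); apply/seteqP.
by split=> w /is_ytrace_swap.
Qed.

Lemma Rintegral_rect_swap a b c d f : L2_rect a b c d f ->
  \int[leb2]_(z in rect c d a b) (f \o swap) z = \int[leb2]_(z in rect a b c d) f z.
Proof.
move=> /L2_rect_integrable iF; rewrite Rintegral_mkcond patch_swap.
rewrite [RHS]Rintegral_mkcond; exact: (Rintegral_swap iF).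
Qed.

Lemma weak_pair_swap a b c d i j f g : c < d -> a < b ->
  L2_rect a b c d f -> L2_rect a b c d g ->
  weak_pair a b c d i j f g -> weak_pair c d a b j i (f \o swap) (g \o swap).
Proof.
move=> cd ab Lf Lg fg phi psi tphi tpsi.
have tL k (m n : nat) : L2_rect a b c d k ->
    L2_rect a b c d (fun z => k z * tensor (derive1n m psi) (derive1n n phi) z).
  move=> Lk.
  have := L2_rect_mull (test1_continuous (test1_derive1n m tpsi))
    (L2_rect_mulrc (test1_continuous (test1_derive1n n tphi)) Lk).
  congr (L2_rect _ _ _ _ _); apply/funext => z.
  by rewrite /tensor -mulrA [derive1n m psi _ * _]mulrC.
have := fg _ _ tpsi tphi.
rewrite -Rintegral_rect_swap; last exact: tL.
rewrite -[in RHS]Rintegral_rect_swap; last exact: (tL g 0%N 0%N).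
rewrite addnC; congr (_ = _ * _); apply: eq_Rintegral => z _ /=;
  by rewrite /tensor/= [in RHS]mulrC mulrC; congr (_ * _); rewrite mulrC.
Qed.

Lemma sub_rect a b c d a' b' c' d' : a <= a' -> b' <= b -> c <= c' -> d' <= d ->
  rect a' b' c' d' `<=` rect a b c d.
Proof.
move=> aa bb cc dd [x y] []; rewrite /= !in_itv/= => /andP[? ?] /andP[? ?].
by split; rewrite /= in_itv/=; lra.
Qed.

Lemma L2_rect_sub a b c d a' b' c' d' f : a <= a' -> b' <= b -> c <= c' -> d' <= d ->
  L2_rect a b c d f -> L2_rect a' b' c' d' f.
Proof.
move=> aa bb cc dd /L2_rectP[mF iF].
have sub := sub_rect aa bb cc dd.
have E : f \_ (rect a' b' c' d') = (f \_ (rect a b c d)) \_ (rect a' b' c' d').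
  apply/funext => z; rewrite /patch; case: ifPn => //.
  by rewrite inE => /sub H; rewrite mem_set.
have mF' : measurable_fun (setT : set (measurableTypeR R * measurableTypeR R))
    (f \_ (rect a' b' c' d')).
  rewrite E; apply/(measurable_restrictT _ _).1; first exact: measurable_rect.
  exact: measurable_funTS.
apply/L2_rectP; split => //.
apply: (le_integrable _ _ _ iF) => //.
  by apply/measurable_EFinP; exact: measurable_funX.
move=> z _; rewrite /= lee_fin !ger0_norm ?sqr_ge0// E [_ \_ (rect a' _ _ _)]/patch.
by case: ifP => // _; rewrite expr0n sqr_ge0.
Qed.

Lemma L2_rect_norm a b c d f : L2_rect a b c d f -> L2_rect a b c d (fun z => `|f z|).
Proof.
move=> /L2_rectP[mF iF].
have E : (fun z => `|f z|) \_ (rect a b c d) = (fun z => `|(f \_ (rect a b c d)) z|).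
  by apply/funext => z; rewrite /patch; case: ifP => // _; rewrite normr0.
apply/L2_rectP; rewrite E; split; first exact: measurableT_comp.
have -> // : (fun z => `|(f \_ (rect a b c d)) z| ^+ 2) = (fun z => (f \_ (rect a b c d)) z ^+ 2).
by apply/funext => z; rewrite real_normK// num_real.
Qed.

End traces.

(** * The continuous representative *)

Section rect_integral.
Context {R : realType}.
Local Notation mu := (@lebesgue_measure R).
Implicit Types (a b c d s t x y : R) (f g u p D : R * R -> R).

(** The indicator of []-oo, x]]. It writes integrals over subrectangles as weighted integrals over
    one fixed rectangle. *)
Definition below (x t : R) : R := (nat_of_bool (t <= x)%R)%:R.

Lemma measurable_below x : measurable_fun (setT : set (measurableTypeR R)) (below x).
Proof.
have -> : below x = \1_(`]-oo, x]).
  apply/funext => t; rewrite /below indicE.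
  by congr (nat_of_bool _)%:R; apply/idP/idP; rewrite inE/= in_itv/=.
exact: measurable_indic.
Qed.

Lemma below_ge0 x t : 0 <= below x t. Proof. exact: ler0n. Qed.
Lemma below_le1 x t : below x t <= 1.
Proof. by rewrite /below; case: (leP t x) => _; [exact: lexx|exact: ler01]. Qed.

Lemma L2_rect_bounded_integrable a b c d f (k : R * R -> R) : L2_rect a b c d f ->
  measurable_fun (setT : set (measurableTypeR R * measurableTypeR R)) k ->
  (forall z, `|k z| <= 1) ->
  (mu \x mu)%E.-integrable (rect a b c d) (EFin \o (fun z => f z * k z)).
Proof.
move=> /L2_rect_integrable iF mk k1; have mr := measurable_rect a b c d.
have ir := (restrict_integrable _ _ mr).2 iF.
apply: (le_integrable _ _ _ ir) => //.
  apply/measurable_EFinP; apply: measurable_funM; last exact: measurable_funTS.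
  by apply/measurable_EFinP; exact: measurable_int ir.
by move=> z _; rewrite /= lee_fin normrM ler_piMr.
Qed.

Lemma measurable_below1 x :
  measurable_fun (setT : set (measurableTypeR R * measurableTypeR R)) (fun z => below x z.1).
Proof.
by apply: (@measurableT_comp _ _ _ _ _ _ (below x) _ fst);
  [exact: measurable_below|exact: measurable_fst].
Qed.

Lemma measurable_below2 y :
  measurable_fun (setT : set (measurableTypeR R * measurableTypeR R)) (fun z => below y z.2).
Proof.
by apply: (@measurableT_comp _ _ _ _ _ _ (below y) _ snd);
  [exact: measurable_below|exact: measurable_snd].
Qed.

Lemma Rintegral_subrect a b c d f x y : x <= b -> y <= d ->
  \int[leb2]_(z in rect a x c y) f z =
  \int[leb2]_(z in rect a b c d) (f z * (below x z.1 * below y z.2)).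
Proof.
move=> xb yd; rewrite Rintegral_mkcond [RHS]Rintegral_mkcond.
apply: eq_Rintegral => -[s t] _; rewrite /patch /below /=.
have [zr|zr] := boolP ((s, t) \in rect a x c y).
  move: (zr); rewrite inE /rect/= !in_itv/= => -[/andP[s1 s2] /andP[t1 t2]].
  rewrite s2 t2 !mulr1 ifT//; apply/mem_set; split; rewrite /= in_itv/=.
    by rewrite s1 (le_trans s2).
  by rewrite t1 (le_trans t2).
case: ifPn => // zr'.
have [sx|_] := boolP (s <= x); last by rewrite mul0r mulr0.
have [ty|_] := boolP (t <= y); last by rewrite !mulr0.
exfalso; move/negP: zr; apply; move: zr'; rewrite !inE /rect/= !in_itv/= sx ty !andbT.
by move=> [/andP[-> _] /andP[-> _]].
Qed.

Lemma below_homo x x' t : x <= x' -> below x t <= below x' t.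
Proof.
rewrite /below => xx'; case: (leP t x) => [tx|_]; last exact: ler0n.
by rewrite (le_trans tx).
Qed.

(** Two rectangles with common corner (a, c) differ only inside a vertical strip between [x] and
    [x'] and a horizontal one between [y] and [y']. The integral of |f| over each strip depends on
    one coordinate alone. *)
Lemma prim_rect_dist a b c d f x x' y y' : L2_rect a b c d f ->
  x <= b -> x' <= b -> y <= d -> y' <= d ->
  `|\int[leb2]_(z in rect a x c y) f z - \int[leb2]_(z in rect a x' c y') f z| <=
  `|\int[leb2]_(z in rect a x c d) `|f z| - \int[leb2]_(z in rect a x' c d) `|f z| | +
  `|\int[leb2]_(z in rect a b c y) `|f z| - \int[leb2]_(z in rect a b c y') `|f z| |.
Proof.
move=> Lf xb xb' yd yd'; have Ln := L2_rect_norm Lf; have mr := measurable_rect a b c d.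
pose ch x y (z : R * R) := below x z.1 * below y z.2.
have ch0 s t z : 0 <= ch s t z by rewrite mulr_ge0 ?below_ge0.
have mch s t : measurable_fun (setT : set (measurableTypeR R * measurableTypeR R)) (ch s t).
  exact: measurable_funM (measurable_below1 s) (measurable_below2 t).
have ch1 s t z : `|ch s t z| <= 1.
  by rewrite ger0_norm// mulr_ile1 ?below_ge0 ?below_le1.
have ich s t : (mu \x mu)%E.-integrable (rect a b c d) (EFin \o (fun z => f z * ch s t z)).
  exact: L2_rect_bounded_integrable.
have inch s t : (mu \x mu)%E.-integrable (rect a b c d) (EFin \o (fun z => `|f z| * ch s t z)).
  exact: L2_rect_bounded_integrable.
have ichd s t s' t' : (mu \x mu)%E.-integrable (rect a b c d)
    (EFin \o (fun z => `|f z| * `|ch s t z - ch s' t' z|)).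
  apply: L2_rect_bounded_integrable => //.
    by apply: measurableT_comp => //; exact: measurable_funB.
  move=> z; rewrite normr_id ler_norml; have := ch1 s t z; have := ch1 s' t' z.
  rewrite !ger0_norm//; have := ch0 s t z; have := ch0 s' t' z; lra.
(* For nested rectangles the difference of indicators has constant sign, so the absolute value comes
   out of the integral. *)
have dist0 s s' t t' : s <= s' -> t <= t' -> s' <= b -> t' <= d ->
    \int[leb2]_(z in rect a b c d) (`|f z| * `|ch s t z - ch s' t' z|) <=
    `|\int[leb2]_(z in rect a s c t) `|f z| - \int[leb2]_(z in rect a s' c t') `|f z| |.
  move=> ss tt sb td.
  have chle z : ch s t z <= ch s' t' z by rewrite ler_pM ?below_ge0 ?below_homo.
  have sr := @Rintegral_subrect a b c d (fun z => `|f z|).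
  rewrite (sr s t) ?(le_trans ss)// ?(le_trans tt)// (sr s' t')//.
  rewrite distrC; apply: le_trans (ler_norm _).
  rewrite le_eqVlt; apply/orP; left; apply/eqP.
  rewrite -RintegralB//; last 2 first.
    exact: inch.
    exact: inch.
  apply: eq_Rintegral => z _; rewrite -mulrBr; congr (_ * _).
  by rewrite distrC ger0_norm// subr_ge0.
have dist s s' t t' : s <= s' /\ t <= t' \/ s' <= s /\ t' <= t ->
    s <= b -> s' <= b -> t <= d -> t' <= d ->
    \int[leb2]_(z in rect a b c d) (`|f z| * `|ch s t z - ch s' t' z|) <=
    `|\int[leb2]_(z in rect a s c t) `|f z| - \int[leb2]_(z in rect a s' c t') `|f z| |.
  move=> [[? ?]|[? ?]] ? ? ? ?; first exact: dist0.
  rewrite distrC.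
  have -> : (fun z => `|f z| * `|ch s t z - ch s' t' z|) =
      (fun z => `|f z| * `|ch s' t' z - ch s t z|).
    by apply/funext => z; rewrite [X in _ * X]distrC.
  exact: dist0.
rewrite (@Rintegral_subrect a b c d f x y)// (@Rintegral_subrect a b c d f x' y')//.
rewrite -RintegralB//; last 2 first.
  exact: ich.
  exact: ich.
have idf : (mu \x mu)%E.-integrable (rect a b c d)
    (EFin \o (fun z => f z * ch x y z - f z * ch x' y' z)).
  rewrite (_ : _ \o _ = ((EFin \o (fun z => (f z * ch x y z)%R)) \-
    (EFin \o (fun z => (f z * ch x' y' z)%R)))%E)//.
  exact: integrableB.
apply: (le_trans (le_normr_Rintegral mr idf)).
apply: (@le_trans _ _ (\int[leb2]_(z in rect a b c d)
   (`|f z| * `|ch x d z - ch x' d z| + `|f z| * `|ch b y z - ch b y' z|))); last first.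
  rewrite (RintegralD mr (ichd _ _ _ _) (ichd _ _ _ _)).
  apply: lerD; apply: dist => //.
    by have [xx|/ltW xx] := leP x x'; [left|right].
  by have [yy|/ltW yy] := leP y y'; [left|right].
apply: le_Rintegral => //.
- exact: integrable_norm idf.
- rewrite (_ : _ \o _ = ((EFin \o (fun z => (`|f z| * `|ch x d z - ch x' d z|)%R)) \+
    (EFin \o (fun z => (`|f z| * `|ch b y z - ch b y' z|)%R)))%E)//.
  apply: integrableD => //; exact: ichd.
move=> [s t] [/=]; rewrite !in_itv/= => /andP[_ sb] /andP[_ td].
rewrite -mulrBr normrM -mulrDr ler_wpM2l//.
have e1 : below d t = 1 by rewrite /below td.
have e2 : below b s = 1 by rewrite /below sb.
rewrite /ch/= e1 e2 !mulr1 !mul1r.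
set k := below x s; set k' := below x' s; set l := below y t; set l' := below y' t.
have -> : k * l - k' * l' = (k - k') * l + k' * (l - l') by ring.
rewrite (le_trans (ler_normD _ _))// !normrM lerD//.
  by rewrite ler_piMr// ger0_norm ?below_ge0// below_le1.
by rewrite ler_piMl// ger0_norm ?below_ge0// below_le1.
Qed.

Lemma Rintegral_rect_sub a b c d f x y : a <= x -> x <= b -> c <= y -> y <= d ->
  L2_rect a b c d f ->
  \int[leb2]_(z in rect a x c y) f z =
  \int[mu]_(s in `[a, x]) \int[mu]_(t in `[c, y]) f (s, t).
Proof.
move=> ax xb cy yd Lf; apply: Rintegral_rect.
by apply: L2_rect_sub Lf.
Qed.

(** By [prim_rect_dist] it suffices that the two strip functions [N] and [M] are continuous, and
    these are primitives of integrable functions of one variable. *)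
Lemma continuous_rect_integral a b c d f : a < b -> c < d -> L2_rect a b c d f ->
  {within rect a b c d, continuous (fun z => \int[leb2]_(w in rect a z.1 c z.2) f w)}.
Proof.
move=> ab cd Lf; have Ln := L2_rect_norm Lf.
pose N x := \int[leb2]_(w in rect a x c d) `|f w|.
pose M y := \int[leb2]_(w in rect a b c y) `|f w|.
have cN : {within `[a, b], continuous N}.
  apply: (@subspace_eq_continuous _ _ _
    (fun x => \int[mu]_(s in `[a, x]) \int[mu]_(t in `[c, d]) `|f (s, t)|)).
    move=> x; rewrite inE/= in_itv/= => /andP[ax xb].
    by apply/esym; exact: (Rintegral_rect_sub ax xb (ltW cd) (lexx d) Ln).
  apply: prim_continuous; first exact: ltW.
  exact: L2_integrable (L2_rect_integral cd Ln).
have cM : {within `[c, d], continuous M}.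
  apply: (@subspace_eq_continuous _ _ _
    (fun y => \int[mu]_(t in `[c, y]) \int[mu]_(s in `[a, b]) `|f (s, t)|)).
    move=> y; rewrite inE/= in_itv/= => /andP[cy yd].
    have Ly : L2_rect a b c y (fun z => `|f z|) by exact: L2_rect_sub Ln.
    apply: etrans (Rintegral_rect_swap Ly); apply/esym.
    exact: (Rintegral_rect (L2_rect_swap Ly)).
  apply: prim_continuous; first exact: ltW.
  exact: L2_integrable (L2_rect_integral ab (L2_rect_swap Ln)).
apply/subspace_continuousP => -[x y] [/= xab ycd].
apply/cvgrPdist_lt => e e0.
have e20 : 0 < e / 2 by rewrite divr_gt0.
have /subspace_continuousP/(_ x xab)/cvgrPdist_lt/(_ _ e20) := cN.
rewrite /within/= -nbhs_ballE => -[r /= r0 Hr].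
have /subspace_continuousP/(_ y ycd)/cvgrPdist_lt/(_ _ e20) := cM.
rewrite /within/= -nbhs_ballE => -[r' /= r'0 Hr'].
rewrite /within/= -nbhs_ballE; exists (Num.min r r'); first by rewrite /= lt_min r0.
move=> [s t] [/= Hs Ht] [/= sab tcd].
have sr : ball x r s by apply: le_ball Hs; rewrite ge_min lexx.
have tr : ball y r' t by apply: le_ball Ht; rewrite ge_min lexx orbT.
have := Hr s sr sab; have := Hr' t tr tcd.
move: xab ycd sab tcd; rewrite !in_itv/=.
move=> /andP[? xb] /andP[? yd] /andP[? sb] /andP[? td] HM HN.
apply: le_lt_trans (prim_rect_dist Lf xb sb yd td) _.
by rewrite [e]splitr ltrD.
Qed.

End rect_integral.

(** * The representation formula for a function with a mixed derivative *)

Section mixed.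
Context {R : realType}.
Local Notation mu := (@lebesgue_measure R).
Implicit Types (a b c d s t x y : R) (k l : R -> R) (f g u p q D : R * R -> R).

Lemma section_continuous1 a b c d g x : {within rect a b c d, continuous g} ->
  x \in `[a, b] -> {within `[c, d], continuous (fun y => g (x, y))}.
Proof.
move=> /subspace_continuousP cg xab; apply/subspace_continuousP => y ycd.
apply/cvgrPdist_lt => e e0.
have /cvgrPdist_lt/(_ _ e0) := cg (x, y) (conj xab ycd).
rewrite /within/= -nbhs_ballE => -[r /= r0 Hr].
rewrite -nbhs_ballE; exists r => //= t yt tcd.
by apply: (Hr (x, t)) => //; split => //=; exact: ballxx.
Qed.

Lemma section_continuous2 a b c d g y : {within rect a b c d, continuous g} ->
  y \in `[c, d] -> {within `[a, b], continuous (fun x => g (x, y))}.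
Proof.
move=> /subspace_continuousP cg ycd; apply/subspace_continuousP => x xab.
apply/cvgrPdist_lt => e e0.
have /cvgrPdist_lt/(_ _ e0) := cg (x, y) (conj xab ycd).
rewrite /within/= -nbhs_ballE => -[r /= r0 Hr].
rewrite -nbhs_ballE; exists r => //= t xt tab.
by apply: (Hr (t, y)) => //; split => //=; exact: ballxx.
Qed.

Lemma continuous_within_fst a b c d k : {within `[a, b], continuous k} ->
  {within rect a b c d, continuous (fun z => k z.1)}.
Proof.
move=> /subspace_continuousP ck; apply/subspace_continuousP => -[x y] [/= xab ycd].
apply/cvgrPdist_lt => e e0; have /cvgrPdist_lt/(_ _ e0) := ck x xab.
rewrite /within/= -nbhs_ballE => -[r /= r0 Hr].
by rewrite -nbhs_ballE; exists r => //= -[s t] [/= xs _] [/= sab _]; exact: Hr.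
Qed.

Lemma continuous_within_snd a b c d k : {within `[c, d], continuous k} ->
  {within rect a b c d, continuous (fun z => k z.2)}.
Proof.
move=> /subspace_continuousP ck; apply/subspace_continuousP => -[x y] [/= xab ycd].
apply/cvgrPdist_lt => e e0; have /cvgrPdist_lt/(_ _ e0) := ck y ycd.
rewrite /within/= -nbhs_ballE => -[r /= r0 Hr].
by rewrite -nbhs_ballE; exists r => //= -[s t] [/= _ yt] [/= _ tcd]; exact: Hr.
Qed.

(** One variable at a time: equality on the whole of almost every vertical line, then on each
    horizontal line by continuity in [x]. *)
Lemma continuous_ae_eq_rect a b c d f g : a < b -> c < d ->
  {within rect a b c d, continuous f} -> {within rect a b c d, continuous g} ->
  ae_eq leb2 (rect a b c d) f g -> forall z, rect a b c d z -> f z = g z.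
Proof.
move=> ab cd cf cg /ae_rect_sections fg [x y] [/= xab ycd].
apply: (within_ae_eq ab (section_continuous2 cf ycd) (section_continuous2 cg ycd)) xab.
apply: filterS fg => s H sab.
exact: (within_ae_eq cd (section_continuous1 cf sab) (section_continuous1 cg sab) (H sab)).
Qed.

(** The representative behind the chosen value may differ from [g], but two continuous
    representatives coincide on the rectangle. *)
Lemma point_valueE a b c d u g z : a < b -> c < d -> ae_eq leb2 (rect a b c d) g u ->
  {within rect a b c d, continuous g} -> rect a b c d z ->
  point_value a b c d u z = g z.
Proof.
move=> ab cd gu cg zr.
have ex : exists t, is_point_value a b c d u z t by exists (g z), g.
have : is_point_value a b c d u z (point_value a b c d u z) := xgetPex 0 ex.
move=> [g' [gu' cg' <-]].
apply: (continuous_ae_eq_rect ab cd) => //.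
by apply: filterS2 gu gu' => w H H' wr; rewrite H// H'.
Qed.

(** A good [x0] forces [l] to be constant almost everywhere, and then a good [y0] does the same for
    [k] with the same constant. *)
Lemma ae_separated a b c d k l : a < b -> c < d ->
  ae_eq leb2 (rect a b c d) (fun z => k z.1) (fun z => l z.2) ->
  exists A, {ae mu, forall x, x \in `[a, b] -> k x = A} /\
            {ae mu, forall y, y \in `[c, d] -> l y = A}.
Proof.
move=> ab cd kl; have := ae_rect_sections (ae_eq_rect_swap kl).
have := ae_rect_sections kl => /(not_ae_false ab)[x0 /subset_itv_oo_cc xab /(_ xab) ly].
move=> kx; exists (k x0); split; last by apply: filterS ly => y H ycd; rewrite -H.
have lk : {ae mu, forall y, y \in `[c, d] ->
    l y = k x0 /\ {ae mu, forall x, x \in `[a, b] -> k x = l y}}.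
  by apply: filterS2 ly kx => y H1 H2 ycd; split; [rewrite -H1|exact: H2].
have [y0 /subset_itv_oo_cc ycd /(_ ycd)[<- //]] := not_ae_false cd lk.
Qed.

(** Integrates the formula for [q] along a vertical line and merges the iterated integral of [D]
    into a double one. The exceptional set of [x] does not depend on [y]. *)
Lemma prim_y_repr a b c d q D (Q : R -> R) : a < b -> c < d ->
  L2_rect a b c d q -> L2_rect a b c d D -> L2 c d Q ->
  ae_eq leb2 (rect a b c d) q (fun z => Q z.2 + \int[mu]_(t in `[a, z.1]) D (t, z.2)) ->
  {ae mu, forall x, x \in `[a, b] -> forall y, y \in `[c, d] ->
    prim_y c q (x, y) = \int[mu]_(t in `[c, y]) Q t + \int[leb2]_(w in rect a x c y) D w}.
Proof.
move=> ab cd Lq LD LQ /ae_rect_sections.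
(* Dropping x = a keeps [[a, x]] nondegenerate, as [L2_rect_integral] demands. *)
apply: filterS3 (ae_neq a) (ae_integrable_section Lq) => x xa iq + xab y ycd.
move=> /(_ xab) E; have {}iq := iq xab.
move: (xab) (ycd); rewrite !in_itv/= => /andP[ax xb] /andP[cy yd].
have {}ax : a < x by rewrite lt_neqAle eq_sym xa.
have LDx : L2_rect a x c d D by apply: L2_rect_sub LD => //; exact: ltW.
have Lw := L2_rect_integral ax (L2_rect_swap LDx).
pose w t := \int[mu]_(s in `[a, x]) (D \o swap) (t, s).
have iQ := L2_integrable LQ; have iw := L2_integrable Lw.
have sub k : mu.-integrable `[c, d] (EFin \o k) -> mu.-integrable `[c, y] (EFin \o k).
  exact: integrable_sub_itv.
rewrite /prim_y/= (@ae_eq_Rintegral R _ _ mu `[c, y] _ (fun t => Q t + w t))//; last 3 first.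
- by apply/measurable_EFinP; exact: (measurable_int mu (sub _ iq)).
- apply: measurable_funD; apply/measurable_EFinP.
    exact: (measurable_int mu (sub _ iQ)).
  exact: (measurable_int mu (sub _ iw)).
- apply: filterS E => t H tcy; apply: H; move: tcy; rewrite /= !in_itv/= => /andP[-> ty].
  exact: le_trans yd.
rewrite RintegralD//; [|exact: sub iQ|exact: sub iw]; congr (_ + _).
have LDxy : L2_rect a x c y D by apply: L2_rect_sub LD => //; exact: ltW.
by rewrite -(Rintegral_rect_swap LDxy) (Rintegral_rect (L2_rect_swap LDxy)).
Qed.

(* p, q and D stand for u_x, u_y and u_xy. *)
Definition mixed a b c d u p q D :=
  [/\ L2_rect a b c d u, L2_rect a b c d p, L2_rect a b c d q & L2_rect a b c d D] /\
  [/\ weak_pair a b c d 1 0 u p, weak_pair a b c d 0 1 u q,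
      weak_pair a b c d 0 1 p D & weak_pair a b c d 1 0 q D].

Lemma ytrace_repr a b c d p D : a < b -> c < d ->
  L2_rect a b c d p -> L2_rect a b c d D -> weak_pair a b c d 1 0 p D ->
  [/\ L2 c d (ytrace a b c d p a),
      ae_eq leb2 (rect a b c d) p
        (fun z => ytrace a b c d p a z.2 + \int[mu]_(t in `[a, z.1]) D (t, z.2)) &
      {ae mu, forall y, y \in `[c, d] -> ytrace a b c d p b y =
        ytrace a b c d p a y + \int[mu]_(x in `[a, b]) D (x, y)}].
Proof.
move=> ab cd Lp LD pD; rewrite !ytrace_swap.
have [L E E'] := xtrace_repr cd ab (L2_rect_swap Lp) (L2_rect_swap LD)
  (weak_pair_swap cd ab Lp LD pD).
split => //; apply: filterS (ae_swap E) => -[x y] /= H [xab ycd].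
by have := H (conj ycd xab).
Qed.

(** With I the double integral of [D], integrating in [y] gives u = U1(x) + prim Q + I, and
    integrating in [x] gives u = U2(y) + prim P + I. So U1 - prim P, a function of [x], equals U2 -
    prim Q, a function of [y], and both are a constant [A]. The resulting formula is continuous on
    the rectangle and supplies the point values. *)
Lemma mixed_repr a b c d u p q D : a < b -> c < d -> mixed a b c d u p q D ->
  let P := xtrace a b c d p c in let Q := ytrace a b c d q a in
  [/\ L2 a b P, L2 c d Q & exists A,
  [/\ forall x y, x \in `[a, b] -> y \in `[c, d] ->
        point_value a b c d u (x, y) = A + \int[mu]_(t in `[a, x]) P t +
          \int[mu]_(t in `[c, y]) Q t + \int[leb2]_(w in rect a x c y) D w,
      {ae mu, forall x, x \in `[a, b] ->
        xtrace a b c d u c x = A + \int[mu]_(t in `[a, x]) P t} &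
      {ae mu, forall y, y \in `[c, d] ->
        ytrace a b c d u a y = A + \int[mu]_(t in `[c, y]) Q t}]].
Proof.
move=> ab cd [[Lu Lp Lq LD] [up uq pD qD]] P Q.
have [LP pE _] := xtrace_repr ab cd Lp LD pD; rewrite -/P in LP pE.
have [LU1 uE1 _] := xtrace_repr ab cd Lu Lq uq.
have [LQ qE _] := ytrace_repr ab cd Lq LD qD; rewrite -/Q in LQ qE.
have [LU2 uE2 _] := ytrace_repr ab cd Lu Lp up.
split => //.
set U1 := xtrace a b c d u c in LU1 uE1 *; set U2 := ytrace a b c d u a in LU2 uE2 *.
pose I (z : R * R) := \int[leb2]_(w in rect a z.1 c z.2) D w.
have u1 : ae_eq leb2 (rect a b c d) u
    (fun z => U1 z.1 + (\int[mu]_(t in `[c, z.2]) Q t + I z)).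
  have := ae_fst mu (prim_y_repr ab cd Lq LD LQ qE).
  by apply: filterS2 uE1 => -[x y] H1 H2 zr; rewrite H1// H2//; case: zr.
have u2 : ae_eq leb2 (rect a b c d) u
    (fun z => U2 z.2 + (\int[mu]_(t in `[a, z.1]) P t + I z)).
  have pE' : ae_eq leb2 (rect c d a b) (p \o swap)
      (fun z => P z.2 + \int[mu]_(t in `[c, z.1]) (D \o swap) (t, z.2)).
    exact: (ae_eq_rect_swap pE).
  have := ae_snd mu (prim_y_repr cd ab (L2_rect_swap Lp) (L2_rect_swap LD) LP pE').
  apply: filterS2 uE2 => -[x y] H1 H2 [/= xab ycd]; rewrite H1//=; congr (_ + _).
  rewrite [LHS]H2//=; congr (_ + _); rewrite /I/=.
  apply: Rintegral_rect_swap; move: xab ycd; rewrite !in_itv/= => /andP[? ?] /andP[? ?].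
  by apply: L2_rect_sub LD.
have [A [kA lA]] : exists A,
    {ae mu, forall x, x \in `[a, b] -> U1 x - \int[mu]_(t in `[a, x]) P t = A} /\
    {ae mu, forall y, y \in `[c, d] -> U2 y - \int[mu]_(t in `[c, y]) Q t = A}.
  apply: ae_separated => //; apply: filterS2 u1 u2 => z H1 H2 zr.
  have sub_swap (r1 r2 v w i : R) : r1 + (w + i) = r2 + (v + i) -> r1 - v = r2 - w by lra.
  exact: sub_swap (etrans (esym (H1 zr)) (H2 zr)).
exists A; split; last 2 first.
- by apply: filterS kA => x H xab; rewrite -(H xab) subrK.
- by apply: filterS lA => y H ycd; rewrite -(H ycd) subrK.
move=> x y xab ycd.
pose g z := A + \int[mu]_(t in `[a, z.1]) P t + \int[mu]_(t in `[c, z.2]) Q t + I z.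
apply: (@point_valueE a b c d u g (x, y) ab cd); last by split.
- have := ae_fst mu kA; apply: filterS2 u1 => z H1 H2 zr.
  by rewrite /g -(H2 zr.1) subrK -addrA H1.
- have cP := continuous_within_fst (prim_continuous (ltW ab) (L2_integrable LP)).
  have cQ := continuous_within_snd (prim_continuous (ltW cd) (L2_integrable LQ)).
  have cI := continuous_rect_integral ab cd LD.
  move=> z; apply: cvgD; last exact: cI.
  by apply: cvgD; [apply: cvgD; [exact: cvg_cst|exact: cP]|exact: cQ].
Qed.

End mixed.

(** * Boundary identities *)

Section identities.
Context {R : realType}.
Local Notation mu := (@lebesgue_measure R).
Implicit Types (a b c d s t x y : R) (k l w : R -> R) (f g u p q D : R * R -> R).

Lemma L2_rect_measurable a b c d f : L2_rect a b c d f ->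
  measurable_fun (rect a b c d : set (measurableTypeR R * measurableTypeR R)) f.
Proof.
move=> /L2_rectP[mf _]; apply/(measurable_restrictT _ _).2 => //.
exact: measurable_rect.
Qed.

Lemma ae_eq_Rintegral_rect a b c d f g : L2_rect a b c d f -> L2_rect a b c d g ->
  ae_eq leb2 (rect a b c d) f g ->
  \int[leb2]_(z in rect a b c d) f z = \int[leb2]_(z in rect a b c d) g z.
Proof.
move=> /L2_rect_measurable mf /L2_rect_measurable mg fg.
exact: (ae_eq_Rintegral (measurable_rect a b c d) mf mg fg).
Qed.

(** Allows the blocks of [uhat] to take the place of the chosen top derivatives. *)
Lemma weak_pair_ae a b c d i j p D D' : L2_rect a b c d D -> L2_rect a b c d D' ->
  ae_eq leb2 (rect a b c d) D D' -> weak_pair a b c d i j p D -> weak_pair a b c d i j p D'.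
Proof.
move=> LD LD' DD' pD phi psi tphi tpsi; rewrite pD//; congr (_ * _).
have tL g : L2_rect a b c d g -> L2_rect a b c d (fun z => g z * tensor phi psi z).
  move=> Lg; have := L2_rect_mull (test1_continuous tphi)
    (L2_rect_mulrc (test1_continuous tpsi) Lg).
  congr (L2_rect _ _ _ _ _); apply/funext => z.
  by rewrite /tensor -mulrA [psi _ * _]mulrC.
apply: ae_eq_Rintegral_rect; [exact: tL|exact: tL|].
by apply: filterS DD' => z H /H ->.
Qed.

(** Origin of the weights (d - y) and (b - x): integration by parts against psi(y) = y - d, which
    has derivative 1 and vanishes at [d]. *)
Lemma Rintegral_prim c d w : c <= d -> mu.-integrable `[c, d] (EFin \o w) ->
  \int[mu]_(y in `[c, d]) \int[mu]_(t in `[c, y]) w t =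
  \int[mu]_(y in `[c, d]) ((d - y) * w y).
Proof.
move=> cd iw; pose psi (y : R) := y - d.
have dpsi (x : R) : is_derive x 1 psi 1.
  by have := is_deriveB (is_derive_id x (1 : R)) (is_derive_cst d x 1); rewrite subr0.
have d1 : derive1 psi = cst 1.
  by apply/funext => x; rewrite derive1E; have [_ ->] := dpsi x.
have := @integral_prim_derive1 R c d w psi cd iw _ _ _.
rewrite d1 => /(_ _ _ _)H.
transitivity (\int[mu]_(y in `[c, d]) ((\int[mu]_(t in `[c, y]) w t) * cst 1 y)).
  by apply: eq_Rintegral => y _; rewrite mulr1.
rewrite H.
- rewrite -mulN1r -RintegralZl//.
    by apply: eq_Rintegral => y _; rewrite /psi mulrCA mulN1r opprB mulrC.
  apply: integrableMc => //; apply: continuous_subspaceT => x.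
  by apply: differentiable_continuous; apply/derivable1_diffP; have [] := dpsi x.
- by move=> x; have [] := dpsi x.
- exact: cst_continuous.
- by rewrite /psi subrr.
Qed.

Lemma Rintegral_cstD_prim c d (A : R) w : c <= d -> mu.-integrable `[c, d] (EFin \o w) ->
  \int[mu]_(y in `[c, d]) (A + \int[mu]_(t in `[c, y]) w t) =
  (d - c) * A + \int[mu]_(y in `[c, d]) ((d - y) * w y).
Proof.
move=> cd iw; rewrite RintegralD//.
- rewrite Rintegral_prim// Rintegral_cst//; congr (_ + _).
  rewrite mulrC [X in fine X]lebesgue_measure_itv/= lte_fin.
  by have [_|dc] := ltP c d; rewrite //= (le_anti (introT andP (conj cd dc))) subrr.
- by apply: continuous_compact_integrable; [exact: segment_compact|
    apply: continuous_subspaceT; exact: cst_continuous].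
- by apply: continuous_compact_integrable; [exact: segment_compact|exact: prim_continuous].
Qed.

(** Almost every section is a constant plus a primitive, which [Rintegral_cstD_prim] integrates. *)
Lemma ae_integral_section a b c d p D : a < b -> c < d ->
  L2_rect a b c d p -> L2_rect a b c d D -> weak_pair a b c d 0 1 p D ->
  {ae mu, forall x, x \in `[a, b] -> \int[mu]_(y in `[c, d]) p (x, y) =
    (d - c) * xtrace a b c d p c x + \int[mu]_(y in `[c, d]) ((d - y) * D (x, y))}.
Proof.
move=> ab cd Lp LD pD; have [_ pE _] := xtrace_repr ab cd Lp LD pD.
apply: filterS3 (ae_rect_sections pE) (ae_integrable_section Lp) (ae_integrable_section LD).
move=> x + + + xab => /(_ xab) E /(_ xab) ip /(_ xab) iD.
rewrite -Rintegral_cstD_prim// ?ltW//; apply: ae_eq_Rintegral => //.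
- by apply/measurable_EFinP; exact: (measurable_int mu ip).
- apply: measurable_funD => //.
  apply: subspace_continuous_measurable_fun => //.
  exact: prim_continuous (ltW cd) iD.
Qed.

(** The weight [k] in the transverse variable is 1, or the factor left by an expansion already made
    in the other direction. *)
Lemma Rintegral_rect_pair a b c d p D k : a < b -> c < d -> continuous k ->
  L2_rect a b c d p -> L2_rect a b c d D -> weak_pair a b c d 0 1 p D ->
  \int[mu]_(x in `[a, b]) \int[mu]_(y in `[c, d]) (k x * p (x, y)) =
  (d - c) * \int[mu]_(x in `[a, b]) (k x * xtrace a b c d p c x) +
  \int[mu]_(x in `[a, b]) \int[mu]_(y in `[c, d]) (k x * ((d - y) * D (x, y))).
Proof.
move=> ab cd ck Lp LD pD; have [LP _ _] := xtrace_repr ab cd Lp LD pD.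
have cl : continuous (fun y : R => d - y).
  by move=> y; apply: cvgB; [exact: cvg_cst|exact: cvg_id].
have LdD : L2_rect a b c d (fun z => (d - z.2) * D z).
  have := L2_rect_mulrc cl LD; congr (L2_rect _ _ _ _ _).
  by apply/funext => z; rewrite mulrC.
have Lk g : L2_rect a b c d g -> L2_rect a b c d (fun z => k z.1 * g z).
  move=> Lg; have := L2_rect_mull ck Lg; congr (L2_rect _ _ _ _ _).
  by apply/funext => z; rewrite mulrC.
have Lkp := L2_rect_integral cd (Lk _ Lp).
have LkdD := L2_rect_integral cd (Lk _ LdD).
have ikP : mu.-integrable `[a, b] (EFin \o (fun x => k x * xtrace a b c d p c x)).
  rewrite (_ : (fun x => _) = (fun x => xtrace a b c d p c x * k x)).
    exact: integrableMc (L2_integrable LP) (continuous_subspaceT ck).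
  by apply/funext => x; rewrite mulrC.
rewrite -RintegralZl// -RintegralD//; last 2 first.
- rewrite (_ : _ \o _ = (fun x => (d - c)%:E *
    (EFin \o (fun x => (k x * xtrace a b c d p c x)%R)) x)%E)//.
  exact: integrableZl.
- exact: (L2_integrable LkdD).
apply: ae_eq_Rintegral => //.
- exact: (L2_measurable Lkp).
- apply: measurable_funD; last exact: (L2_measurable LkdD).
  apply: measurable_funM => //; apply/measurable_EFinP; exact: (measurable_int mu ikP).
- apply: filterS3 (ae_integral_section ab cd Lp LD pD) (ae_integrable_section Lp)
    (ae_integrable_section LdD) => x + + + xab.
  move=> /(_ xab) E /(_ xab) ip /(_ xab) idD /=.
  by rewrite !RintegralZl// E mulrDr mulrCA.
Qed.

End identities.

(** * Values at the corners and on the far sides *)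

Section corners.
Context {R : realType} (a b c d : R).
Hypotheses (ab : a < b) (cd : c < d).
Local Notation mu := (@lebesgue_measure R).
Implicit Types (k l w : R -> R) (f g u p q D : R * R -> R).

Local Notation pv := (point_value a b c d).
Local Notation xt := (xtrace a b c d).
Local Notation yt := (ytrace a b c d).
Local Notation L2r := (L2_rect a b c d).
Local Notation wp := (weak_pair a b c d).

Lemma Rintegral_iter_swap f : L2r f ->
  \int[mu]_(x in `[a, b]) \int[mu]_(y in `[c, d]) f (x, y) =
  \int[mu]_(y in `[c, d]) \int[mu]_(x in `[a, b]) f (x, y).
Proof.
move=> Lf; rewrite -Rintegral_rect// -Rintegral_rect_swap//.
exact: (Rintegral_rect (L2_rect_swap Lf)).
Qed.

Lemma ae_integral_section_y p D : L2r p -> L2r D -> wp 1 0 p D ->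
  {ae mu, forall y, y \in `[c, d] -> \int[mu]_(x in `[a, b]) p (x, y) =
    (b - a) * yt p a y + \int[mu]_(x in `[a, b]) ((b - x) * D (x, y))}.
Proof.
move=> Lp LD pD; rewrite ytrace_swap.
exact: (ae_integral_section cd ab (L2_rect_swap Lp) (L2_rect_swap LD)
  (weak_pair_swap cd ab Lp LD pD)).
Qed.

Lemma Rintegral_rect_pair_y p D k : continuous k ->
  L2r p -> L2r D -> wp 1 0 p D ->
  \int[mu]_(y in `[c, d]) \int[mu]_(x in `[a, b]) (k y * p (x, y)) =
  (b - a) * \int[mu]_(y in `[c, d]) (k y * yt p a y) +
  \int[mu]_(y in `[c, d]) \int[mu]_(x in `[a, b]) (k y * ((b - x) * D (x, y))).
Proof.
move=> ck Lp LD pD; rewrite ytrace_swap.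
exact: (Rintegral_rect_pair cd ab ck (L2_rect_swap Lp) (L2_rect_swap LD)
  (weak_pair_swap cd ab Lp LD pD)).
Qed.

Let aab : a \in `[a, b]. Proof. by rewrite in_itv/= lexx ltW. Qed.
Let bab : b \in `[a, b]. Proof. by rewrite in_itv/= lexx ltW. Qed.
Let ccd : c \in `[c, d]. Proof. by rewrite in_itv/= lexx ltW. Qed.
Let dcd : d \in `[c, d]. Proof. by rewrite in_itv/= lexx ltW. Qed.

Lemma Rintegral_rect_left y D : c <= y -> y <= d -> L2r D ->
  \int[leb2]_(w in rect a a c y) D w = 0.
Proof.
move=> cy yd LD; rewrite (Rintegral_rect_sub (lexx a) (ltW ab) cy yd LD).
by rewrite set_itv1 Rintegral_set1.
Qed.

Lemma Rintegral_rect_bottom x D : a <= x -> x <= b -> L2r D ->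
  \int[leb2]_(w in rect a x c c) D w = 0.
Proof.
move=> ax xb LD; rewrite (Rintegral_rect_sub ax xb (lexx c) (ltW cd) LD).
rewrite (@eq_Rintegral _ _ _ mu _ (cst 0)); first by rewrite Rintegral_cst// mul0r.
by move=> s _; rewrite set_itv1 Rintegral_set1.
Qed.

(** [mixed_repr] at the four corners, where degenerate intervals and rectangles contribute nothing;
    the corner (a, c) identifies the constant. *)
Lemma mixed_corners u p q D : mixed a b c d u p q D ->
  [/\ pv u (b, c) = pv u (a, c) + \int[mu]_(x in `[a, b]) xt p c x,
      pv u (a, d) = pv u (a, c) + \int[mu]_(y in `[c, d]) yt q a y,
      pv u (b, d) = pv u (a, c) + \int[mu]_(x in `[a, b]) xt p c x +
        \int[mu]_(y in `[c, d]) yt q a y +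
        \int[mu]_(x in `[a, b]) \int[mu]_(y in `[c, d]) D (x, y),
      {ae mu, forall x, x \in `[a, b] ->
        xt u c x = pv u (a, c) + \int[mu]_(t in `[a, x]) xt p c t} &
      {ae mu, forall y, y \in `[c, d] ->
        yt u a y = pv u (a, c) + \int[mu]_(t in `[c, y]) yt q a t}].
Proof.
move=> M; have [_ _ LD] : [/\ L2r p, L2r q & L2r D] by case: M => -[].
have [LP LQ [A [uA xA yA]]] := mixed_repr ab cd M.
have AE : pv u (a, c) = A.
  rewrite uA// !set_itv1 !Rintegral_set1 !addr0.
  by rewrite Rintegral_rect_left ?addr0// ltW.
rewrite AE; split => //.
- rewrite uA// set_itv1 Rintegral_set1 addr0.
  by rewrite Rintegral_rect_bottom ?addr0// ltW.
- rewrite uA// set_itv1 Rintegral_set1 addr0.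
  by rewrite Rintegral_rect_left ?addr0// ltW.
- by rewrite uA// Rintegral_rect.
Qed.

Lemma mixed_Rintegral_xtrace u p q D : mixed a b c d u p q D ->
  \int[mu]_(x in `[a, b]) xt u c x =
  (b - a) * pv u (a, c) + \int[mu]_(x in `[a, b]) ((b - x) * xt p c x).
Proof.
move=> M; have [_ _ _ uP _] := mixed_corners M.
have [LP LQ _] := mixed_repr ab cd M.
have [[Lu Lp Lq LD] [_ uq _ _]] := M.
have [LU _ _] := xtrace_repr ab cd Lu Lq uq.
rewrite -Rintegral_cstD_prim ?ltW//; last exact: L2_integrable.
apply: ae_eq_Rintegral => //; first exact: L2_measurable.
apply: measurable_funD => //; apply: subspace_continuous_measurable_fun => //.
exact: prim_continuous (ltW ab) (L2_integrable LP).
Qed.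

Lemma mixed_Rintegral_ytrace u p q D : mixed a b c d u p q D ->
  \int[mu]_(y in `[c, d]) yt u a y =
  (d - c) * pv u (a, c) + \int[mu]_(y in `[c, d]) ((d - y) * yt q a y).
Proof.
move=> M; have [_ _ _ _ uQ] := mixed_corners M.
have [LP LQ _] := mixed_repr ab cd M.
have [[Lu Lp Lq LD] [up _ _ _]] := M.
have [LU _ _] := ytrace_repr ab cd Lu Lp up.
rewrite -Rintegral_cstD_prim ?ltW//; last exact: L2_integrable.
apply: ae_eq_Rintegral => //; first exact: L2_measurable.
apply: measurable_funD => //; apply: subspace_continuous_measurable_fun => //.
exact: prim_continuous (ltW cd) (L2_integrable LQ).
Qed.

Lemma Rintegral_rect_xpair p D : L2r p -> L2r D -> wp 1 0 p D ->
  \int[mu]_(x in `[a, b]) \int[mu]_(y in `[c, d]) p (x, y) =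
  (b - a) * \int[mu]_(y in `[c, d]) yt p a y +
  \int[mu]_(x in `[a, b]) \int[mu]_(y in `[c, d]) ((b - x) * D (x, y)).
Proof.
move=> Lp LD pD.
have cl : continuous (fun x : R => b - x).
  by move=> x; apply: cvgB; [exact: cvg_cst|exact: cvg_id].
have LbD : L2r (fun z => (b - z.1) * D z).
  have := L2_rect_mull cl LD; congr (L2_rect _ _ _ _ _).
  by apply/funext => z; rewrite mulrC.
rewrite Rintegral_iter_swap// (Rintegral_iter_swap LbD).
have := @Rintegral_rect_pair_y p D (cst 1) (@cst_continuous _ _ _) Lp LD pD.
under eq_Rintegral do under eq_Rintegral do rewrite mul1r.
under [in X in _ = X -> _]eq_Rintegral do rewrite mul1r.
move=> ->; apply: (congr1 (+%R _)).
by apply: eq_Rintegral => y _; apply: eq_Rintegral => x _; rewrite mul1r.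
Qed.

Lemma Rintegral_rect_ypair p D : L2r p -> L2r D -> wp 0 1 p D ->
  \int[mu]_(x in `[a, b]) \int[mu]_(y in `[c, d]) p (x, y) =
  (d - c) * \int[mu]_(x in `[a, b]) xt p c x +
  \int[mu]_(x in `[a, b]) \int[mu]_(y in `[c, d]) ((d - y) * D (x, y)).
Proof.
move=> Lp LD pD.
have := Rintegral_rect_pair ab cd (@cst_continuous R R 1) Lp LD pD.
under eq_Rintegral do under eq_Rintegral do rewrite mul1r.
under [in X in _ = X -> _]eq_Rintegral do rewrite mul1r.
move=> ->; apply: (congr1 (+%R _)).
by apply: eq_Rintegral => y _; apply: eq_Rintegral => x _; rewrite mul1r.
Qed.

(** Expand in [y]; then expand in [x] both resulting terms, the trace of [r] on [y = c] through [s]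
    and the double integral of (d - y) t through [D]. *)
Lemma mixed_Rintegral_rect r s t D : mixed a b c d r s t D ->
  \int[mu]_(x in `[a, b]) \int[mu]_(y in `[c, d]) r (x, y) =
  (d - c) * (b - a) * pv r (a, c) +
  (d - c) * \int[mu]_(x in `[a, b]) ((b - x) * xt s c x) +
  (b - a) * \int[mu]_(y in `[c, d]) ((d - y) * yt t a y) +
  \int[mu]_(x in `[a, b]) \int[mu]_(y in `[c, d]) ((d - y) * (b - x) * D (x, y)).
Proof.
move=> M; have [[Lr Ls Lt LD] [rs rt sD tD]] := M.
rewrite (Rintegral_rect_ypair Lr Lt rt) (mixed_Rintegral_xtrace M).
have cl : continuous (fun y : R => d - y).
  by move=> x; apply: cvgB; [exact: cvg_cst|exact: cvg_id].
have cl' : continuous (fun x : R => b - x).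
  by move=> x; apply: cvgB; [exact: cvg_cst|exact: cvg_id].
have Ldt : L2r (fun z => (d - z.2) * t z).
  have := L2_rect_mulrc cl Lt; congr (L2_rect _ _ _ _ _).
  by apply/funext => z; rewrite mulrC.
have LdbD : L2r (fun z => (d - z.2) * (b - z.1) * D z).
  have := L2_rect_mull cl' (L2_rect_mulrc cl LD); congr (L2_rect _ _ _ _ _).
  by apply/funext => z; rewrite -mulrA mulrC.
rewrite (Rintegral_iter_swap Ldt) (Rintegral_rect_pair_y cl Lt LD tD).
rewrite (Rintegral_iter_swap LdbD).
under [X in _ + (_ + X) = _]eq_Rintegral do under eq_Rintegral do rewrite mulrA.
(* Stated over plain reals, so that the integrals enter the algebra as atoms. *)
have expand (l m r1 p2 q2 w : R) :
    m * (l * r1 + p2) + (l * q2 + w) = m * l * r1 + m * p2 + l * q2 + w by ring.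
exact: expand.
Qed.

(* u, p, q, r are u, u_x, u_y, u_xy, then pp, s, qq, t, D are
   u_xx, u_xxy, u_yy, u_xyy, u_xxyy. *)
Lemma mixed2_corners u p q r pp s qq t D :
  mixed a b c d u p q r -> mixed a b c d p pp r s -> mixed a b c d q r qq t ->
  mixed a b c d r s t D ->
  [/\ pv u (b, c) = pv u (a, c) + (b - a) * pv p (a, c) +
        \int[mu]_(x in `[a, b]) ((b - x) * xt pp c x),
      pv u (a, d) = pv u (a, c) + (d - c) * pv q (a, c) +
        \int[mu]_(y in `[c, d]) ((d - y) * yt qq a y) &
      pv u (b, d) = pv u (a, c) + (b - a) * pv p (a, c) + (d - c) * pv q (a, c) +
        (d - c) * (b - a) * pv r (a, c) +
        \int[mu]_(x in `[a, b]) ((b - x) * xt pp c x) +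
        (d - c) * \int[mu]_(x in `[a, b]) ((b - x) * xt s c x) +
        \int[mu]_(y in `[c, d]) ((d - y) * yt qq a y) +
        (b - a) * \int[mu]_(y in `[c, d]) ((d - y) * yt t a y) +
        \int[mu]_(x in `[a, b]) \int[mu]_(y in `[c, d]) ((d - y) * (b - x) * D (x, y))].
Proof.
move=> M0 Mx My Mxy; have [-> -> -> _ _] := mixed_corners M0.
have expand (A P Q W l m p1 p2 q1 q2 r1 p3 q3 w : R) :
    P = l * p1 + p2 -> Q = m * q1 + q2 -> W = m * l * r1 + m * p3 + l * q3 + w ->
    A + P + Q + W =
    A + l * p1 + m * q1 + m * l * r1 + p2 + m * p3 + q2 + l * q3 + w.
  by move=> -> -> ->; ring.
(* The traces of u_x and u_y in the first-order formula are themselves primitives of traces, which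
   brings in the second derivatives with their weights. *)
have EP := mixed_Rintegral_xtrace Mx; have EQ := mixed_Rintegral_ytrace My.
split; last exact: (expand _ _ _ _ _ _ _ _ _ _ _ _ _ _ EP EQ (mixed_Rintegral_rect Mxy)).
- exact: (etrans (congr1 (+%R _) EP) (addrA _ _ _)).
- exact: (etrans (congr1 (+%R _) EQ) (addrA _ _ _)).
Qed.

(** One derivative in [x] is already spent, so only the [y] direction is expanded to second order
    and only (d - y) appears as a weight. *)
Lemma mixed2_corners_dx p pp r s t D :
  mixed a b c d p pp r s -> mixed a b c d r s t D ->
  [/\ pv p (b, c) = pv p (a, c) + \int[mu]_(x in `[a, b]) xt pp c x,
      pv p (a, d) = pv p (a, c) + (d - c) * pv r (a, c) +
        \int[mu]_(y in `[c, d]) ((d - y) * yt t a y) &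
      pv p (b, d) = pv p (a, c) + (d - c) * pv r (a, c) +
        \int[mu]_(x in `[a, b]) xt pp c x + (d - c) * \int[mu]_(x in `[a, b]) xt s c x +
        \int[mu]_(y in `[c, d]) ((d - y) * yt t a y) +
        \int[mu]_(x in `[a, b]) \int[mu]_(y in `[c, d]) ((d - y) * D (x, y))].
Proof.
move=> Mx Mxy; have [-> -> -> _ _] := mixed_corners Mx.
have [[Lr Ls Lt LD] [rs rt sD tD]] := Mxy.
have expand (A P Q W m r1 q2 p3 w : R) : Q = m * r1 + q2 -> W = m * p3 + w ->
    A + P + Q + W = A + m * r1 + P + m * p3 + q2 + w.
  by move=> -> ->; ring.
have EQ := mixed_Rintegral_ytrace Mxy.
split; first exact: erefl.
- exact: (etrans (congr1 (+%R _) EQ) (addrA _ _ _)).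
- exact: (expand _ _ _ _ _ _ _ _ _ EQ (Rintegral_rect_ypair Ls LD sD)).
Qed.

Lemma mixed2_corners_dy q r qq s t D :
  mixed a b c d q r qq t -> mixed a b c d r s t D ->
  [/\ pv q (b, c) = pv q (a, c) + (b - a) * pv r (a, c) +
        \int[mu]_(x in `[a, b]) ((b - x) * xt s c x),
      pv q (a, d) = pv q (a, c) + \int[mu]_(y in `[c, d]) yt qq a y &
      pv q (b, d) = pv q (a, c) + (b - a) * pv r (a, c) +
        \int[mu]_(x in `[a, b]) ((b - x) * xt s c x) +
        \int[mu]_(y in `[c, d]) yt qq a y + (b - a) * \int[mu]_(y in `[c, d]) yt t a y +
        \int[mu]_(x in `[a, b]) \int[mu]_(y in `[c, d]) ((b - x) * D (x, y))].
Proof.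
move=> My Mxy; have [-> -> -> _ _] := mixed_corners My.
have [[Lr Ls Lt LD] [rs rt sD tD]] := Mxy.
have expand (A P Q W l r1 p2 q3 w : R) : P = l * r1 + p2 -> W = l * q3 + w ->
    A + P + Q + W = A + l * r1 + p2 + Q + l * q3 + w.
  by move=> -> ->; ring.
have EP := mixed_Rintegral_xtrace Mxy.
split; last exact: (expand _ _ _ _ _ _ _ _ _ EP (Rintegral_rect_xpair Lt LD tD)).
- exact: (etrans (congr1 (+%R _) EP) (addrA _ _ _)).
- exact: erefl.
Qed.

Lemma xtrace_end2 p s D : L2r p -> L2r s -> L2r D -> wp 0 1 p s -> wp 0 1 s D ->
  {ae mu, forall x, x \in `[a, b] -> xt p d x =
    xt p c x + (d - c) * xt s c x + \int[mu]_(y in `[c, d]) ((d - y) * D (x, y))}.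
Proof.
move=> Lp Ls LD ps sD; have [_ _ pd] := xtrace_repr ab cd Lp Ls ps.
apply: filterS2 pd (ae_integral_section ab cd Ls LD sD) => x H1 H2 xab.
by rewrite H1// H2// addrA.
Qed.

Lemma ytrace_end2 p s D : L2r p -> L2r s -> L2r D -> wp 1 0 p s -> wp 1 0 s D ->
  {ae mu, forall y, y \in `[c, d] -> yt p b y =
    yt p a y + (b - a) * yt s a y + \int[mu]_(x in `[a, b]) ((b - x) * D (x, y))}.
Proof.
move=> Lp Ls LD ps sD; have [_ _ pd] := ytrace_repr ab cd Lp Ls ps.
apply: filterS2 pd (ae_integral_section_y Ls LD sD) => x H1 H2 xab.
by rewrite H1// H2// addrA.
Qed.

End corners.

(** * From Sobolev functions to systems of mixed derivatives *)

Section weak_derivatives.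
Context {R : realType} (a b c d : R).
Hypotheses (ab : a < b) (cd : c < d).
Implicit Types (u v : R * R -> R).
Local Notation wd := (weak_derivative a b c d).

Lemma sobolevP n u i j : sobolev a b c d n u -> (maxn i j <= n)%N ->
  is_weak_derivative a b c d i j u (wd i j u).
Proof.
move=> [_ H] ij; have [v Hv] := H i j ij.
by apply: (@xgetPex _ _ [set v | is_weak_derivative a b c d i j u v]); exists v.
Qed.

Lemma sobolev1_mixed u v : sobolev a b c d 1 u -> L2_rect a b c d v ->
  ae_eq leb2 (rect a b c d) v (wd 1 1 u) ->
  mixed a b c d u (wd 1 0 u) (wd 0 1 u) v.
Proof.
move=> su Lv vu; have H i j := @sobolevP 1 u i j su.
have [L10 _] := H 1%N 0%N isT.
have [L01 _] := H 0%N 1%N isT; have [L11 _] := H 1%N 1%N isT.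
have p10 := is_weak_derivative_pair (H 1%N 0%N isT).
have p01 := is_weak_derivative_pair (H 0%N 1%N isT).
have p11 := is_weak_derivative_pair (H 1%N 1%N isT).
have uv : ae_eq leb2 (rect a b c d) (wd 1 1 u) v.
  by apply: filterS vu => z H' /H' ->.
split; split=> //; first by case: su.
- exact: (weak_pair_ae L11 Lv uv (weak_pair_dy p10 p11)).
- exact: (weak_pair_ae L11 Lv uv (weak_pair_dx p01 p11)).
Qed.

(** The orders in [x] and in [y] are bounded separately, so u_xxy, u_xyy and u_xxyy exist;
    neighbouring derivatives are related by comparing them through [u]. *)
Lemma sobolev2_mixed u v : sobolev a b c d 2 u -> L2_rect a b c d v ->
  ae_eq leb2 (rect a b c d) v (wd 2 2 u) ->
  [/\ mixed a b c d u (wd 1 0 u) (wd 0 1 u) (wd 1 1 u),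
      mixed a b c d (wd 1 0 u) (wd 2 0 u) (wd 1 1 u) (wd 2 1 u),
      mixed a b c d (wd 0 1 u) (wd 1 1 u) (wd 0 2 u) (wd 1 2 u) &
      mixed a b c d (wd 1 1 u) (wd 2 1 u) (wd 1 2 u) v].
Proof.
move=> su Lv vu; have H i j := @sobolevP 2 u i j su.
have uv : ae_eq leb2 (rect a b c d) (wd 2 2 u) v.
  by apply: filterS vu => z H' /H' ->.
have L i j : (maxn i j <= 2)%N -> L2_rect a b c d (wd i j u) by move=> /H[].
have P i j (ij : (maxn i j <= 2)%N) := is_weak_derivative_pair (H i j ij).
have L0 : L2_rect a b c d u by case: su.
have dxP i j (i1 : (i < 2)%N) (j2 : (j <= 2)%N) :
    weak_pair a b c d 1 0 (wd i j u) (wd i.+1 j u).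
  by apply: (weak_pair_dx (P i j _) (P i.+1 j _)); rewrite geq_max ?i1 ?j2 ?(ltnW i1).
have dyP i j (i2 : (i <= 2)%N) (j1 : (j < 2)%N) :
    weak_pair a b c d 0 1 (wd i j u) (wd i j.+1 u).
  by apply: (weak_pair_dy (P i j _) (P i j.+1 _)); rewrite geq_max ?j1 ?i2 ?(ltnW j1).
have sD : weak_pair a b c d 0 1 (wd 2 1 u) v.
  exact: (weak_pair_ae (L 2 2 isT)%N Lv uv (dyP 2 1 isT isT)%N).
have tD : weak_pair a b c d 1 0 (wd 1 2 u) v.
  exact: (weak_pair_ae (L 2 2 isT)%N Lv uv (dxP 1 2 isT isT)%N).
(* [dxP 0 0] would start from the chosen representative [wd 0 0 u] instead of [u] itself. *)
have p10 : weak_pair a b c d 1 0 u (wd 1 0 u) := P 1%N 0%N isT.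
have p01 : weak_pair a b c d 0 1 u (wd 0 1 u) := P 0%N 1%N isT.
have [L10 L01 L11] := And3 (L 1 0 isT) (L 0 1 isT) (L 1 1 isT)%N.
have [L20 L02 L21 L12] :=
  And4 (L 2 0 isT) (L 0 2 isT) (L 2 1 isT) (L 1 2 isT)%N.
exact: (And4
  (conj (And4 L0 L10 L01 L11) (And4 p10 p01 (dyP 1 0 isT isT) (dxP 0 1 isT isT)))
  (conj (And4 L10 L20 L11 L21)
    (And4 (dxP 1 0 isT isT) (dyP 1 0 isT isT) (dyP 2 0 isT isT) (dxP 1 1 isT isT)))
  (conj (And4 L01 L11 L02 L12)
    (And4 (dxP 0 1 isT isT) (dyP 0 1 isT isT) (dyP 1 1 isT isT) (dxP 0 2 isT isT)))
  (conj (And4 L11 L21 L12 Lv)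
    (And4 (dxP 1 1 isT isT) (dyP 1 1 isT isT) sD tD)))%N.
Qed.

End weak_derivatives.

(** * Block matrices *)

Section blocks.
Context {R : realType}.
Local Notation mu := (@lebesgue_measure R).

Lemma mul_col3 m1 m2 m3 p n (A1 : 'M[R]_(m1, p)) (A2 : 'M[R]_(m2, p)) (A3 : 'M[R]_(m3, p))
    (X : 'M[R]_(p, n)) :
  col3 A1 A2 A3 *m X = col3 (A1 *m X) (A2 *m X) (A3 *m X).
Proof. by rewrite /col3 !mul_col_mx. Qed.

Lemma mul_col5 m1 m2 m3 m4 m5 p n (A1 : 'M[R]_(m1, p)) (A2 : 'M[R]_(m2, p))
    (A3 : 'M[R]_(m3, p)) (A4 : 'M[R]_(m4, p)) (A5 : 'M[R]_(m5, p)) (X : 'M[R]_(p, n)) :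
  col5 A1 A2 A3 A4 A5 *m X =
  col5 (A1 *m X) (A2 *m X) (A3 *m X) (A4 *m X) (A5 *m X).
Proof. by rewrite /col5 !mul_col_mx. Qed.

Lemma mul_row3_col3 m p1 p2 p3 n (A1 : 'M[R]_(m, p1)) (A2 : 'M[R]_(m, p2)) (A3 : 'M[R]_(m, p3))
    (X1 : 'M[R]_(p1, n)) (X2 : 'M[R]_(p2, n)) (X3 : 'M[R]_(p3, n)) :
  row3 A1 A2 A3 *m col3 X1 X2 X3 = A1 *m X1 + (A2 *m X2 + A3 *m X3).
Proof. by rewrite /row3 /col3 !mul_row_col. Qed.

Lemma mul_row5_col5 m p1 p2 p3 p4 p5 n (A1 : 'M[R]_(m, p1)) (A2 : 'M[R]_(m, p2))
    (A3 : 'M[R]_(m, p3)) (A4 : 'M[R]_(m, p4)) (A5 : 'M[R]_(m, p5))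
    (X1 : 'M[R]_(p1, n)) (X2 : 'M[R]_(p2, n)) (X3 : 'M[R]_(p3, n))
    (X4 : 'M[R]_(p4, n)) (X5 : 'M[R]_(p5, n)) :
  row5 A1 A2 A3 A4 A5 *m col5 X1 X2 X3 X4 X5 =
  A1 *m X1 + (A2 *m X2 + (A3 *m X3 + (A4 *m X4 + A5 *m X5))).
Proof. by rewrite /row5 /col5 !mul_row_col. Qed.

Lemma add_col3 p m1 m2 m3 (A1 B1 : 'M[R]_(m1, p)) (A2 B2 : 'M[R]_(m2, p)) (A3 B3 : 'M[R]_(m3, p)) :
  col3 A1 A2 A3 + col3 B1 B2 B3 = col3 (A1 + B1) (A2 + B2) (A3 + B3).
Proof. by rewrite /col3 !add_col_mx. Qed.

Lemma add_col5 p m1 m2 m3 m4 m5 (A1 B1 : 'M[R]_(m1, p)) (A2 B2 : 'M[R]_(m2, p))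
    (A3 B3 : 'M[R]_(m3, p)) (A4 B4 : 'M[R]_(m4, p)) (A5 B5 : 'M[R]_(m5, p)) :
  col5 A1 A2 A3 A4 A5 + col5 B1 B2 B3 B4 B5 =
  col5 (A1 + B1) (A2 + B2) (A3 + B3) (A4 + B4) (A5 + B5).
Proof. by rewrite /col5 !add_col_mx. Qed.

Lemma col3_submx p m1 m2 m3 (X : 'M[R]_(m1 + (m2 + m3), p)) :
  X = col3 (usubmx X) (usubmx (dsubmx X)) (dsubmx (dsubmx X)).
Proof. by rewrite /col3 !vsubmxK. Qed.

Lemma intv_col_mx (s t : R) m n (F : R -> 'cV[R]_m) (G : R -> 'cV[R]_n) :
  intv s t (fun r => col_mx (F r) (G r)) = col_mx (intv s t F) (intv s t G).
Proof.
apply/matrixP => i j; rewrite [LHS]mxE [RHS]mxE.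
under eq_Rintegral do rewrite mxE.
by case: (fintype.split i) => k; rewrite [RHS]mxE.
Qed.

(** A row index of the stacked column consists of its block, [sig1], and its position in the block,
    [sig2]. *)
Lemma kronI_mulE k n (v : 'cV[R]_k) (X : 'cV[R]_n) s j :
  (kronI v n *m X) s j = v (tagnat.sig1 s) 0 * X (tagnat.sig2 s) 0.
Proof. by rewrite mxcol_mul mxE mul_scalar_mx mxE (ord1 j). Qed.

Lemma kronIZ_mul k n (l : R) (v : 'cV[R]_k) (X : 'cV[R]_n) :
  kronI (l *: v) n *m X = kronI v n *m (l *: X).
Proof. by apply/matrixP => s j; rewrite !kronI_mulE !mxE mulrA [l * _]mulrC. Qed.

(* No integrability is needed: the two sides also agree on the junk value of the
   integral of a non-integrable function. *)
Lemma intv_kronI01 (s t : R) k (v : 'cV[R]_k) n (F : R -> 'cV[R]_n) :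
  (forall i, v i 0 = 0 \/ v i 0 = 1) ->
  intv s t (fun r => kronI v n *m F r) = kronI v n *m intv s t F.
Proof.
move=> v01; apply/matrixP => i j; rewrite mxE kronI_mulE mxE.
under eq_Rintegral do rewrite kronI_mulE.
have [->|->] := v01 (tagnat.sig1 i).
  by under eq_Rintegral do rewrite mul0r; rewrite Rintegral_cst// !mul0r.
by under eq_Rintegral do rewrite mul1r; rewrite mul1r.
Qed.

Definition vint (s t : R) n (F : R -> 'cV[R]_n) :=
  forall k, mu.-integrable `[s, t] (EFin \o (fun r => F r k 0)).

Lemma intv_kronI (s t : R) k (v : 'cV[R]_k) n (F : R -> 'cV[R]_n) : vint s t F ->
  intv s t (fun r => kronI v n *m F r) = kronI v n *m intv s t F.
Proof.
move=> iF; apply/matrixP => i j; rewrite mxE kronI_mulE mxE -RintegralZl//.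
by apply: eq_Rintegral => r _; rewrite kronI_mulE.
Qed.

Lemma vint_kronI (s t : R) k (v : 'cV[R]_k) n (F : R -> 'cV[R]_n) : vint s t F ->
  vint s t (fun r => kronI v n *m F r).
Proof.
move=> iF i.
have : mu.-integrable `[s, t] (fun r => (v (tagnat.sig1 i) 0)%:E *
    (EFin \o (fun r => F r (tagnat.sig2 i) (0 : 'I_1)%R)) r)%E.
  by apply: integrableZl => //; exact: iF.
by congr (integrable _ _ _); apply/funext => r; rewrite /= kronI_mulE EFinM.
Qed.

Lemma intvD (s t : R) n (F G : R -> 'cV[R]_n) : vint s t F -> vint s t G ->
  intv s t (fun r => F r + G r) = intv s t F + intv s t G.
Proof.
move=> iF iG; apply/matrixP => i j; rewrite !mxE -RintegralD//.
by apply: eq_Rintegral => r _; rewrite mxE.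
Qed.

Lemma vintZ (s t : R) n (l : R -> R) (F : R -> 'cV[R]_n) : continuous l ->
  vint s t F -> vint s t (fun r => l r *: F r).
Proof.
move=> cl iF k; have := integrableMc (iF k) (continuous_subspaceT cl).
by congr (integrable _ _ _); apply/funext => r; rewrite /= !mxE mulrC.
Qed.

Lemma intvE (s t : R) n (F : R -> 'cV[R]_n) k : intv s t F k 0 = \int[mu]_(r in `[s, t]) F r k 0.
Proof. by rewrite mxE. Qed.

Lemma intvZE (s t : R) n (l : R -> R) (F : R -> 'cV[R]_n) k :
  intv s t (fun r => l r *: F r) k 0 = \int[mu]_(r in `[s, t]) (l r * F r k 0).
Proof. by rewrite mxE; apply: eq_Rintegral => r _; rewrite mxE. Qed.

Lemma vecE k (s : seq R) i : vec k s i 0 = s`_i.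
Proof. by rewrite mxE. Qed.

Lemma coordinate_wD (a b c d : R) i j n (u : R * R -> 'cV[R]_n) k :
  coordinate (wD a b c d i j u) k = weak_derivative a b c d i j (coordinate u k).
Proof. by apply/funext => z; rewrite /coordinate mxE. Qed.

Lemma xtrE (a b c d : R) n (u : R * R -> 'cV[R]_n) y k x :
  xtr a b c d u y x k 0 = xtrace a b c d (coordinate u k) y x.
Proof. by rewrite mxE. Qed.

Lemma ytrE (a b c d : R) n (u : R * R -> 'cV[R]_n) y k x :
  ytr a b c d u y x k 0 = ytrace a b c d (coordinate u k) y x.
Proof. by rewrite mxE. Qed.

Lemma ptE (a b c d : R) n (u : R * R -> 'cV[R]_n) x y k :
  pt a b c d u x y k 0 = point_value a b c d (coordinate u k) (x, y).
Proof. by rewrite mxE. Qed.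

(** Reduces an identity between stacked vectors to one scalar identity per block and coordinate. *)
Lemma mxcol_sum_kronI k n (L : 'I_k -> 'cV[R]_n) (r : seq ('cV[R]_k * 'cV[R]_n)) :
  (forall i j, L i j 0 = \sum_(x <- r) x.1 i 0 * x.2 j 0) ->
  \mxcol_(i < k) L i = \sum_(x <- r) kronI x.1 n *m x.2.
Proof.
move=> H; apply/matrixP => i j.
rewrite (ord1 j).
rewrite mxE.
rewrite H.
rewrite summxE.
by apply: eq_bigr => x _; rewrite kronI_mulE.
Qed.

(** The corners are ordered (a,c), (b,c), (a,d), (b,d). Hence (0,1,0,1) marks those with x = b,
    (0,0,1,1) those with y = d, and (0,0,0,1) the one with both. Scalar entries are passed through
    separate equations, so that the corner formulas, stated for scalar functions, fit directly. *)
Lemma mxcol4_mixed n (u00 u10 u01 u11 P Q W : 'cV[R]_n) (a00 a10 a01 a11 p q w : 'I_n -> R) :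
  (forall k, u00 k 0 = a00 k) -> (forall k, u10 k 0 = a10 k) ->
  (forall k, u01 k 0 = a01 k) -> (forall k, u11 k 0 = a11 k) ->
  (forall k, P k 0 = p k) -> (forall k, Q k 0 = q k) -> (forall k, W k 0 = w k) ->
  (forall k, [/\ a10 k = a00 k + p k, a01 k = a00 k + q k & a11 k = a00 k + p k + q k + w k]) ->
  \mxcol_(i < 4) [:: u00; u10; u01; u11]`_i =
  kronI (vec 4 [:: 1; 1; 1; 1]) n *m u00 + kronI (vec 4 [:: 0; 1; 0; 1]) n *m P +
  kronI (vec 4 [:: 0; 0; 1; 1]) n *m Q + kronI (vec 4 [:: 0; 0; 0; 1]) n *m W.
Proof.
move=> h00 h10 h01 h11 hP hQ hW H.
have := @mxcol_sum_kronI 4 n (fun i : 'I_4 => [:: u00; u10; u01; u11]`_i)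
 [:: (vec 4 [:: 1; 1; 1; 1], u00); (vec 4 [:: 0; 1; 0; 1], P);
  (vec 4 [:: 0; 0; 1; 1], Q); (vec 4 [:: 0; 0; 0; 1], W)].
rewrite !big_cons !big_nil /= addr0 !addrA; apply => i j; have [e1 e2 e3] := H j.
rewrite !big_cons !big_nil /= !vecE h00 hP hQ hW.
by case: i => -[|[|[|[|//]]]] ? /=; rewrite ?h00 ?h10 ?h01 ?h11 ?e1 ?e2 ?e3; ring.
Qed.

(** Here [l] = b - a and [m] = d - c. The corner formulas are Taylor expansions with integral
    remainder, and the new vectors are the corner markers times side lengths. *)
Lemma mxcol4_mixed2 n (u00 u10 u01 u11 B C D P P' Q Q' W : 'cV[R]_n)
    (a00 a10 a01 a11 b c d p p' q q' w : 'I_n -> R) (l m : R) :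
  (forall k, u00 k 0 = a00 k) -> (forall k, u10 k 0 = a10 k) ->
  (forall k, u01 k 0 = a01 k) -> (forall k, u11 k 0 = a11 k) ->
  (forall k, B k 0 = b k) -> (forall k, C k 0 = c k) -> (forall k, D k 0 = d k) ->
  (forall k, P k 0 = p k) -> (forall k, P' k 0 = p' k) ->
  (forall k, Q k 0 = q k) -> (forall k, Q' k 0 = q' k) -> (forall k, W k 0 = w k) ->
  (forall k, [/\ a10 k = a00 k + l * b k + p k, a01 k = a00 k + m * c k + q k &
    a11 k = a00 k + l * b k + m * c k + m * l * d k + p k + m * p' k + q k + l * q' k + w k]) ->
  \mxcol_(i < 4) [:: u00; u10; u01; u11]`_i =
  (kronI (vec 4 [:: 1; 1; 1; 1]) n *m u00 + (kronI (vec 4 [:: 0; l; 0; l]) n *m B +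
    (kronI (vec 4 [:: 0; 0; m; m]) n *m C + kronI (vec 4 [:: 0; 0; 0; m * l]) n *m D))) +
  (kronI (vec 4 [:: 0; 1; 0; 1]) n *m P + kronI (vec 4 [:: 0; 0; 0; m]) n *m P') +
  (kronI (vec 4 [:: 0; 0; 1; 1]) n *m Q + kronI (vec 4 [:: 0; 0; 0; l]) n *m Q') +
  kronI (vec 4 [:: 0; 0; 0; 1]) n *m W.
Proof.
move=> h00 h10 h01 h11 hB hC hD hP hP' hQ hQ' hW H.
have := @mxcol_sum_kronI 4 n (fun i : 'I_4 => [:: u00; u10; u01; u11]`_i)
 [:: (vec 4 [:: 1; 1; 1; 1], u00); (vec 4 [:: 0; l; 0; l], B);
  (vec 4 [:: 0; 0; m; m], C); (vec 4 [:: 0; 0; 0; m * l], D);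
  (vec 4 [:: 0; 1; 0; 1], P); (vec 4 [:: 0; 0; 0; m], P');
  (vec 4 [:: 0; 0; 1; 1], Q); (vec 4 [:: 0; 0; 0; l], Q');
  (vec 4 [:: 0; 0; 0; 1], W)].
rewrite !big_cons !big_nil /= addr0 !addrA; apply => i j; have [e1 e2 e3] := H j.
rewrite !big_cons !big_nil /= !vecE h00 hB hC hD hP hP' hQ hQ' hW.
by case: i => -[|[|[|[|//]]]] ? /=; rewrite ?h00 ?h10 ?h01 ?h11 ?e1 ?e2 ?e3; ring.
Qed.

Lemma mxcol4_mixed2_dx n (u00 u10 u01 u11 D P P' Q W : 'cV[R]_n)
    (a00 a10 a01 a11 d p p' q w : 'I_n -> R) (m : R) :
  (forall k, u00 k 0 = a00 k) -> (forall k, u10 k 0 = a10 k) ->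
  (forall k, u01 k 0 = a01 k) -> (forall k, u11 k 0 = a11 k) ->
  (forall k, D k 0 = d k) -> (forall k, P k 0 = p k) -> (forall k, P' k 0 = p' k) ->
  (forall k, Q k 0 = q k) -> (forall k, W k 0 = w k) ->
  (forall k, [/\ a10 k = a00 k + p k, a01 k = a00 k + m * d k + q k &
    a11 k = a00 k + m * d k + p k + m * p' k + q k + w k]) ->
  \mxcol_(i < 4) [:: u00; u10; u01; u11]`_i =
  (kronI (vec 4 [:: 1; 1; 1; 1]) n *m u00 + kronI (vec 4 [:: 0; 0; m; m]) n *m D) +
  (kronI (vec 4 [:: 0; 1; 0; 1]) n *m P + kronI (vec 4 [:: 0; 0; 0; m]) n *m P') +
  kronI (vec 4 [:: 0; 0; 1; 1]) n *m Q + kronI (vec 4 [:: 0; 0; 0; 1]) n *m W.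
Proof.
move=> h00 h10 h01 h11 hD hP hP' hQ hW H.
have := @mxcol_sum_kronI 4 n (fun i : 'I_4 => [:: u00; u10; u01; u11]`_i)
 [:: (vec 4 [:: 1; 1; 1; 1], u00); (vec 4 [:: 0; 0; m; m], D);
  (vec 4 [:: 0; 1; 0; 1], P); (vec 4 [:: 0; 0; 0; m], P');
  (vec 4 [:: 0; 0; 1; 1], Q); (vec 4 [:: 0; 0; 0; 1], W)].
rewrite !big_cons !big_nil /= addr0 !addrA; apply => i j; have [e1 e2 e3] := H j.
rewrite !big_cons !big_nil /= !vecE h00 hD hP hP' hQ hW.
by case: i => -[|[|[|[|//]]]] ? /=; rewrite ?h00 ?h10 ?h01 ?h11 ?e1 ?e2 ?e3; ring.
Qed.

Lemma mxcol4_mixed2_dy n (u00 u10 u01 u11 D P Q Q' W : 'cV[R]_n)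
    (a00 a10 a01 a11 d p q q' w : 'I_n -> R) (l : R) :
  (forall k, u00 k 0 = a00 k) -> (forall k, u10 k 0 = a10 k) ->
  (forall k, u01 k 0 = a01 k) -> (forall k, u11 k 0 = a11 k) ->
  (forall k, D k 0 = d k) -> (forall k, P k 0 = p k) -> (forall k, Q k 0 = q k) ->
  (forall k, Q' k 0 = q' k) -> (forall k, W k 0 = w k) ->
  (forall k, [/\ a10 k = a00 k + l * d k + p k, a01 k = a00 k + q k &
    a11 k = a00 k + l * d k + p k + q k + l * q' k + w k]) ->
  \mxcol_(i < 4) [:: u00; u10; u01; u11]`_i =
  (kronI (vec 4 [:: 1; 1; 1; 1]) n *m u00 + kronI (vec 4 [:: 0; l; 0; l]) n *m D) +
  kronI (vec 4 [:: 0; 1; 0; 1]) n *m P +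
  (kronI (vec 4 [:: 0; 0; 1; 1]) n *m Q + kronI (vec 4 [:: 0; 0; 0; l]) n *m Q') +
  kronI (vec 4 [:: 0; 0; 0; 1]) n *m W.
Proof.
move=> h00 h10 h01 h11 hD hP hQ hQ' hW H.
have := @mxcol_sum_kronI 4 n (fun i : 'I_4 => [:: u00; u10; u01; u11]`_i)
 [:: (vec 4 [:: 1; 1; 1; 1], u00); (vec 4 [:: 0; l; 0; l], D);
  (vec 4 [:: 0; 1; 0; 1], P); (vec 4 [:: 0; 0; 1; 1], Q); (vec 4 [:: 0; 0; 0; l], Q');
  (vec 4 [:: 0; 0; 0; 1], W)].
rewrite !big_cons !big_nil /= addr0 !addrA; apply => i j; have [e1 e2 e3] := H j.
rewrite !big_cons !big_nil /= !vecE h00 hD hP hQ hQ' hW.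
by case: i => -[|[|[|[|//]]]] ? /=; rewrite ?h00 ?h10 ?h01 ?h11 ?e1 ?e2 ?e3; ring.
Qed.

Lemma mxcol2_mixed n (u0 u1 W : 'cV[R]_n) (a0 a1 w : 'I_n -> R) :
  (forall k, u0 k 0 = a0 k) -> (forall k, u1 k 0 = a1 k) -> (forall k, W k 0 = w k) ->
  (forall k, a1 k = a0 k + w k) ->
  \mxcol_(i < 2) [:: u0; u1]`_i =
  kronI (vec 2 [:: 1; 1]) n *m u0 + kronI (vec 2 [:: 0; 1]) n *m W.
Proof.
move=> h0 h1 hW H.
have := @mxcol_sum_kronI 2 n (fun i : 'I_2 => [:: u0; u1]`_i)
 [:: (vec 2 [:: 1; 1], u0); (vec 2 [:: 0; 1], W)].
rewrite !big_cons !big_nil /= addr0; apply => i j.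
rewrite !big_cons !big_nil /= !vecE h0 hW.
by case: i => -[|[|//]] ? /=; rewrite ?h0 ?h1 ?H; ring.
Qed.

Lemma mxcol2_mixed2 n (u0 u1 P W : 'cV[R]_n) (a0 a1 p w : 'I_n -> R) (m : R) :
  (forall k, u0 k 0 = a0 k) -> (forall k, u1 k 0 = a1 k) -> (forall k, P k 0 = p k) ->
  (forall k, W k 0 = w k) -> (forall k, a1 k = a0 k + m * p k + w k) ->
  \mxcol_(i < 2) [:: u0; u1]`_i =
  (kronI (vec 2 [:: 1; 1]) n *m u0 + kronI (m *: vec 2 [:: 0; 1]) n *m P) +
  kronI (vec 2 [:: 0; 1]) n *m W.
Proof.
move=> h0 h1 hP hW H; rewrite kronIZ_mul.
have := @mxcol_sum_kronI 2 n (fun i : 'I_2 => [:: u0; u1]`_i)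
 [:: (vec 2 [:: 1; 1], u0); (vec 2 [:: 0; 1], m *: P); (vec 2 [:: 0; 1], W)].
rewrite !big_cons !big_nil /= addr0 addrA; apply => i j.
rewrite !big_cons !big_nil /= !vecE h0 hW [(m *: P) _ _]mxE hP.
by case: i => -[|[|//]] ? /=; rewrite ?h0 ?h1 ?H; ring.
Qed.

End blocks.

(** * Block rows of the boundary operators *)

Section assembly.
Context {R : realType} (a b c d : R).
Hypotheses (ab : a < b) (cd : c < d).
Local Notation mu := (@lebesgue_measure R).
Local Notation pt := (pt a b c d).
Local Notation xtr := (xtr a b c d).
Local Notation ytr := (ytr a b c d).

Lemma intv_xtrE n (q : R * R -> 'cV[R]_n) k :
  intv a b (xtr q c) k 0 = \int[mu]_(x in `[a, b]) xtrace a b c d (coordinate q k) c x.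
Proof. by rewrite intvE; apply: eq_Rintegral => x _; rewrite xtrE. Qed.

Lemma intv_ytrE n (q : R * R -> 'cV[R]_n) k :
  intv c d (ytr q a) k 0 = \int[mu]_(y in `[c, d]) ytrace a b c d (coordinate q k) a y.
Proof. by rewrite intvE; apply: eq_Rintegral => x _; rewrite ytrE. Qed.

Lemma intvZ_xtrE l n (q : R * R -> 'cV[R]_n) k :
  intv a b (fun x => l x *: xtr q c x) k 0 =
  \int[mu]_(x in `[a, b]) (l x * xtrace a b c d (coordinate q k) c x).
Proof. by rewrite intvZE; apply: eq_Rintegral => x _; rewrite xtrE. Qed.

Lemma intvZ_ytrE l n (q : R * R -> 'cV[R]_n) k :
  intv c d (fun y => l y *: ytr q a y) k 0 =
  \int[mu]_(y in `[c, d]) (l y * ytrace a b c d (coordinate q k) a y).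
Proof. by rewrite intvZE; apply: eq_Rintegral => x _; rewrite ytrE. Qed.

Lemma intv2E n (q : R * R -> 'cV[R]_n) k :
  intv a b (fun x => intv c d (fun y => q (x, y))) k 0 =
  \int[mu]_(x in `[a, b]) \int[mu]_(y in `[c, d]) coordinate q k (x, y).
Proof. by rewrite intvE; apply: eq_Rintegral => x _; rewrite intvE. Qed.

Lemma intv2ZE (l : R -> R -> R) n (q : R * R -> 'cV[R]_n) k :
  intv a b (fun x => intv c d (fun y => l x y *: q (x, y))) k 0 =
  \int[mu]_(x in `[a, b]) \int[mu]_(y in `[c, d]) (l x y * coordinate q k (x, y)).
Proof. by rewrite intvE; apply: eq_Rintegral => x _; rewrite intvZE. Qed.

Definition mixedv n (u p q D : R * R -> 'cV[R]_n) := forall k,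
  mixed a b c d (coordinate u k) (coordinate p k) (coordinate q k) (coordinate D k).

Lemma vint_xtr n (u p q D : R * R -> 'cV[R]_n) : mixedv u p q D -> vint a b (xtr p c).
Proof.
move=> M k; have [LP _ _] := mixed_repr ab cd (M k); have := L2_integrable LP.
by congr (integrable _ _ _); apply/funext => x; rewrite /= xtrE.
Qed.

Lemma vint_ytr n (u p q D : R * R -> 'cV[R]_n) : mixedv u p q D -> vint c d (ytr q a).
Proof.
move=> M k; have [_ LQ _] := mixed_repr ab cd (M k); have := L2_integrable LQ.
by congr (integrable _ _ _); apply/funext => x; rewrite /= ytrE.
Qed.

(** Serves the first and the last block row: [u1], and the mixed derivative u_xy of [u2], each have
    one more derivative available in each variable. *)
Lemma Lambda1_mixed n (u p q D : R * R -> 'cV[R]_n) : mixedv u p q D ->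
  Lambda1 a b c d u =
  kronI (vec 4 [:: 1; 1; 1; 1]) n *m pt u a c +
  kronI (vec 4 [:: 0; 1; 0; 1]) n *m intv a b (xtr p c) +
  kronI (vec 4 [:: 0; 0; 1; 1]) n *m intv c d (ytr q a) +
  kronI (vec 4 [:: 0; 0; 0; 1]) n *m intv a b (fun x => intv c d (fun y => D (x, y))).
Proof.
move=> M.
apply: (mxcol4_mixed (fun k => ptE _ _ _ _ u a c k) (fun k => ptE _ _ _ _ u b c k)
  (fun k => ptE _ _ _ _ u a d k) (fun k => ptE _ _ _ _ u b d k)
  (fun k => intv_xtrE p k) (fun k => intv_ytrE q k) (fun k => intv2E D k)) => k.
by have [e1 e2 e3 _ _] := mixed_corners ab cd (M k); split.
Qed.

Lemma Lambda1_mixed2 n (u p q r pp s qq t D : R * R -> 'cV[R]_n) :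
  mixedv u p q r -> mixedv p pp r s -> mixedv q r qq t -> mixedv r s t D ->
  Lambda1 a b c d u =
  (kronI (vec 4 [:: 1; 1; 1; 1]) n *m pt u a c +
    (kronI (vec 4 [:: 0; b - a; 0; b - a]) n *m pt p a c +
    (kronI (vec 4 [:: 0; 0; d - c; d - c]) n *m pt q a c +
    kronI (vec 4 [:: 0; 0; 0; (d - c) * (b - a)]) n *m pt r a c))) +
  (kronI (vec 4 [:: 0; 1; 0; 1]) n *m intv a b (fun x => (b - x) *: xtr pp c x) +
   kronI (vec 4 [:: 0; 0; 0; d - c]) n *m intv a b (fun x => (b - x) *: xtr s c x)) +
  (kronI (vec 4 [:: 0; 0; 1; 1]) n *m intv c d (fun y => (d - y) *: ytr qq a y) +
   kronI (vec 4 [:: 0; 0; 0; b - a]) n *m intv c d (fun y => (d - y) *: ytr t a y)) +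
  kronI (vec 4 [:: 0; 0; 0; 1]) n *m
    intv a b (fun x => intv c d (fun y => ((d - y) * (b - x)) *: D (x, y))).
Proof.
move=> M0 Mx My Mxy.
apply: (mxcol4_mixed2 (fun k => ptE _ _ _ _ u a c k) (fun k => ptE _ _ _ _ u b c k)
  (fun k => ptE _ _ _ _ u a d k) (fun k => ptE _ _ _ _ u b d k)
  (fun k => ptE _ _ _ _ p a c k) (fun k => ptE _ _ _ _ q a c k)
  (fun k => ptE _ _ _ _ r a c k)
  (fun k => intvZ_xtrE _ pp k) (fun k => intvZ_xtrE _ s k)
  (fun k => intvZ_ytrE _ qq k) (fun k => intvZ_ytrE _ t k)
  (fun k => intv2ZE (fun x y => (d - y) * (b - x)) D k)) => k.
exact: (mixed2_corners ab cd (M0 k) (Mx k) (My k) (Mxy k)).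
Qed.

Lemma Lambda1_mixed2_dx n (p r pp s t D : R * R -> 'cV[R]_n) :
  mixedv p pp r s -> mixedv r s t D ->
  Lambda1 a b c d p =
  (kronI (vec 4 [:: 1; 1; 1; 1]) n *m pt p a c +
    kronI (vec 4 [:: 0; 0; d - c; d - c]) n *m pt r a c) +
  (kronI (vec 4 [:: 0; 1; 0; 1]) n *m intv a b (xtr pp c) +
   kronI (vec 4 [:: 0; 0; 0; d - c]) n *m intv a b (xtr s c)) +
  kronI (vec 4 [:: 0; 0; 1; 1]) n *m intv c d (fun y => (d - y) *: ytr t a y) +
  kronI (vec 4 [:: 0; 0; 0; 1]) n *m
    intv a b (fun x => intv c d (fun y => (d - y) *: D (x, y))).
Proof.
move=> Mx Mxy.
apply: (mxcol4_mixed2_dx (fun k => ptE _ _ _ _ p a c k) (fun k => ptE _ _ _ _ p b c k)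
  (fun k => ptE _ _ _ _ p a d k) (fun k => ptE _ _ _ _ p b d k)
  (fun k => ptE _ _ _ _ r a c k)
  (fun k => intv_xtrE pp k) (fun k => intv_xtrE s k)
  (fun k => intvZ_ytrE _ t k)
  (fun k => intv2ZE (fun x y => (d - y)) D k)) => k.
exact: (mixed2_corners_dx ab cd (Mx k) (Mxy k)).
Qed.

Lemma Lambda1_mixed2_dy n (q r qq s t D : R * R -> 'cV[R]_n) :
  mixedv q r qq t -> mixedv r s t D ->
  Lambda1 a b c d q =
  (kronI (vec 4 [:: 1; 1; 1; 1]) n *m pt q a c +
    kronI (vec 4 [:: 0; b - a; 0; b - a]) n *m pt r a c) +
  kronI (vec 4 [:: 0; 1; 0; 1]) n *m intv a b (fun x => (b - x) *: xtr s c x) +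
  (kronI (vec 4 [:: 0; 0; 1; 1]) n *m intv c d (ytr qq a) +
   kronI (vec 4 [:: 0; 0; 0; b - a]) n *m intv c d (ytr t a)) +
  kronI (vec 4 [:: 0; 0; 0; 1]) n *m
    intv a b (fun x => intv c d (fun y => (b - x) *: D (x, y))).
Proof.
move=> My Mxy.
apply: (mxcol4_mixed2_dy (fun k => ptE _ _ _ _ q a c k) (fun k => ptE _ _ _ _ q b c k)
  (fun k => ptE _ _ _ _ q a d k) (fun k => ptE _ _ _ _ q b d k)
  (fun k => ptE _ _ _ _ r a c k)
  (fun k => intvZ_xtrE _ s k)
  (fun k => intv_ytrE qq k) (fun k => intv_ytrE t k)
  (fun k => intv2ZE (fun x y => (b - x)) D k)) => k.
exact: (mixed2_corners_dy ab cd (My k) (Mxy k)).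
Qed.

Lemma Lambda2_mixed n (u p q D : R * R -> 'cV[R]_n) : mixedv u p q D ->
  {ae mu, forall x, x \in `[a, b] -> Lambda2 a b c d p x =
    kronI (vec 2 [:: 1; 1]) n *m xtr p c x +
    kronI (vec 2 [:: 0; 1]) n *m intv c d (fun y => D (x, y))}.
Proof.
move=> M.
have E k : {ae mu, forall x, x \in `[a, b] -> xtrace a b c d (coordinate p k) d x =
    xtrace a b c d (coordinate p k) c x + \int[mu]_(y in `[c, d]) coordinate D k (x, y)}.
  by have [[_ Lp _ LD] [_ _ pD _]] := M k; have [] := xtrace_repr ab cd Lp LD pD.
(* There are finitely many coordinates, so their exceptional sets merge into one null set. *)
have {}E := filter_forall (@ae_lebesgue_filter R) E; apply: filterS E => x H xab.
apply: (mxcol2_mixed (fun k => xtrE _ _ _ _ p c k x) (fun k => xtrE _ _ _ _ p d k x)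
  (fun k => intvE c d (fun y => D (x, y)) k)) => k.
exact: H.
Qed.

Lemma Lambda3_mixed n (u p q D : R * R -> 'cV[R]_n) : mixedv u p q D ->
  {ae mu, forall y, y \in `[c, d] -> Lambda3 a b c d q y =
    kronI (vec 2 [:: 1; 1]) n *m ytr q a y +
    kronI (vec 2 [:: 0; 1]) n *m intv a b (fun x => D (x, y))}.
Proof.
move=> M.
have E k : {ae mu, forall y, y \in `[c, d] -> ytrace a b c d (coordinate q k) b y =
    ytrace a b c d (coordinate q k) a y + \int[mu]_(x in `[a, b]) coordinate D k (x, y)}.
  by have [[_ _ Lq LD] [_ _ _ qD]] := M k; have [] := ytrace_repr ab cd Lq LD qD.
have {}E := filter_forall (@ae_lebesgue_filter R) E; apply: filterS E => y H ycd.
apply: (mxcol2_mixed (fun k => ytrE _ _ _ _ q a k y) (fun k => ytrE _ _ _ _ q b k y)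
  (fun k => intvE a b (fun x => D (x, y)) k)) => k.
exact: H.
Qed.

Lemma Lambda2_mixed2 n (p r pp s t D : R * R -> 'cV[R]_n) :
  mixedv p pp r s -> mixedv r s t D ->
  {ae mu, forall x, x \in `[a, b] -> Lambda2 a b c d pp x =
    (kronI (vec 2 [:: 1; 1]) n *m xtr pp c x +
     kronI ((d - c) *: vec 2 [:: 0; 1]) n *m xtr s c x) +
    kronI (vec 2 [:: 0; 1]) n *m intv c d (fun y => (d - y) *: D (x, y))}.
Proof.
move=> Mx Mxy.
have E k : {ae mu, forall x, x \in `[a, b] -> xtrace a b c d (coordinate pp k) d x =
    xtrace a b c d (coordinate pp k) c x + (d - c) * xtrace a b c d (coordinate s k) c x +
    \int[mu]_(y in `[c, d]) ((d - y) * coordinate D k (x, y))}.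
  have [[_ Lpp _ Ls] [_ _ pps _]] := Mx k; have [[_ _ _ LD] [_ _ sD _]] := Mxy k.
  exact: xtrace_end2.
have {}E := filter_forall (@ae_lebesgue_filter R) E; apply: filterS E => x H xab.
apply: (mxcol2_mixed2 (fun k => xtrE _ _ _ _ pp c k x) (fun k => xtrE _ _ _ _ pp d k x)
  (fun k => xtrE _ _ _ _ s c k x)
  (fun k => intvZE c d _ (fun y => D (x, y)) k)) => k.
exact: H.
Qed.

Lemma Lambda3_mixed2 n (q r qq s t D : R * R -> 'cV[R]_n) :
  mixedv q r qq t -> mixedv r s t D ->
  {ae mu, forall y, y \in `[c, d] -> Lambda3 a b c d qq y =
    (kronI (vec 2 [:: 1; 1]) n *m ytr qq a y +
     kronI ((b - a) *: vec 2 [:: 0; 1]) n *m ytr t a y) +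
    kronI (vec 2 [:: 0; 1]) n *m intv a b (fun x => (b - x) *: D (x, y))}.
Proof.
move=> My Mxy.
have E k : {ae mu, forall y, y \in `[c, d] -> ytrace a b c d (coordinate qq k) b y =
    ytrace a b c d (coordinate qq k) a y + (b - a) * ytrace a b c d (coordinate t k) a y +
    \int[mu]_(x in `[a, b]) ((b - x) * coordinate D k (x, y))}.
  have [[_ _ Lqq Lt] [_ _ _ qqt]] := My k; have [[_ _ _ LD] [_ _ _ tD]] := Mxy k.
  exact: ytrace_end2.
have {}E := filter_forall (@ae_lebesgue_filter R) E; apply: filterS E => y H ycd.
apply: (mxcol2_mixed2 (fun k => ytrE _ _ _ _ qq a k y) (fun k => ytrE _ _ _ _ qq b k y)
  (fun k => ytrE _ _ _ _ t a k y)
  (fun k => intvZE a b _ (fun x => D (x, y)) k)) => k.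
exact: H.
Qed.

End assembly.

(** * Integrals of the products with the block matrices *)

Section products.
Context {R : realType} (n0 n1 n2 : nat).

Lemma intv_col3 (s t : R) m1 m2 m3 (F1 : R -> 'cV[R]_m1) (F2 : R -> 'cV[R]_m2)
    (F3 : R -> 'cV[R]_m3) :
  intv s t (fun r => col3 (F1 r) (F2 r) (F3 r)) =
  col3 (intv s t F1) (intv s t F2) (intv s t F3).
Proof. by rewrite /col3 !intv_col_mx. Qed.

Lemma intv_col5 (s t : R) m1 m2 m3 m4 m5 (F1 : R -> 'cV[R]_m1) (F2 : R -> 'cV[R]_m2)
    (F3 : R -> 'cV[R]_m3) (F4 : R -> 'cV[R]_m4) (F5 : R -> 'cV[R]_m5) :
  intv s t (fun r => col5 (F1 r) (F2 r) (F3 r) (F4 r) (F5 r)) =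
  col5 (intv s t F1) (intv s t F2) (intv s t F3) (intv s t F4) (intv s t F5).
Proof. by rewrite /col5 !intv_col_mx. Qed.

Lemma eq_col3 p m1 m2 m3 (A1 B1 : 'M[R]_(m1, p)) (A2 B2 : 'M[R]_(m2, p))
    (A3 B3 : 'M[R]_(m3, p)) :
  A1 = B1 -> A2 = B2 -> A3 = B3 -> col3 A1 A2 A3 = col3 B1 B2 B3.
Proof. by move=> -> -> ->. Qed.

Lemma eq_col5 p m1 m2 m3 m4 m5 (A1 B1 : 'M[R]_(m1, p)) (A2 B2 : 'M[R]_(m2, p))
    (A3 B3 : 'M[R]_(m3, p)) (A4 B4 : 'M[R]_(m4, p)) (A5 B5 : 'M[R]_(m5, p)) :
  A1 = B1 -> A2 = B2 -> A3 = B3 -> A4 = B4 -> A5 = B5 ->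
  col5 A1 A2 A3 A4 A5 = col5 B1 B2 B3 B4 B5.
Proof. by move=> -> -> -> -> ->. Qed.

Lemma eq_intv (s t : R) n (F G : R -> 'cV[R]_n) : F =1 G -> intv s t F = intv s t G.
Proof. by move=> /funext ->. Qed.

(** The scalar weight is moved from the matrix onto the data, where the corner formulas have it. *)
Lemma intv_kronIZ (s t : R) k (v : 'cV[R]_k) n (l : R -> R) (F : R -> 'cV[R]_n) :
  continuous l -> vint s t F ->
  intv s t (fun r => kronI (l r *: v) n *m F r) =
  kronI v n *m intv s t (fun r => l r *: F r).
Proof.
move=> cl iF; rewrite -intv_kronI; last exact: vintZ.
by apply: eq_intv => r; rewrite kronIZ_mul.
Qed.

Lemma intv_kronID (s t : R) k (v w : 'cV[R]_k) n (F G : R -> 'cV[R]_n) :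
  vint s t F -> vint s t G ->
  intv s t (fun r => kronI v n *m F r + kronI w n *m G r) =
  kronI v n *m intv s t F + kronI w n *m intv s t G.
Proof.
by move=> iF iG; rewrite intvD ?intv_kronI//; exact: vint_kronI.
Qed.

Lemma intv_kronIZD (s t : R) k (v w : 'cV[R]_k) n (l : R -> R) (F G : R -> 'cV[R]_n) :
  continuous l -> vint s t F -> vint s t G ->
  intv s t (fun r => kronI (l r *: v) n *m F r + kronI (l r *: w) n *m G r) =
  kronI v n *m intv s t (fun r => l r *: F r) + kronI w n *m intv s t (fun r => l r *: G r).
Proof.
move=> cl iF iG; rewrite -intv_kronID; [|exact: vintZ|exact: vintZ].
by apply: eq_intv => r; rewrite !kronIZ_mul.
Qed.

Let cB (l : R) : continuous (fun r : R => l - r).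
Proof. by move=> x; apply: cvgB; [exact: cvg_cst|exact: cvg_id]. Qed.

Lemma H00_mul (a b c d : R) (X1 : 'cV[R]_n1) (X2 X3 X4 X5 : 'cV[R]_n2) :
  H00 a b c d n1 n2 *m col5 X1 X2 X3 X4 X5 =
  col5 (kronI (vec 4 [:: 1; 1; 1; 1]) _ *m X1)
    (kronI (vec 4 [:: 1; 1; 1; 1]) _ *m X2 +
      (kronI (vec 4 [:: 0; b - a; 0; b - a]) _ *m X3 +
      (kronI (vec 4 [:: 0; 0; d - c; d - c]) _ *m X4 +
       kronI (vec 4 [:: 0; 0; 0; (d - c) * (b - a)]) _ *m X5)))
    (kronI (vec 4 [:: 1; 1; 1; 1]) _ *m X3 +
      kronI (vec 4 [:: 0; 0; d - c; d - c]) _ *m X5)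
    (kronI (vec 4 [:: 1; 1; 1; 1]) _ *m X4 +
      kronI (vec 4 [:: 0; b - a; 0; b - a]) _ *m X5)
    (kronI (vec 4 [:: 1; 1; 1; 1]) _ *m X5).
Proof. by rewrite mul_col5 !mul_row5_col5 !mul0mx !(add0r, addr0). Qed.

Lemma intv_H01 (a b c d : R) (F1 : R -> 'cV[R]_n1) (F2 F3 : R -> 'cV[R]_n2) :
  vint a b F1 -> vint a b F2 -> vint a b F3 ->
  intv a b (fun x => H01 b c d n1 n2 x *m col3 (F1 x) (F2 x) (F3 x)) =
  col5 (kronI (vec 4 [:: 0; 1; 0; 1]) _ *m intv a b F1)
    (kronI (vec 4 [:: 0; 1; 0; 1]) _ *m intv a b (fun x => (b - x) *: F2 x) +
     kronI (vec 4 [:: 0; 0; 0; d - c]) _ *m intv a b (fun x => (b - x) *: F3 x))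
    (kronI (vec 4 [:: 0; 1; 0; 1]) _ *m intv a b F2 +
     kronI (vec 4 [:: 0; 0; 0; d - c]) _ *m intv a b F3)
    (kronI (vec 4 [:: 0; 1; 0; 1]) _ *m intv a b (fun x => (b - x) *: F3 x))
    (kronI (vec 4 [:: 0; 1; 0; 1]) _ *m intv a b F3).
Proof.
move=> i1 i2 i3.
under eq_intv do rewrite mul_col5 !mul_row3_col3 !mul0mx !(add0r, addr0).
by rewrite intv_col5 intv_kronI// intv_kronIZD// intv_kronID// intv_kronIZ// intv_kronI.
Qed.

Lemma intv_H02 (a b c d : R) (F1 : R -> 'cV[R]_n1) (F2 F3 : R -> 'cV[R]_n2) :
  vint c d F1 -> vint c d F2 -> vint c d F3 ->
  intv c d (fun y => H02 a b d n1 n2 y *m col3 (F1 y) (F2 y) (F3 y)) =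
  col5 (kronI (vec 4 [:: 0; 0; 1; 1]) _ *m intv c d F1)
    (kronI (vec 4 [:: 0; 0; 1; 1]) _ *m intv c d (fun y => (d - y) *: F2 y) +
     kronI (vec 4 [:: 0; 0; 0; b - a]) _ *m intv c d (fun y => (d - y) *: F3 y))
    (kronI (vec 4 [:: 0; 0; 1; 1]) _ *m intv c d (fun y => (d - y) *: F3 y))
    (kronI (vec 4 [:: 0; 0; 1; 1]) _ *m intv c d F2 +
     kronI (vec 4 [:: 0; 0; 0; b - a]) _ *m intv c d F3)
    (kronI (vec 4 [:: 0; 0; 1; 1]) _ *m intv c d F3).
Proof.
move=> i1 i2 i3.
under eq_intv do rewrite mul_col5 !mul_row3_col3 !mul0mx !(add0r, addr0).
by rewrite intv_col5 intv_kronI// intv_kronIZD// intv_kronIZ// intv_kronID// intv_kronI.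
Qed.

Lemma vec4_01 i : (vec 4 [:: 0; 0; 0; 1] : 'cV[R]_4) i 0 = 0 \/
  (vec 4 [:: 0; 0; 0; 1] : 'cV[R]_4) i 0 = 1.
Proof. by rewrite vecE; case: i => -[|[|[|[|//]]]] ? /=; [left|left|left|right]. Qed.

Lemma vec2_01 i : (vec 2 [:: 0; 1] : 'cV[R]_2) i 0 = 0 \/ (vec 2 [:: 0; 1] : 'cV[R]_2) i 0 = 1.
Proof. by rewrite vecE; case: i => -[|[|//]] ? /=; [left|right]. Qed.

Lemma intv_kronI01Z (s t : R) k (v : 'cV[R]_k) n (l : R -> R) (F : R -> 'cV[R]_n) :
  (forall i, v i 0 = 0 \/ v i 0 = 1) ->
  intv s t (fun r => kronI (l r *: v) n *m F r) =
  kronI v n *m intv s t (fun r => l r *: F r).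
Proof.
move=> v01; rewrite -intv_kronI01//.
by apply: eq_intv => r; rewrite kronIZ_mul.
Qed.

(** Up to a scalar weight only the vector [h] occurs, with entries 0 and 1. By [intv_kronI01] it
    leaves the inner integral at every [x], also where the section is not integrable. *)
Lemma intv_H03 (a b c d : R) (D0 : R * R -> 'cV[R]_n0) (D1 : R * R -> 'cV[R]_n1)
    (D2 : R * R -> 'cV[R]_n2) :
  intv a b (fun x => intv c d (fun y =>
    H03 b d n0 n1 n2 x y *m col3 (D0 (x, y)) (D1 (x, y)) (D2 (x, y)))) =
  col5 (kronI (vec 4 [:: 0; 0; 0; 1]) _ *m
      intv a b (fun x => intv c d (fun y => D1 (x, y))))
    (kronI (vec 4 [:: 0; 0; 0; 1]) _ *m
      intv a b (fun x => intv c d (fun y => ((d - y) * (b - x)) *: D2 (x, y))))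
    (kronI (vec 4 [:: 0; 0; 0; 1]) _ *m
      intv a b (fun x => intv c d (fun y => (d - y) *: D2 (x, y))))
    (kronI (vec 4 [:: 0; 0; 0; 1]) _ *m
      intv a b (fun x => intv c d (fun y => (b - x) *: D2 (x, y))))
    (kronI (vec 4 [:: 0; 0; 0; 1]) _ *m
      intv a b (fun x => intv c d (fun y => D2 (x, y)))).
Proof.
have h01 := vec4_01.
under eq_intv => x.
  under eq_intv do rewrite mul_col5 !mul_row3_col3 !mul0mx !(add0r, addr0).
  rewrite intv_col5 intv_kronI01// (intv_kronI01Z c d (fun y => (d - y) * (b - x)))//.
  rewrite intv_kronI01Z// (intv_kronI01Z c d (fun y => b - x))// intv_kronI01//.
  over.
by rewrite intv_col5 !intv_kronI01.
Qed.

Lemma H11_mul (c d : R) (X1 : 'cV[R]_n1) (X2 X3 : 'cV[R]_n2) :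
  H11 c d n1 n2 *m col3 X1 X2 X3 =
  col3 (kronI (vec 2 [:: 1; 1]) _ *m X1)
    (kronI (vec 2 [:: 1; 1]) _ *m X2 + kronI ((d - c) *: vec 2 [:: 0; 1]) _ *m X3)
    (kronI (vec 2 [:: 1; 1]) _ *m X3).
Proof. by rewrite mul_col3 !mul_row3_col3 !mul0mx !(add0r, addr0). Qed.

Lemma intv_H13 (c d : R) (D0 : R -> 'cV[R]_n0) (D1 : R -> 'cV[R]_n1) (D2 : R -> 'cV[R]_n2) :
  intv c d (fun y => H13 d n0 n1 n2 y *m col3 (D0 y) (D1 y) (D2 y)) =
  col3 (kronI (vec 2 [:: 0; 1]) _ *m intv c d D1)
    (kronI (vec 2 [:: 0; 1]) _ *m intv c d (fun y => (d - y) *: D2 y))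
    (kronI (vec 2 [:: 0; 1]) _ *m intv c d D2).
Proof.
have t01 := vec2_01.
under eq_intv do rewrite mul_col3 !mul_row3_col3 !mul0mx !(add0r, addr0).
by rewrite intv_col3 intv_kronI01// intv_kronI01Z// intv_kronI01.
Qed.

End products.

(** [uhat] ranges over all representatives of the L^2 class of [Dop]. The corner component is a
    vector and is compared exactly, the two side components almost everywhere. *)
Theorem corollary11 (R : realType) (a b c d : R) (n0 n1 n2 : nat)
    (u0 : R * R -> 'cV[R]_n0) (u1 : R * R -> 'cV[R]_n1)
    (u2 : R * R -> 'cV[R]_n2) (uhat : R * R -> 'cV[R]_(n0 + (n1 + n2))) :
  a < b -> c < d ->
  L2v a b c d u0 -> sobolevv a b c d 1 u1 -> sobolevv a b c d 2 u2 ->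
  L2v a b c d uhat ->
  ae_eq leb2 (rect a b c d) uhat (Dop a b c d (u0, u1, u2)) ->
  bf_eq a b c d
    (Lambda_bf a b c d (u0, u1, u2))
    (bf_add (calH1 a b c d (Lambda_bc a b c d (u0, u1, u2))) (calH2 a b c d uhat)).
Proof.
move=> ab cd _ su1 su2 Lu uE.
(* The blocks of [uhat]: [h1] and [h2] play the part of [D] for [u1] and for the mixed derivative of
   [u2]. *)
pose h0 z := usubmx (uhat z); pose h1 z := usubmx (dsubmx (uhat z)).
pose h2 z := dsubmx (dsubmx (uhat z)).
have hE : uhat = fun z => col3 (h0 z) (h1 z) (h2 z).
  by apply/funext => z; exact: col3_submx.
have M1 : mixedv a b c d u1 (wD a b c d 1 0 u1) (wD a b c d 0 1 u1) h1.
  move=> k; have L1 : L2_rect a b c d (coordinate h1 k).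
    have := Lu (rshift n0 (lshift n2 k)); congr (L2_rect _ _ _ _ _).
    by apply/funext => z; rewrite /coordinate /h1 !mxE.
  have h1E : ae_eq leb2 (rect a b c d) (coordinate h1 k)
      (weak_derivative a b c d 1 1 (coordinate u1 k)).
    apply: filterS uE => z H /H; rewrite /coordinate /h1 => ->.
    by rewrite /Dop /col3 col_mxKd col_mxKu mxE.
  by have := sobolev1_mixed (su1 k) L1 h1E; rewrite -!coordinate_wD.
have L2h2 : L2v a b c d h2.
  move=> k; have := Lu (rshift n0 (rshift n1 k)); congr (L2_rect _ _ _ _ _).
  by apply/funext => z; rewrite /coordinate /h2 !mxE.
have h2E k : ae_eq leb2 (rect a b c d) (coordinate h2 k)
    (weak_derivative a b c d 2 2 (coordinate u2 k)).
  apply: filterS uE => z H /H; rewrite /coordinate /h2 => ->.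
  by rewrite /Dop /col3 !col_mxKd mxE.
have M2 k := sobolev2_mixed (su2 k) (L2h2 k) (h2E k).
have M20 : mixedv a b c d u2 (wD a b c d 1 0 u2) (wD a b c d 0 1 u2) (wD a b c d 1 1 u2).
  by move=> k; have [] := M2 k; rewrite -!coordinate_wD.
have M2x : mixedv a b c d (wD a b c d 1 0 u2) (wD a b c d 2 0 u2) (wD a b c d 1 1 u2)
    (wD a b c d 2 1 u2).
  by move=> k; have [] := M2 k; rewrite -!coordinate_wD.
have M2y : mixedv a b c d (wD a b c d 0 1 u2) (wD a b c d 1 1 u2) (wD a b c d 0 2 u2)
    (wD a b c d 1 2 u2).
  by move=> k; have [] := M2 k; rewrite -!coordinate_wD.
have M2xy : mixedv a b c d (wD a b c d 1 1 u2) (wD a b c d 2 1 u2) (wD a b c d 1 2 u2) h2.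
  by move=> k; have [] := M2 k; rewrite -!coordinate_wD.
rewrite hE; split.
(* [calH1] and [calH2] unfold to the four products by conversion; each is replaced by its block
   form, and the block rows are then matched one by one. *)
- apply: (etrans _ (esym (congr2 (fun X Y => X + Y) (congr2 (fun X Y => X + Y)
    (congr2 (fun X Y => X + Y) (H00_mul _ _ _ _ _ _ _ _ _)
      (intv_H01 c d (vint_xtr ab cd M1) (vint_xtr ab cd M2x) (vint_xtr ab cd M2xy)))
    (intv_H02 a b (vint_ytr ab cd M1) (vint_ytr ab cd M2y) (vint_ytr ab cd M2xy)))
    (intv_H03 a b c d h0 h1 h2)))).
  rewrite !add_col5; apply: eq_col5.
  + exact: Lambda1_mixed.
  + exact: Lambda1_mixed2.
  + exact: (Lambda1_mixed2_dx ab cd M2x M2xy).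
  + exact: (Lambda1_mixed2_dy ab cd M2y M2xy).
  + exact: Lambda1_mixed.
- apply: filterS3 (Lambda2_mixed ab cd M1) (Lambda2_mixed2 ab cd M2x M2xy)
    (Lambda2_mixed ab cd M2xy) => x E1 E2 E3 xab.
  apply: (etrans _ (esym (congr2 (fun X Y => X + Y) (H11_mul _ _ _ _ _)
    (intv_H13 c d (fun y => h0 (x, y)) (fun y => h1 (x, y)) (fun y => h2 (x, y)))))).
  by rewrite add_col3; exact: (eq_col3 (E1 _) (E2 _) (E3 _)).
- apply: filterS3 (Lambda3_mixed ab cd M1) (Lambda3_mixed2 ab cd M2y M2xy)
    (Lambda3_mixed ab cd M2xy) => y E1 E2 E3 ycd.
  (* [H22] and [H23] are convertible to [H11] and [H13] with [a], [b] in place of [c], [d], so the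
     same product lemmas apply. *)
  apply: (etrans _ (esym (congr2 (fun X Y => X + Y) (H11_mul _ _ _ _ _)
    (intv_H13 a b (fun x => h0 (x, y)) (fun x => h1 (x, y)) (fun x => h2 (x, y)))))).
  by rewrite add_col3; exact: (eq_col3 (E1 _) (E2 _) (E3 _)).
Qed.
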